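(* Let $\mathcal C$ be a class of topological semigroups such that $\mathsf{T_{z}S}\subseteq\mathcal C\subseteq\mathsf{T_{2}S}$. A commutative semigroup $X$ is injectively $\mathcal C$-closed if and only if $X$ is bounded, chain-finite, group-finite, nonsingular and not Clifford-singular.
   Context: A topological semigroup is a topological space endowed with a continuous associative binary operation. $\mathsf{T_{2}S}$ is the class of Hausdorff topological semigroups; $\mathsf{T_{z}S}$ is the class of Hausdorff zero-dimensional topological semigroups, where a space is zero-dimensional if it has a base of clopen sets. A (discrete) semigroup $X$ is injectively $\mathcal C$-closed if, $X$ being endowed with the discrete topology, for every injective homomorphism $h:X\to Y$ to a topological semigroup $Y\in\mathcal C$ the image $h[X]$ is closed in $Y$. For a semigroup $X$, $E(X)=\{x\in X: xx=x\}$ is the set of idempotents; for $e\in E(X)$, $H_e$ is the maximal subgroup of $X$ containing $e$; the Clifford part is $H(X)=\bigcup_{e\in E(X)}H_e$. For $A\subseteq X$, $AA=\{ab:a,b\in A\}$. A semigroup $X$ is called: - bounded if there exists $n\in\mathbb N$ (positive) such that $x^n$ is an idempotent for every $x\in X$; - chain-finite if every infinite set $I\subseteq X$ contains elements $x,y\in I$ with $xy\notin\{x,y\}$; - group-finite if every subgroup of $X$ is finite; - singular if there exists an infinite set $A\subseteq X$ such that $AA$ is a singleton, and nonsingular otherwise; - Clifford-singular if there exists an infinite set $A\subseteq X\setminus H(X)$ such that $AA\subseteq H(X)$. *)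

(* Defs.v *)
From HB Require Import structures.
From mathcomp Require Import all_boot all_order all_algebra.
From mathcomp Require Import all_classical.
From mathcomp Require Import topology.

Set Implicit Arguments.
Unset Strict Implicit.
Unset Printing Implicit Defensive.

Import Algebra.

Local Open Scope classical_set_scope.
Local Open Scope group_scope.

HB.mixin Record isTopologicalSemigroup Y of Topological Y & Semigroup Y := {
  mul_continuous : continuous (fun p : Y * Y => p.1 * p.2)
}.

#[short(type="topologicalSemigroupType")]
HB.structure Definition TopologicalSemigroup :=
  {Y of Topological Y & Semigroup Y & isTopologicalSemigroup Y}.

(* Not MathComp-Analysis's [zero_dimensional], which only asks that distinct
   points be separated by a clopen set. *)
Definition has_clopen_base (Y : topologicalType) : Prop :=
  exists2 B : set_system Y, B `<=` clopen & basis B.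

Definition T2S (Y : topologicalSemigroupType) : Prop := hausdorff_space Y.

Definition TzS (Y : topologicalSemigroupType) : Prop :=
  hausdorff_space Y /\ has_clopen_base Y.

(* [X] is discrete, so its homomorphisms to [Y] are all continuous. *)
Definition injectively_closed (C : topologicalSemigroupType -> Prop)
    (X : semigroupType) : Prop :=
  forall (Y : topologicalSemigroupType) (h : {multiplicative X -> Y}),
    C Y -> injective h -> closed (range h).

Section Semigroup.
Variable X : semigroupType.
Implicit Types (x y e : X) (A G : set X).

Definition idempotents : set X := [set e | e * e = e].

Definition is_subgroup G : Prop :=
  (forall x y, G x -> G y -> G (x * y)) /\
  exists2 e, G e & forall x, G x ->
    [/\ e * x = x, x * e = x & exists2 y, G y & x * y = e /\ y * x = e].

Definition is_maximal_subgroup e G : Prop :=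
  [/\ is_subgroup G, G e &
      forall G', is_subgroup G' -> G `<=` G' -> G' = G].

Definition Clifford_part : set X :=
  \bigcup_(e in idempotents) \bigcup_(G in is_maximal_subgroup e) G.

Definition mul_set A : set X := [set a * b | a in A & b in A].

(* For [0 < n], [iterop n *%g x x] is the power x^n; the library's [x ^+ n]
   needs a unit. *)
Definition bounded_semigroup : Prop :=
  exists2 n : nat, (0 < n)%N & forall x, idempotents (iterop n *%g x x).

Definition chain_finite : Prop :=
  forall A, infinite_set A ->
    exists x y, [/\ A x, A y & ~ [set x; y] (x * y)].

Definition group_finite : Prop := forall G, is_subgroup G -> finite_set G.

Definition singular : Prop :=
  exists2 A, infinite_set A & exists c, mul_set A = [set c].

Definition Clifford_singular : Prop :=
  exists A, [/\ infinite_set A, A `<=` ~` Clifford_part &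
    mul_set A `<=` Clifford_part].

End Semigroup.

Arguments bounded_semigroup : clear implicits.
Arguments chain_finite : clear implicits.
Arguments group_finite : clear implicits.
Arguments singular : clear implicits.
Arguments Clifford_singular : clear implicits.

(* Main.v *)
(* Write [pi x] for the idempotent power of [x], and call [x] Clifford when
   [pi x * x = x].

   Sufficiency. Let [h (w i)] converge to [a] along an ultrafilter. In a
   chain-finite semigroup the idempotents [pi (w i)] have a limit [l], and [h l]
   is the idempotent power of [a]. If the [w i] are Clifford, the finiteness of
   the group at [l] gives [a] in [h X]. Otherwise the products [w i * w j] are
   treated by induction on idempotents, and nonsingularity and Clifford
   nonsingularity force [w] to be constant on a large set.

   Necessity. If a filter on [X] converges along enough homomorphisms to
   zero-dimensional semigroups to separate the points of [X] and to exclude each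
   of them as a limit, then the image of [X] in the product of the targets is not
   closed. The homomorphisms are those to discrete quotients (translations by an
   idempotent, Rees quotients, coset maps), where the filter becomes constant,
   and an extension of [X] in which its limit is adjoined: an ultrafilter [u]
   with [u u] equal to [u] or principal (singular, chain and Clifford-singular
   sets), the filter of the [x ^ k] with [n!] dividing [k] (elements of infinite
   order), and a limit of elements whose orders grow fast along a sequence of
   subgroups or of incomparable idempotents (unbounded orders). An infinite
   group of prime exponent has enough subgroups of index [p] for the discrete
   quotients to suffice. That the powers [x ^ n] with a fixed [n] are Clifford
   then follows algebraically. *)

From HB Require Import structures.
Require Import Defs.
From mathcomp Require Import all_boot all_order all_algebra.
From mathcomp Require Import all_classical.
From mathcomp Require Import topology.
From mathcomp Require Import zify.

Set Implicit Arguments.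
Unset Strict Implicit.
Unset Printing Implicit Defensive.

Import Algebra.

Local Open Scope classical_set_scope.
Local Open Scope group_scope.

(** Chain-finiteness enters only through idempotents, ordered by [s * t = s]: it excludes infinite
    chains, so the order is well-founded in both directions. Every induction, infimum and limit of
    idempotents comes from this. Nonsingularity and Clifford nonsingularity are used as constancy
    statements: when a family is not constant along an ultrafilter, a Ramsey-type extraction yields
    a forbidden infinite set. In the necessity part, the extension that contains the new limit often
    exists only after a part of [X] has been collapsed, and the collapsed points must still be
    separated by discrete quotients along which the same filter is constant. This shapes the choice
    of the filter: one works at a minimal idempotent, or with an antichain of idempotents, or
    replaces a sequence by its quotients [x_i^-1 x_j], which eventually fix the points lying
    below. *)

Section Ultrafilters.
Variable I : choiceType.
Implicit Types (A B : set I) (u : set_system I).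

Lemma free_ultrafilter A : infinite_set A ->
  exists u, [/\ UltraFilter u, u A & forall B, finite_set B -> ~ u B].
Proof.
move=> Ainf; pose F : set_system I := [set Q | finite_set (A `\` Q)].
have FF : ProperFilter F.
  apply: Build_ProperFilter_ex.
    move=> Q FQ; have /infinite_setN0[x [Ax Qx]] := infinite_setD Ainf FQ.
    by exists x; apply: contrapT => nQ; apply: Qx.
  split; first by rewrite /F /= setDT; exact: finite_set0.
    by move=> P Q FP FQ; rewrite /F /= setDIr finite_setU.
  by move=> P Q PQ; apply: sub_finite_set; apply: setDS.
have [u [uu Fu]] := ultraFilterLemma FF.
exists u; split=> //; first by apply: Fu; rewrite /F /= setDv; exact: finite_set0.
move=> B Bfin uB; have uCB : u (~` B).
  by apply: Fu; rewrite /F /= setDE setCK; apply: finite_setI; right.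
by have /filter_ex[x []] : u (B `&` ~` B) by exact: filterI.
Qed.

Lemma ultraN u A : UltraFilter u -> ~ u A -> u (~` A).
Proof. by move=> uu nA; have [] := in_ultra_setVsetC A uu. Qed.

Lemma ultra_ex2 u A B : UltraFilter u -> u A -> u B -> exists i, A i /\ B i.
Proof.
by move=> uu uA uB; have /filter_ex[i []] : u (A `&` B) by [exact: filterI]; exists i.
Qed.

Lemma ultra_ex3 u A B D : UltraFilter u -> u A -> u B -> u D ->
  exists i, [/\ A i, B i & D i].
Proof.
move=> uu uA uB uD.
have [|i [? []]] := @ultra_ex2 u A (B `&` D) uu uA; first exact: filterI.
by exists i.
Qed.

Lemma ultra_finite (T : eqType) u (f : I -> T) (B : set T) : UltraFilter u ->
  finite_set B -> u [set i | B (f i)] -> exists2 b, B b & u [set i | f i = b].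
Proof.
move=> uu /finite_seqP[s ->]; elim: s => [|b s IHs] us.
  by have /filter_ex[] := us.
have [ub|/ultraN nub] := pselect (u [set i | f i = b]).
  by exists b => //=; rewrite inE eqxx.
have [|c sc uc] := IHs; last by exists c => //=; rewrite inE sc orbT.
by apply: filterS2 us nub => i /=; rewrite inE => /orP[/eqP|].
Qed.

(** A Ramsey-type extraction: each new term is taken from the intersection of the finitely many
    large sets attached to the terms already chosen. *)
Lemma ultra_sequence u (Q : set I) (R : I -> I -> Prop) : UltraFilter u ->
  u Q -> u [set i | u [set j | R i j]] ->
  exists s : nat -> I, (forall n, Q (s n)) /\
    forall m n, (m < n)%N -> R (s m) (s n).
Proof.
move=> uu uQ uR; pose P := Q `&` [set i | u [set j | R i j]].
pose good (l : seq I) := forall i, i \in l -> P i.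
have next l : exists j, good l -> P j /\ forall i, i \in l -> R i j.
  have [gl|] := pselect (good l); last first.
    have /filter_ex[j _] := uQ; by exists j.
  have /filter_ex[j [Pj Rj]] : u (P `&` [set j | forall i, i \in l -> R i j]).
    apply: filterI; first exact: filterI.
    elim: l gl => [|i l IHl] gl; first by apply: filterS filterT => j _ i.
    have uj := (gl i (mem_head _ _)).2.
    have /IHl ul : good l by move=> k kl; apply: gl; rewrite inE kl orbT.
    apply: filterS2 uj ul => j Rij lj k.
    by rewrite inE => /orP[/eqP ->|/lj].
  by exists j.
pose f l := sval (cid (next l)).
have fP l : good l -> P (f l) /\ forall i, i \in l -> R i (f l).
  exact: svalP (cid (next l)).
pose L n := iter n (fun l => f l :: l) [::].
have gL n : good (L n).
  elim: n => [|n IHn] i //=; rewrite inE => /orP[/eqP ->|/IHn//].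
  by have [] := fP _ IHn.
exists (fun n => f (L n)); split=> [n|m n mn]; first by have [[]] := fP _ (gL n).
have [_] := fP _ (gL n); apply; elim: n mn => // n IHn.
by rewrite ltnS leq_eqVlt /= inE => /orP[/eqP ->|/IHn ->]; rewrite ?eqxx ?orbT.
Qed.

End Ultrafilters.

Lemma infinite_range (T : Type) (s : nat -> T) :
  (forall m n, (m < n)%N -> s m <> s n) -> infinite_set (range s).
Proof.
move=> s_inj; rewrite (eq_finite_set (inj_card_eq _)); first exact: infinite_nat.
move=> m n _ _ smn; have [mn|nm|//] := ltngtP m n.
  by case: (s_inj _ _ mn).
by case: (s_inj _ _ nm).
Qed.

(** * Idempotents and the Clifford part *)

Section CommutativeSemigroup.
Variable X : semigroupType.
Hypothesis mulC : forall x y : X, x * y = y * x.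
Implicit Types (x y z e s t : X) (A G D : set X).

Lemma mulAC x y z : x * y * z = x * z * y.
Proof. by rewrite -!mulgA (mulC y). Qed.

Lemma mulCA x y z : x * (y * z) = y * (x * z).
Proof. by rewrite !mulgA (mulC x). Qed.

Lemma mulACA x y z t : x * y * (z * t) = x * z * (y * t).
Proof. by rewrite !mulgA (mulAC x). Qed.

(* [pw x 0] is the junk value [x]. *)
Definition pw x n : X := iterop n *%g x x.

Lemma pwS x n : (0 < n)%N -> pw x n.+1 = x * pw x n.
Proof. by case: n. Qed.

Lemma pwSS x n : pw x n.+2 = x * pw x n.+1. Proof. by []. Qed.

Lemma pwD x m n : (0 < m)%N -> (0 < n)%N -> pw x (m + n) = pw x m * pw x n.
Proof.
case: m => // m _ n0; elim: m => [|m IHm]; first by rewrite add1n pwS.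
by rewrite addSn pwS ?addSn // -addSn IHm mulgA -pwS.
Qed.

Lemma pw_mul x n m : (0 < m)%N -> (0 < n)%N -> pw (pw x m) n = pw x (m * n).
Proof.
move=> m0; case: n => // n _; elim: n => [|n IHn]; first by rewrite muln1.
by rewrite pwS // IHn [in RHS]mulnS pwD // muln_gt0 m0.
Qed.

Lemma pwM x y n : pw (x * y) n = pw x n * pw y n.
Proof.
case: n => // n; elim: n => // n IHn.
by rewrite !pwSS IHn mulACA.
Qed.

Lemma pw_idem e n : idempotents e -> pw e n = e.
Proof. by move=> ee; case: n => // n; elim: n => // n IHn; rewrite pwSS IHn. Qed.

Lemma idemM e s : idempotents e -> idempotents s -> idempotents (e * s).
Proof. by rewrite /idempotents /= => ee ss; rewrite mulACA ee ss. Qed.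

Lemma mul_idem e x : idempotents e -> e * (e * x) = e * x.
Proof. by move=> ee; rewrite mulgA ee. Qed.

Definition periodic := forall x, exists2 n, (0 < n)%N & idempotents (pw x n).

Lemma bounded_periodic : bounded_semigroup X -> periodic.
Proof. by move=> [n n0 nE] x; exists n => //; exact: nE. Qed.

(* The idempotent power of [x], when there is one. *)
Definition pi x : X := xget x [set e | idempotents e /\
  exists2 n, (0 < n)%N & e = pw x n].

(* [x] lies in the Clifford part, see [Clifford_partE]. *)
Definition clf x : Prop := pi x * x = x.

Definition Hc e : set X := [set x | clf x /\ pi x = e].

(** Both sides equal the power with exponent [m * n], since an idempotent equals its own powers. *)
Lemma idem_pw_eq x m n : (0 < m)%N -> (0 < n)%N ->
  idempotents (pw x m) -> idempotents (pw x n) -> pw x m = pw x n.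
Proof.
move=> m0 n0 Em En.
by rewrite -[LHS](pw_idem n) // -[RHS](pw_idem m) // !pw_mul // mulnC.
Qed.

Hypothesis per : periodic.

Lemma pi_prop x : idempotents (pi x) /\ exists2 n, (0 < n)%N & pi x = pw x n.
Proof.
rewrite /pi; case: xgetP => [e _ //|nE]; have [n n0 En] := per x.
by case: (nE (pw x n)); split=> //; exists n.
Qed.

Lemma pi_idem x : idempotents (pi x). Proof. by have [] := pi_prop x. Qed.

Lemma pi_pi x : pi x * pi x = pi x. Proof. exact: pi_idem. Qed.

Lemma pi_pw x : exists2 n, (0 < n)%N & pw x n = pi x.
Proof. by have [_ [n n0 ->]] := pi_prop x; exists n. Qed.

Lemma pi_eq x n : (0 < n)%N -> idempotents (pw x n) -> pi x = pw x n.
Proof.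
move=> n0 En; have [_ [m m0 Em]] := pi_prop x; rewrite Em.
by apply: idem_pw_eq => //; rewrite -Em; exact: pi_idem.
Qed.

Lemma pi_id e : idempotents e -> pi e = e.
Proof. by move=> ee; rewrite (@pi_eq e 1). Qed.

Lemma piM x y : pi (x * y) = pi x * pi y.
Proof.
have [m m0 mx] := pi_pw x; have [n n0 ny] := pi_pw y.
have mn0 : (0 < m * n)%N by rewrite muln_gt0 m0.
have Exy : pw (x * y) (m * n) = pi x * pi y.
  rewrite pwM -pw_mul // mx pw_idem; last exact: pi_idem.
  by rewrite mulnC -pw_mul // ny pw_idem //; exact: pi_idem.
by rewrite (pi_eq mn0) Exy //; apply: idemM; exact: pi_idem.
Qed.

Lemma pi_pwn x n : pi (pw x n) = pi x.
Proof.
case: n => // n; elim: n => // n IHn.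
by rewrite pwSS piM IHn pi_pi.
Qed.

Lemma pi_mul x : pi (pi x) = pi x.
Proof. exact: pi_id (pi_idem x). Qed.

Lemma clf_idem e : idempotents e -> clf e.
Proof. by move=> ee; rewrite /clf pi_id. Qed.

Lemma clfM x y : clf x -> clf y -> clf (x * y).
Proof. by rewrite /clf piM mulACA => -> ->. Qed.

Lemma clf_le e x : idempotents e -> e * pi x = e -> clf (e * x).
Proof. by move=> ee ex; rewrite /clf piM pi_id // ex mul_idem. Qed.

Lemma clf_pi_mul x : clf (pi x * x).
Proof. by apply: clf_le; [exact: pi_idem|exact: pi_pi]. Qed.

Lemma clf_pw x : clf x -> forall n, clf (pw x n).
Proof.
by move=> cx [|n] //; elim: n => // n IHn; rewrite pwSS; exact: clfM.
Qed.

Lemma clf_pw_le x m n : (0 < m)%N -> (m <= n)%N -> clf (pw x m) ->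
  clf (pw x n).
Proof.
move=> m0; rewrite leq_eqVlt => /orP[/eqP <- //|mn] cm.
rewrite -(subnKC mn) addSnnS pwD // /clf piM !pi_pwn pi_pi mulgA.
by move: cm; rewrite /clf pi_pwn => ->.
Qed.

Lemma clf_pw_ex x : exists2 n, (0 < n)%N & clf (pw x n).
Proof.
by have [n n0 nx] := pi_pw x; exists n => //; rewrite nx; exact/clf_idem/pi_idem.
Qed.

Lemma clf_inv x : clf x -> exists y, [/\ clf y, pi y = pi x & x * y = pi x].
Proof.
move=> cx; have [n n0 nx] := pi_pw x; exists (pw x (n + n).-1); split.
- exact: clf_pw.
- exact: pi_pwn.
- by rewrite -pwS ?prednK ?pwD ?nx ?pi_pi //; lia.
Qed.

Lemma Hc_id e : idempotents e -> Hc e e.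
Proof. by move=> ee; split; [exact: clf_idem|exact: pi_id]. Qed.

Lemma HcM e x y : Hc e x -> Hc e y -> Hc e (x * y).
Proof.
move=> [cx xe] [cy ye]; split; first exact: clfM.
by rewrite piM xe ye -xe pi_pi.
Qed.

Lemma Hc_subgroup e : idempotents e -> is_subgroup (Hc e).
Proof.
move=> ee; split; first by move=> x y; exact: HcM.
exists e => [|x [cx xe]]; first exact: Hc_id.
have [y [cy yx xy]] := clf_inv cx; split; rewrite -?xe 1?(mulC x) //.
by exists y; [split=> //; rewrite yx|rewrite xy mulC].
Qed.

(** A subgroup has only one idempotent, and it contains [pi x], a power of [x]. *)
Lemma subgroup_Hc e G : is_subgroup G -> idempotents e -> G e -> G `<=` Hc e.
Proof.
move=> [GM [e' Ge' Gid]].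
have idG f : idempotents f -> G f -> f = e'.
  move=> ff Gf; have [ef _ [y Gy [fy _]]] := Gid _ Gf.
  by rewrite -fy -[in RHS]ff -mulgA fy mulC ef.
move=> ee Ge x Gx; have [ex _ _] := Gid _ Gx; rewrite (idG _ ee Ge).
suff pe : pi x = e' by split; rewrite // /clf pe.
have Gpw n : G (pw x n).
  by case: n => // n; elim: n => // n IHn; rewrite pwSS; exact: GM.
by have [n n0 nx] := pi_pw x; apply: idG; [exact: pi_idem|rewrite -nx].
Qed.

Lemma Clifford_partE x : Clifford_part x <-> clf x.
Proof.
split=> [[e ee [G [Gs Ge _] Gx]]|cx]; first by have [] := subgroup_Hc Gs ee Ge Gx.
exists (pi x); first exact: pi_idem.
exists (Hc (pi x)) => //; split.
- exact/Hc_subgroup/pi_idem.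
- exact/Hc_id/pi_idem.
- move=> G Gs sG; apply/seteqP; split=> //; apply: subgroup_Hc => //.
  exact: pi_idem.
  by apply: sG; exact/Hc_id/pi_idem.
Qed.

Lemma group_finiteP : group_finite X <-> forall e, finite_set (Hc e).
Proof.
split=> [gf e|Hf G Gs].
  have [ee|ne] := pselect (idempotents e); first exact/gf/Hc_subgroup.
  rewrite (_ : Hc e = set0); first exact: finite_set0.
  by rewrite -subset0 => x [_ xe]; apply: ne; rewrite -xe; exact: pi_idem.
have [GM [e Ge Gid]] := Gs; have [ee _ _] := Gid _ Ge.
exact: sub_finite_set (subgroup_Hc Gs ee Ge) (Hf e).
Qed.

(** * The order of idempotents in a chain-finite semigroup *)

Hypothesis cf : chain_finite X.

Lemma no_idem_chain (s : nat -> X) : (forall n, idempotents (s n)) ->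
  (forall m n, (m < n)%N -> s m <> s n /\
    (s m * s n = s m \/ s m * s n = s n)) -> False.
Proof.
move=> sE sP; have [|x [y [[m _ <-] [n _ <-]]]] := cf (infinite_range (s := s) _).
  by move=> m n /sP[].
apply; have [mn|nm|->] := ltngtP m n.
- by have [_ [->|->]] := sP _ _ mn; [left|right].
- by rewrite mulC; have [_ [->|->]] := sP _ _ nm; [right|left].
- by left; exact: sE.
Qed.

(** An infinite [R]-descent would be an infinite chain of idempotents. [R] stays abstract so as to
    cover both the strict order and its converse. *)
Lemma no_descent D (R : X -> X -> Prop) :
  (forall t, D t -> idempotents t) ->
  (forall t s, R s t -> s <> t /\ (s * t = s \/ s * t = t)) ->
  (forall t s r, idempotents t -> idempotents s -> idempotents r ->
    R r s -> R s t -> R r t) ->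
  D !=set0 -> exists2 t, D t & forall s, D s -> ~ R s t.
Proof.
move=> DE Rle Rtr [t0 Dt0]; apply: contrapT => nmin.
have next t : exists s, D t -> D s /\ R s t.
  have [Dt|nDt] := pselect (D t); last by exists t.
  apply: contrapT => nex; apply: nmin; exists t => // s Ds Rst.
  by apply: nex; exists s.
pose f t := sval (cid (next t)); pose s n := iter n f t0.
have fP t : D t -> D (f t) /\ R (f t) t by exact: svalP (cid (next t)).
have sD n : D (s n) by elim: n => //= n /fP[].
have sR m n : (m < n)%N -> R (s n) (s m).
  elim: n => // n IHn; rewrite ltnS leq_eqVlt => /orP[/eqP ->|/IHn Rnm].
    by have [] := fP _ (sD n).
  by apply: (Rtr _ (s n)); try exact: DE; have [] := fP _ (sD n).
apply: (@no_idem_chain s) => [n|m n /sR/Rle[nmn]]; first exact: DE.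
by rewrite mulC => -[]->; split=> //; [apply/nesym| right|apply/nesym|left].
Qed.

Lemma idem_min D : D `<=` @idempotents X -> D !=set0 ->
  exists2 t, D t & forall s, D s -> s * t = s -> s = t.
Proof.
move=> DE D0; pose R s t := s <> t /\ s * t = s.
have [t s []|t s r tt ss rr [rs rsE] [st stE]|t Dt tmin] := @no_descent D R DE _ _ D0.
- by move=> ? ?; split=> //; left.
- rewrite /R; split=> [rt|]; last by rewrite -rsE -mulgA stE.
  by apply: st; rewrite -stE mulC -rt rsE.
- by exists t => // s Ds st; apply: contrapT => nst; case: (tmin s).
Qed.

Lemma idem_max D : D `<=` @idempotents X -> D !=set0 ->
  exists2 t, D t & forall s, D s -> t * s = t -> s = t.
Proof.
move=> DE D0; pose R s t := s <> t /\ t * s = t.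
have [t s []|t s r tt ss rr [rs rsE] [st stE]|t Dt tmax] := @no_descent D R DE _ _ D0.
- by move=> ? E; split=> //; right; rewrite mulC.
- rewrite /R; split=> [rt|]; last by rewrite -stE -mulgA rsE.
  by apply: rs; rewrite rt -stE -rt mulC rsE.
- by exists t => // s Ds st; apply: contrapT => nst; case: (tmax s).
Qed.

(** * Constancy along an ultrafilter *)

Section Ultra.
Variables (I : choiceType) (u : set_system I).
Hypothesis uu : UltraFilter u.
Implicit Types (f w : I -> X).

Definition ucst (T : Type) (v : I -> T) := exists c, u [set i | v i = c].

(** [t] is the infimum of the [f i] with [i] in [P]: a minimal idempotent above all their lower
    bounds. The set of such idempotents is stable under multiplication by these [f i], so minimality
    puts [t] below each of them. *)
Lemma idem_inf f (P : set I) : (forall i, idempotents (f i)) -> P !=set0 ->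
  exists t, [/\ idempotents t, forall i, P i -> t * f i = t &
    forall s, (forall i, P i -> s * f i = s) -> s * t = s].
Proof.
move=> eE [i0 Pi0]; pose D : set X := [set t | idempotents t /\
  forall s, (forall i, P i -> s * f i = s) -> s * t = s].
have [||t [tE tP] tmin] := @idem_min D; first by move=> t [].
  by exists (f i0); split=> // s; exact.
exists t; split=> // i Pi; apply: tmin; last by rewrite mulAC tE.
by split=> [|s sP]; [exact: idemM|rewrite mulgA tP // sP].
Qed.

(* In the compact topology of [E] generated by the sets [{t | s <= t}] and their
   complements, [l] is the limit of [f] along [u]. *)
Lemma idem_lim f : (forall i, idempotents (f i)) ->
  exists l, [/\ idempotents l, u [set i | l * f i = l] &
    forall s, u [set i | s * f i = s] -> s * l = s].
Proof.
move=> eE; pose D : set X := [set t | idempotents t /\ u [set i | t * f i = t]].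
have DP P : u P -> exists2 t, D t & forall s, (forall i, P i -> s * f i = s) -> s * t = s.
  move=> uP; have [t [tE tP ?]] := idem_inf eE (filter_ex uP).
  by exists t => //; split=> //; exact: filterS uP.
have [||l [lE ul] lmax] := @idem_max D; first by move=> t [].
  by have [t Dt _] := DP _ (filterT : u setT); exists t.
exists l; split=> // s us.
(* The infimum over the indices at which both [l] and [s] lie below [f i]; it is above [l], hence
   equal to [l] by maximality, and it is above [s]. *)
have [t Dt tP] := DP _ (filterI ul us).
by rewrite -(lmax t) // tP // => i [].
Qed.

(** Otherwise most pairs are distinct and comparable, and an infinite chain can be extracted. *)
Lemma antichain_ultra f : (forall i, idempotents (f i)) -> ~ ucst f ->
  u [set i | u [set j | f i * f j <> f i /\ f i * f j <> f j]].
Proof.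
move=> eE ncst; apply: contrapT => /ultraN nu.
have [||s [_ sR]] := @ultra_sequence _ u setT
    (fun i j => f i <> f j /\ (f i * f j = f i \/ f i * f j = f j)) uu.
- exact: filterT.
- apply: filterS nu => i /= /ultraN un.
  have une : u [set j | f i <> f j].
    by apply: ultraN => ue; apply: ncst; exists (f i); apply: filterS ue => j.
  apply: filterS2 une un => j /= ij nj; split=> //.
  by apply: contrapT => /not_orP[? ?]; apply: nj.
by apply: (@no_idem_chain (f \o s)) => // n; exact: eE.
Qed.

(** If [w] is not constant on a large set, one extracts infinitely many distinct terms all of whose
    products, squares included, are [c]. *)
Lemma nonsingular_ultra w (c : X) : ~ singular X ->
  u [set i | w i * w i = c] -> u [set i | u [set j | w i * w j = c]] -> ucst w.
Proof.
move=> ns wc wwc; apply: contrapT => ncst; apply: ns.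
have [|s [sc sR]] := @ultra_sequence _ u [set i | w i * w i = c]
    (fun i j => w i <> w j /\ w i * w j = c) uu wc.
  apply: filterS wwc => i wi; apply: filterI wi; apply: ultraN => ue.
  by apply: ncst; exists (w i); apply: filterS ue => j.
exists (range (w \o s)); first by apply: infinite_range => m n /sR[].
exists c; apply/seteqP; split=> [_ [_ [m _ <-] [_ [n _ <-] <-]]|_ ->] /=.
  have [mn|nm|->] := ltngtP m n; first by have [] := sR _ _ mn.
    by rewrite mulC; have [] := sR _ _ nm.
  exact: sc.
by exists (w (s 0%N)); [exists 0%N|exists (w (s 0%N)); [exists 0%N|exact: sc]].
Qed.

Lemma clifford_nonsingular_ultra w : ~ Clifford_singular X ->
  u [set i | ~ clf (w i)] -> u [set i | clf (w i * w i)] ->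
  u [set i | u [set j | clf (w i * w j)]] -> ucst w.
Proof.
move=> ncs nw wc wwc; apply: contrapT => ncst; apply: ncs.
have [|s [sc sR]] := @ultra_sequence _ u
    ([set i | ~ clf (w i)] `&` [set i | clf (w i * w i)])
    (fun i j => w i <> w j /\ clf (w i * w j)) uu (filterI nw wc).
  apply: filterS wwc => i wi; apply: filterI wi; apply: ultraN => ue.
  by apply: ncst; exists (w i); apply: filterS ue => j.
exists (range (w \o s)); split.
- by apply: infinite_range => m n /sR[].
- by move=> _ [n _ <-] /=; rewrite Clifford_partE; have [] := sc n.
move=> _ [_ [m _ <-] [_ [n _ <-] <-]]; apply/Clifford_partE => /=.
have [mn|nm|->] := ltngtP m n; first by have [] := sR _ _ mn.
  by rewrite mulC; have [] := sR _ _ nm.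
by have [] := sc n.
Qed.

(* If [s s w_i = d] for all [i] in a large set [P], then [(s w_i) (s w_j)], which
   is [d w_j] and [d w_i], does not depend on [i, j] in [P]. *)
Lemma nonsingular_sq w s : ~ singular X ->
  ucst (fun i => s * s * w i) -> ucst (fun i => s * w i).
Proof.
move=> ns [d ud]; have /filter_ex[k kd] := ud.
have dE i : s * s * w i = d -> d * w i = d * w k.
  by rewrite /= in kd => id; rewrite -{1}kd mulAC id.
have sE i j : s * s * w i = d -> s * s * w j = d ->
    s * w i * (s * w j) = d * w k.
  by move=> id jd; rewrite mulACA mulgA id; exact: dE.
apply: (nonsingular_ultra (c := d * w k) ns).
  by apply: filterS ud => i id; exact: sE.
by apply: filterS (ud) => i id; apply: filterS ud => j jd; exact: sE.
Qed.

Lemma pi_mul_pw s : exists2 N, (0 < N)%N &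
  forall n, (N <= n)%N -> pi s * pw s n = pw s n.
Proof.
have [N N0 sN] := clf_pw_ex s; exists N => // n Nn.
by have := clf_pw_le N0 Nn sN; rewrite /clf pi_pwn.
Qed.

(** For large [N] the power [pw s (2 ^ N)] absorbs [pi s], so its products with [w] are constant;
    [nonsingular_sq] then removes one squaring at a time. *)
Lemma nonsingular_pi w s : ~ singular X ->
  ucst (fun i => pi s * w i) -> ucst (fun i => s * w i).
Proof.
move=> ns [d ud]; have [N N0 sN] := pi_mul_pw s.
have : ucst (fun i => pw s (2 ^ N) * w i).
  exists (pw s (2 ^ N) * d); apply: filterS ud => i /= <-.
  rewrite mulgA (mulC _ (pi s)) sN //; exact/ltnW/ltn_expl.
elim: N {sN N0} => // N IHN; rewrite expnS mul2n -addnn pwD ?expn_gt0 //.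
by move=> /(nonsingular_sq ns).
Qed.

Lemma Hc_ucst w e : finite_set (Hc e) -> u [set i | Hc e (w i)] -> ucst w.
Proof. by move=> ef ue; have [c _ uc] := ultra_finite uu ef ue; exists c. Qed.

End Ultra.
(** * Sufficiency *)

Section Closed.
Hypothesis Hc_fin : forall e, finite_set (Hc e).
Hypothesis ns : ~ singular X.
Hypothesis ncs : ~ Clifford_singular X.
Variable n : nat.
Hypothesis n_gt0 : (0 < n)%N.
Hypothesis pw_n : forall x, idempotents (pw x n).
Variables (Y : topologicalSemigroupType) (h : {multiplicative X -> Y}).
Hypothesis haus : hausdorff_space Y.
Hypothesis h_inj : injective h.
Variables (I : choiceType) (u : set_system I).
Hypothesis uu : UltraFilter u.
Implicit Types (w v : I -> X) (a b : Y).

Definition hlim w a := (h \o w) @ u --> a.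

Lemma cvg_mul (f g : I -> Y) a b : f @ u --> a -> g @ u --> b ->
  (fun i => f i * g i) @ u --> a * b.
Proof.
move=> fa gb.
exact: (@continuous2_cvg I Y Y Y u _ f g ( *%g) a b (@mul_continuous Y (a, b)) fa gb).
Qed.

Lemma hlimM w v a b : hlim w a -> hlim v b ->
  hlim (fun i => w i * v i) (a * b).
Proof.
move=> wa vb; have := cvg_mul wa vb; rewrite /hlim.
by under eq_fun do rewrite -gmulfM.
Qed.

Lemma cvg_uniq (f : I -> Y) a b : f @ u --> a -> f @ u --> b -> a = b.
Proof. by move=> fa fb; apply: (cvg_unique haus fa fb). Qed.

Lemma hlim_cst w c : u [set i | w i = c] -> hlim w (h c).
Proof. by move=> uc; apply: cvg_near_cst; apply: filterS uc => i /= ->. Qed.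

Lemma hlim_pw w a k : hlim w a -> exists b, hlim (fun i => pw (w i) k) b.
Proof.
move=> wa; case: k => [|k]; first by exists a.
elim: k => [|k [b IHk]]; first by exists a.
by exists (a * b); exact: hlimM.
Qed.

Lemma pw_nE x : pw x n = pi x. Proof. by rewrite (pi_eq n_gt0). Qed.

(** The topological limit of idempotents agrees with their limit in the order. Given neighbourhoods
    of [eps] and [h l], take a minimal idempotent [t] with [h t] and [h t * eps] in a suitable open
    set. For most [i] the product [t * w i] has the same properties, so minimality gives
    [t * w i = t]. Hence [t * l = t], and [h t] lies in both neighbourhoods. *)
Lemma hlim_idem w eps l : (forall i, idempotents (w i)) -> hlim w eps ->
  u [set i | l * w i = l] ->
  (forall s, u [set i | s * w i = s] -> s * l = s) -> eps = h l.
Proof.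
move=> wE weps lw lP.
have epsE : eps * eps = eps.
  apply: (cvg_uniq _ weps); have := hlimM weps weps.
  by rewrite /hlim; under eq_fun do rewrite /comp /= wE.
have <- : eps * h l = h l.
  have ll : hlim (fun=> l) (h l) by exact: cvg_cst.
  apply: (cvg_uniq (hlimM weps ll)); apply: hlim_cst.
  by apply: filterS lw => i /= {2}<-; rewrite mulC.
have mull_nbhs (a b : Y) B : nbhs (a * b) B -> nbhs a [set x : Y | B (x * b)].
  have : (fun x : Y => x * b) @ a --> a * b.
    exact: (@continuous2_cvg Y Y Y Y (nbhs a) _ id (fun=> b) ( *%g) a b
      (@mul_continuous Y (a, b)) cvg_id (cvg_cst b)).
  by move=> ab nB; exact: ab.
apply: haus => A B nA nB.
have : nbhs eps (A `&` [set x : Y | B (x * h l)]).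
  by apply: filterI => //; exact: mull_nbhs.
rewrite nbhsE => -[O [Oo Oeps] OAB].
pose D : set X := [set t | [/\ idempotents t, O (h t) & O (h t * eps)]].
have hO t : O (h t * eps) -> u [set i | O (h (t * w i))].
  move=> Ot; have : (fun i => h t * h (w i)) @ u --> h t * eps.
    by apply: (@cvg_mul (fun=> h t) (h \o w)) => //; exact: cvg_cst.
  move=> tO; have {tO} : u [set i | O (h t * h (w i))].
    exact: (tO O (open_nbhs_nbhs (conj Oo Ot))).
  by apply: filterS => i /=; rewrite gmulfM.
have hO' t : O (h t * eps) -> u [set i | O (h (t * w i) * eps)].
  move=> Ot; have : (fun i => h t * h (w i)) @ u --> h t * eps.
    by apply: (@cvg_mul (fun=> h t) (h \o w)) => //; exact: cvg_cst.
  have nO : nbhs (h t * eps) [set x : Y | O (x * eps)].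
    by apply: mull_nbhs; rewrite -mulgA epsE; exact: open_nbhs_nbhs.
  move=> tO; have {tO} : u [set i | O (h t * h (w i) * eps)] by exact: (tO _ nO).
  by apply: filterS => i /=; rewrite gmulfM.
have [||t [tE Ot Oteps] tmin] := @idem_min D; first by move=> t [].
  have O1 : u [set i | O (h (w i))].
    by apply: weps; exact: open_nbhs_nbhs.
  have O2 : u [set i | O (h (w i) * eps)].
    apply: (weps [set x : Y | O (x * eps)]); apply: mull_nbhs; rewrite epsE.
    exact: open_nbhs_nbhs.
  have [i [? ?]] := ultra_ex2 uu O1 O2.
  by exists (w i); split.
have tl : t * l = t.
  apply: lP; apply: filterS2 (hO t Oteps) (hO' t Oteps) => i O1 O2.
  by apply: tmin; [split=> //; exact: idemM|rewrite mulAC tE].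
have [At Bt] := OAB _ Ot; exists (h t); split=> //.
by move: Bt; rewrite /= -gmulfM tl.
Qed.

(** The elements [l * w i] lie in the finite group at [l], hence equal some [g] for most [i]. Then
    [h g = h l * a], and [h l], the limit of the [h (pi (w i))], fixes [a] because [pi (w i)] fixes
    [w i]. *)
Lemma hlim_clifford w a : u [set i | clf (w i)] -> hlim w a ->
  exists2 g, clf g & a = h g.
Proof.
move=> wc wa; have piE i : idempotents (pi (w i)) by exact: pi_idem.
have [l [lE lw lP]] := idem_lim uu piE.
have [eps weps] := hlim_pw n wa.
have {}weps : hlim (pi \o w) eps.
  by rewrite (_ : pi \o w = fun i => pw (w i) n) //; apply/funext => i /=; rewrite pw_nE.
have epsE := hlim_idem piE weps lw lP.
have [|g ug] := @Hc_ucst I u uu (fun i => l * w i) l (Hc_fin l).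
  apply: filterS lw => i /= lwi; split; first exact: clf_le.
  by rewrite piM pi_id.
have [i [gi li]] := ultra_ex2 uu ug lw; exists g; first by rewrite -gi; exact: clf_le.
have ll : hlim (fun=> l) (h l) by exact: cvg_cst.
have -> : h g = h l * a by apply: (cvg_uniq (hlim_cst ug)); exact: hlimM.
rewrite -epsE; apply: (cvg_uniq wa).
move: (hlimM weps wa); apply: cvg_trans; apply: near_eq_cvg.
by apply: filterS wc => j; rewrite /clf /= => ->.
Qed.

Lemma ucst_first_square w R : ucst u (fun i => pw (w i) (2 ^ R)) ->
  ucst u w \/ exists r, ~ ucst u (fun i => pw (w i) (2 ^ r)) /\
    ucst u (fun i => pw (w i) (2 ^ r) * pw (w i) (2 ^ r)).
Proof.
elim: R => [|R IHR]; first by left.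
have [/IHR //|ncst cst] := pselect (ucst u (fun i => pw (w i) (2 ^ R))).
right; exists R; split=> //; move: cst.
by under eq_fun do rewrite expnS mul2n -addnn pwD ?expn_gt0 //.
Qed.

(** Let [z] be the last nonconstant power of [w] in the sequence of repeated squares, so that
    [z i * z i = c] for most [i]. Since the group at [e] is finite, [z i * z j] has a constant value
    [g i] for most [j]. The products [g i * g j] are constant, so [g] is constant by nonsingularity,
    and comparing limits in [Y] identifies its value with [c]. A second use of nonsingularity makes
    [z] constant. *)
Lemma hlim_unipotent w a e : u [set i | pi (w i) = e] -> hlim w a -> ucst u w.
Proof.
move=> we wa; have ee : idempotents e.
  by have /filter_ex[i <-] := we; exact: pi_idem.
have cst_Hc v : u [set i | pi (v i) = e] -> ucst u (fun i => e * v i).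
  move=> ve; apply: (@Hc_ucst I u uu _ e) => //.
  apply: filterS ve => i /= <-; split; first exact: clf_pi_mul.
  by rewrite piM pi_mul pi_pi.
have cst_pi s v : pi s = e -> u [set i | pi (v i) = e] -> ucst u (fun i => s * v i).
  by move=> se ve; apply: nonsingular_pi => //; rewrite se; exact: cst_Hc.
have [||[r [ncst [c zc]]]] := @ucst_first_square w n; last 1 first.
- apply: contrapT => _; pose z i := pw (w i) (2 ^ r).
  have ze : u [set i | pi (z i) = e] by apply: filterS we => i; rewrite /= pi_pwn.
  have [b zb] := hlim_pw (2 ^ r) wa; rewrite -/z in zc ncst.
  have ce : pi c = e.
    have [i [zi <-]] := ultra_ex2 uu ze zc; rewrite piM [pi (z i)]zi; exact: ee.
  have bb : b * b = h c.
    by apply: cvg_uniq (hlim_cst zc); exact: hlimM.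
  have /choice[g gP] : forall i, exists d, pi (z i) = e -> u [set j | z i * z j = d].
    move=> i; have [zi|nzi] := pselect (pi (z i) = e); last by exists c.
    by have [d ud] := cst_pi _ _ zi ze; exists d.
  have [d cd] := cst_pi _ _ ce ze.
  have [k0 kd] := filter_ex cd; rewrite /= in kd.
  (* Choose one [k] good for both indices: [g i * g j = z i * z j * (z k * z k) = z i * (c * z j) =
     z i * d], which is then rewritten through [d = c * z k0]. *)
  have gg i j : pi (z i) = e -> c * z i = d -> pi (z j) = e -> c * z j = d ->
      g i * g j = d * z k0.
    move=> /gP gi ci /gP gj cj.
    have [k [<- <- kc]] := ultra_ex3 uu gi gj zc.
    rewrite mulACA [z k * z k]kc -mulgA (mulC (z j)) cj.
    by rewrite -{1}kd mulgA (mulC (z i)) ci.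
  have [c' gc'] : ucst u g.
    apply: (nonsingular_ultra uu (c := d * z k0) ns).
      by apply: filterS2 ze cd => i zi ci; exact: gg.
    by apply: filterS2 (ze) (cd) => i zi ci; apply: filterS2 ze cd => j; exact: gg.
  have c'c : c' = c.
    apply: h_inj; rewrite -bb; apply: cvg_uniq (hlim_cst gc') _.
    have bcst : (fun=> b) @ u --> b by exact: cvg_cst.
    move: (cvg_mul zb bcst); apply: cvg_trans; apply: near_eq_cvg.
    apply: filterS ze => i /= /gP gi; apply/esym/(cvg_uniq (hlim_cst gi)).
    by apply: hlimM => //; exact: cvg_cst.
  apply: ncst; apply: (nonsingular_ultra uu (c := c) ns) => //.
  by apply: filterS2 gc' ze => i /= gi /gP; rewrite gi c'c.
- have [b pib] := hlim_pw n wa.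
  have [d ud] := cst_Hc _ we.
  apply: (@Hc_ucst I u uu _ e) => //.
  apply: filterS we => i /= wi.
  split; last by rewrite pi_pwn.
  apply: (@clf_pw_le _ n) => //; first exact/ltnW/ltn_expl.
  by rewrite pw_nE; exact/clf_idem/pi_idem.
- by [].
Qed.

Lemma clf_first_square w : u [set i | ~ clf (w i)] ->
  exists r, u [set i | ~ clf (pw (w i) (2 ^ r))] /\
    u [set i | clf (pw (w i) (2 ^ r) * pw (w i) (2 ^ r))].
Proof.
move=> nw.
have : u [set i | clf (pw (w i) (2 ^ n))].
  apply: filterS filterT => i _; apply: (@clf_pw_le _ n) => //.
    exact/ltnW/ltn_expl.
  by rewrite pw_nE; exact/clf_idem/pi_idem.
elim: n => [cw|R IHR cw].
  by have [i []] := ultra_ex2 uu nw cw.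
have [/IHR //|/(ultraN uu) ncw] := pselect (u [set i | clf (pw (w i) (2 ^ R))]).
exists R; split=> //; apply: filterS cw => i /=.
by rewrite expnS mul2n -addnn pwD ?expn_gt0.
Qed.

(** Either alternative puts the limit into the range of [h], see [hlim_range]. *)
Definition tame w := u [set i | clf (w i)] \/ ucst u w.

Definition tame_below e := forall w a, u [set i | e * pi (w i) = pi (w i)] ->
  hlim w a -> tame w.

(** Let [z] be a power of [w] with [z i] not Clifford and [z i * z i] Clifford. By Clifford
    nonsingularity, for most [i] most products [z i * z k] are not Clifford. They converge in [k]
    and lie below [pi (w i)], so by hypothesis they have a constant value [g i]. The [g i] have a
    common idempotent, hence are constant, and [h] of their value is the limit of the
    [h (z i * z i)]. That limit is the image of a Clifford element, a contradiction. *)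
Lemma hlim_tame_step w a : u [set i | tame_below (pi (w i))] ->
  hlim w a -> tame w.
Proof.
move=> wT wa; apply: contrapT => /not_orP[/(ultraN uu) nw ncst].
have ncst_pi : ~ ucst u (pi \o w).
  by move=> [e we]; apply: ncst; apply: hlim_unipotent we wa.
have [r [nz zz]] := clf_first_square nw.
pose z i := pw (w i) (2 ^ r); rewrite -/z in nz zz.
have pz i : pi (z i) = pi (w i) by rewrite pi_pwn.
have ncst_z : ~ ucst u z.
  by move=> [c uc]; apply: ncst_pi; exists (pi c); apply: filterS uc => i /= <-.
have [b zb] := hlim_pw (2 ^ r) wa; rewrite -/(hlim z b) in zb.
have [nzz|/(ultraN uu) nzz] := pselect (u [set i | u [set k | clf (z i * z k)]]).
  exact/ncst_z/(clifford_nonsingular_ultra uu ncs).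
have /choice[g gP] : forall i, exists d, tame_below (pi (w i)) ->
    ~ u [set k | clf (z i * z k)] -> u [set k | z i * z k = d].
  move=> i; have [[Ti ni]|] := pselect (tame_below (pi (w i)) /\
    ~ u [set k | clf (z i * z k)]); last first.
    by move=> nTn; exists (z i) => Ti ni; case: nTn.
  have ziz : hlim (fun k => z i * z k) (h (z i) * b).
    by apply: hlimM => //; exact: cvg_cst.
  have [|//|[d ud]] := Ti _ _ _ ziz; last by exists d.
  by apply: filterS filterT => k _ /=; rewrite piM pz mulgA pi_pi.
have [l [lE lw lP]] := idem_lim uu (fun i => pi_idem (w i)).
(* [pi (g i)] is [pi (w i) * pi (w k)] for most [k]. It lies below most [pi (w k)], hence below [l];
   and it is above [l] because both factors are. *)
have gl : u [set i | pi (g i) = l].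
  apply: filterS3 (wT) (nzz) (lw) => i /= Ti ni li.
  have gi := gP i Ti ni.
  have piE : u [set k | pi (z i) * pi (w k) = pi (g i)].
    by apply: filterS gi => k /= <-; rewrite piM !pz.
  have [k [kg lk]] := ultra_ex2 uu piE lw.
  have : pi (g i) * l = pi (g i).
    apply: lP; apply: filterS piE => j /= <-.
    by rewrite -mulgA pi_pi.
  by rewrite -[in LHS]kg pz mulC mulgA li lk => ->.
have gb : hlim g (b * b).
  have bcst : (fun=> b) @ u --> b by exact: cvg_cst.
  move: (cvg_mul zb bcst); apply: cvg_trans; apply: near_eq_cvg.
  apply: filterS2 wT nzz => i /= Ti ni; apply/esym/(cvg_uniq (hlim_cst (gP i Ti ni))).
  by apply: hlimM => //; exact: cvg_cst.
have [c gc] := hlim_unipotent gl gb.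
have [|g0 cg0 bb] := @hlim_clifford _ (b * b) zz; first exact: hlimM.
have cE : c = g0.
  by apply: h_inj; rewrite -bb; apply: cvg_uniq (hlim_cst gc) gb.
have [i [gi Ti ni]] := ultra_ex3 uu gc wT nzz.
apply: (ni); apply: filterS (gP i Ti ni) => k /= ->.
by rewrite [g i]gi cE.
Qed.

(** At a minimal idempotent [t] for which [tame_below] fails, a family below [t] has most of its
    idempotents equal to [t] or most of them strictly below [t]. The first case is [hlim_unipotent],
    the second is the inductive step. *)
Lemma hlim_tame w a : hlim w a -> tame w.
Proof.
have T e : idempotents e -> tame_below e; last first.
  by apply: hlim_tame_step; apply: filterS filterT => i _; exact/T/pi_idem.
move=> ee; apply: contrapT => nTe.
have [||t [tE nT] tmin] := @idem_min [set e | idempotents e /\ ~ tame_below e].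
- by move=> t [].
- by exists e.
apply: nT => v b vt vb.
have [ve|/(ultraN uu) nve] := pselect (u [set i | pi (v i) = t]).
  by right; exact: hlim_unipotent ve vb.
apply: hlim_tame_step vb; apply: filterS2 vt nve => i /= vi nvi.
apply: contrapT => nTi; apply: nvi; apply: tmin; last by rewrite mulC.
by split=> //; exact: pi_idem.
Qed.

Lemma hlim_range w a : hlim w a -> range h a.
Proof.
move=> wa; have [wc|[c uc]] := hlim_tame wa.
  by have [g _ ->] := hlim_clifford wc wa; exists g.
by exists c => //; apply: cvg_uniq (hlim_cst uc) wa.
Qed.

End Closed.
End CommutativeSemigroup.

Lemma closure_range_ultra (T : choiceType) (Y : topologicalType) (f : T -> Y) y :
  closure (range f) y -> exists u, UltraFilter u /\ f @ u --> y.
Proof.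
move=> fy; have FF : ProperFilter (filter_from (nbhs y) (fun B => f @^-1` B)).
  apply: filter_from_proper => [|B /fy[_ [[x _ <-] Bx]]]; last by exists x.
  apply: filter_from_filter; first by exists setT; exact: filterT.
  by move=> A B nA nB; exists (A `&` B) => //; exact: filterI.
have [u [uu Fu]] := ultraFilterLemma FF; exists u; split=> // B nB.
by apply: Fu; exists B.
Qed.

Lemma injectively_closed_T2S (X : semigroupType)
    (mulC : forall x y : X, x * y = y * x) :
  bounded_semigroup X -> chain_finite X -> group_finite X -> ~ singular X ->
  ~ Clifford_singular X -> injectively_closed T2S X.
Proof.
move=> bX cf gf ns ncs Y h haus h_inj y /closure_range_ultra[u [uu uy]].
have per := bounded_periodic bX; have [n n0 nE] := bX.
have Hfin := (group_finiteP mulC per).1 gf.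
apply: (hlim_range mulC per cf Hfin ns ncs n0 nE haus h_inj uu (w := id)).
exact: uy.
Qed.

(** * Zero-dimensional semigroups *)

(* A zero-dimensional Hausdorff topological semigroup [dom], given by its
   neighbourhood filters; what [op] and [nb] do outside of [dom] is irrelevant. *)
Record tzs := Tzs {
  car :> Type;
  dom : set car;
  op : car -> car -> car;
  nb : car -> set_system car;
  clop (B : set car) := forall z, dom z ->
    (B z -> nb z B) /\ (~ B z -> nb z (~` B));
  op_dom : forall x y, dom x -> dom y -> dom (op x y);
  opA : forall x y z, dom x -> dom y -> dom z -> op x (op y z) = op (op x y) z;
  nb_filter : forall x, dom x -> Filter (nb x);
  nb_self : forall x V, dom x -> nb x V -> V x;
  nb_base : forall x V, dom x -> nb x V ->
    exists B, [/\ clop B, B x & forall z, dom z -> B z -> V z];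
  nb_sep : forall x y, dom x -> dom y -> x <> y ->
    exists V, nb x V /\ ~ V y;
  nb_op : forall x y V, dom x -> dom y -> nb (op x y) V ->
    exists A B, [/\ nb x A, nb y B & forall z w, dom z -> dom w ->
      A z -> B w -> V (op z w)]
}.

Section TzsTopology.
Variable T : tzs.

Definition tz_point := {x : T | dom x}.

HB.instance Definition _ := gen_eqMixin tz_point.
HB.instance Definition _ := gen_choiceMixin tz_point.

Definition tz_mul (p q : tz_point) : tz_point :=
  exist _ (op (sval p) (sval q)) (op_dom (svalP p) (svalP q)).

Lemma tz_point_inj (p q : tz_point) : sval p = sval q -> p = q.
Proof. by case: p q => [x Dx] [y Dy] /= xy; exact: eq_exist. Qed.

Lemma tz_mulA : associative tz_mul.
Proof. by move=> p q r; apply: tz_point_inj; apply: opA; exact: svalP. Qed.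

HB.instance Definition _ := isSemigroup.Build tz_point tz_mulA.

Definition tz_nbhs (p : tz_point) : set_system tz_point :=
  [set A | exists2 V, nb (sval p) V & forall q : tz_point, V (sval q) -> A q].

HB.instance Definition _ := hasNbhs.Build tz_point tz_nbhs.

Lemma tz_nbhs_filter (p : tz_point) : ProperFilter (tz_nbhs p).
Proof.
have nbF := nb_filter (svalP p); apply: Build_ProperFilter_ex.
  by move=> A [V /(nb_self (svalP p)) Vp VA]; exists p; exact: VA.
split.
- by exists setT => //; exact: filterT.
- move=> A B [V pV VA] [W pW WB]; exists (V `&` W); first exact: filterI.
  by move=> q [/VA ? /WB].
- by move=> A B AB [V pV VA]; exists V => // q /VA /AB.
Qed.

Lemma tz_nbhs_singleton (p : tz_point) (A : set tz_point) : tz_nbhs p A -> A p.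
Proof. by move=> [V /(nb_self (svalP p)) Vp VA]; exact: VA. Qed.

Lemma clop_open (B : set T) (p : tz_point) :
  clop B -> B (sval p) -> tz_nbhs p [set q | B (sval q)].
Proof. by move=> cB Bp; exists B => //; have [+ _] := cB _ (svalP p); exact. Qed.

Lemma tz_nbhs_nbhs (p : tz_point) (A : set tz_point) :
  tz_nbhs p A -> tz_nbhs p (tz_nbhs^~ A).
Proof.
move=> [V /(nb_base (svalP p))[B [cB Bp BV]] VA].
have := clop_open cB Bp; apply: (@filterS _ _ (tz_nbhs_filter p)) => q Bq.
apply: (@filterS _ _ (tz_nbhs_filter q)) (clop_open cB Bq) => r Br.
by apply: VA; apply: BV => //; exact: svalP.
Qed.

HB.instance Definition _ := Nbhs_isNbhsTopological.Build tz_point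
  tz_nbhs_filter tz_nbhs_singleton tz_nbhs_nbhs.

Lemma tz_mul_continuous :
  continuous (fun p : tz_point * tz_point => p.1 * p.2).
Proof.
move=> [p q] A [V /(nb_op (svalP p) (svalP q))[P [Q [pP qQ PQV]]] VA].
exists ([set r | P (sval r)], [set r | Q (sval r)]) => /=.
  by split; [exists P|exists Q].
by move=> [r s] [/= Pr Qs]; apply: VA; apply: PQV => //; exact: svalP.
Qed.

HB.instance Definition _ := isTopologicalSemigroup.Build tz_point tz_mul_continuous.

Lemma tz_clopen (B : set T) : clop B -> clopen [set q : tz_point | B (sval q)].
Proof.
move=> cB; split; rewrite ?openE.
  by move=> q Bq; exact: clop_open.
rewrite -openC openE => q nBq; exists (~` B) => //.
by have [_ +] := cB _ (svalP q); exact.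
Qed.

Lemma tz_TzS : TzS tz_point.
Proof.
split.
  move=> p q pq; apply: contrapT => npq.
  have [V [/(nb_base (svalP p))[B [cB Bp BV]] nVq]] : exists V,
      nb (sval p) V /\ ~ V (sval q).
    by apply: nb_sep; [exact: svalP|exact: svalP|move/tz_point_inj].
  have nBq : ~ B (sval q) by move=> /(BV _ (svalP q)).
  have [|r [Br nBr]] := pq _ (~` [set r : tz_point | B (sval r)])
      (clop_open cB Bp).
    by exists (~` B) => //; have [_ +] := cB _ (svalP q); exact.
  exact: nBr.
exists (@clopen tz_point) => //; split; first by move=> B [].
move=> p A [V /(nb_base (svalP p))[B [cB Bp BV]] VA].
exists [set q : tz_point | B (sval q)]; first by split=> //; exact: tz_clopen.
by move=> q Bq; apply: VA; apply: BV => //; exact: svalP.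
Qed.

End TzsTopology.

Section TzsProduct.
Variables (J : Type) (T : J -> tzs).
Let prod := forall j, T j.

(** The product topology, generated inductively from cylinders in place of finite intersections, so
    that its properties follow by induction. *)
Inductive prod_nb (f : prod) : set_system prod :=
| prod_nbT V : (forall g, V g) -> prod_nb f V
| prod_nb_cyl j A V : nb (f j) A -> (forall g : prod, A (g j) -> V g) -> prod_nb f V
| prod_nbI A B V : prod_nb f A -> prod_nb f B ->
    (forall g, A g -> B g -> V g) -> prod_nb f V.

Let prod_dom : set prod := [set f | forall j, dom (f j)].
Let prod_op (f g : prod) : prod := fun j => op (f j) (g j).

Lemma prod_nbS f V W : prod_nb f V -> (forall g, V g -> W g) -> prod_nb f W.
Proof. by move=> fV VW; apply: (prod_nbI fV fV) => g /VW. Qed.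

Lemma prod_nb_filter f : prod_dom f -> Filter (prod_nb f).
Proof.
move=> Df; split; first exact: prod_nbT.
  by move=> A B fA fB; apply: (prod_nbI fA fB).
by move=> A B AB fA; exact: prod_nbS fA AB.
Qed.

Lemma prod_nb_self f V : prod_dom f -> prod_nb f V -> V f.
Proof.
move=> Df; elim=> {V}[V VT|j A V fA AV|A B V _ Af _ Bf ABV].
- exact: VT.
- exact/AV/(nb_self (Df j)).
- exact: ABV.
Qed.

Let prod_clop (B : set prod) := forall z, prod_dom z ->
    (B z -> prod_nb z B) /\ (~ B z -> prod_nb z (~` B)).

Lemma prod_nb_base f V : prod_dom f -> prod_nb f V ->
  exists B, [/\ prod_clop B, B f & forall z, prod_dom z -> B z -> V z].
Proof.
move=> Df; elim=> {V}[V VT|j A V fA AV|A B V _ [A' [cA Af AA]] _ [B' [cB Bf BB]] ABV].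
- exists setT; split=> // z _.
  by split=> [_|nT]; [exact: prod_nbT|case: nT].
- have [B [cB Bf BA]] := nb_base (Df j) fA.
  exists [set g | B (g j)]; split=> // [z Dz|z Dz /(BA _ (Dz j))/AV//].
  have [cB1 cB2] := cB _ (Dz j).
  by split=> [/cB1|/cB2] zB; apply: (prod_nb_cyl zB).
- exists (A' `&` B'); split=> // [z Dz|z Dz [/(AA _ Dz) Az /(BB _ Dz)]]; last exact: ABV.
  have [cA1 cA2] := cA _ Dz; have [cB1 cB2] := cB _ Dz; split=> [[/cA1 zA /cB1 zB]|].
    exact: (prod_nbI zA zB).
  have [Az|/cA2 nA] := pselect (A' z).
    have [Bz|/cB2 nB _] := pselect (B' z); first by case.
    by apply: prod_nbS nB _ => g nB [].
  by move=> _; apply: prod_nbS nA _ => g nA' [].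
Qed.

Lemma prod_nb_op f g V : prod_dom f -> prod_dom g -> prod_nb (prod_op f g) V ->
  exists A B, [/\ prod_nb f A, prod_nb g B & forall z w, prod_dom z ->
    prod_dom w -> A z -> B w -> V (prod_op z w)].
Proof.
move=> Df Dg; elim=> {V}[V VT|j A V fgA AV|A B V _ [A1 [A2 [fA gA A12]]]
    _ [B1 [B2 [fB gB B12]]] ABV].
- by exists setT, setT; split=> //; exact: prod_nbT.
- have [P [Q [fP gQ PQ]]] := nb_op (Df j) (Dg j) fgA.
  exists [set z | P (z j)], [set z | Q (z j)]; split.
  + exact: (prod_nb_cyl fP).
  + exact: (prod_nb_cyl gQ).
  + by move=> z w Dz Dw Pz Qw; apply: AV; apply: PQ.
- exists (A1 `&` B1), (A2 `&` B2); split.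
  + exact: (prod_nbI fA fB).
  + exact: (prod_nbI gA gB).
  + by move=> z w Dz Dw [? ?] [? ?]; apply: ABV; [exact: A12|exact: B12].
Qed.

Definition tz_prod : tzs.
Proof.
refine (@Tzs prod prod_dom prod_op prod_nb _ _ prod_nb_filter prod_nb_self
  prod_nb_base _ prod_nb_op).
- by move=> f g Df Dg j; exact: op_dom.
- by move=> f g k Df Dg Dk; apply: functional_extensionality_dep => j; exact: opA.
- move=> f g Df Dg fg; have [j fgj] : exists j, f j <> g j.
    apply: contrapT => nfg; apply: fg; apply: functional_extensionality_dep => j.
    by apply: contrapT => fgj; apply: nfg; exists j.
  have [V [fV nV]] := nb_sep (Df j) (Dg j) fgj.
  by exists [set h | V (h j)]; split=> //; exact: (prod_nb_cyl fV).
Defined.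

End TzsProduct.

(* A homomorphism to a zero-dimensional Hausdorff topological semigroup along
   which the filter [F] converges. *)
Record probe (X : semigroupType) (F : set_system X) := Probe {
  pT : tzs;
  pf : X -> pT;
  plim : pT;
  pf_dom : forall x, dom (pf x);
  plim_dom : dom plim;
  pfM : forall x y, pf (x * y) = op (pf x) (pf y);
  p_cvg : forall V, nb plim V -> F [set x | V (pf x)]
}.

Lemma not_injectively_closed (X : semigroupType) (F : set_system X) :
  ProperFilter F ->
  (forall s t, s <> t -> exists p : probe F, pf p s <> pf p t) ->
  (forall x, exists p : probe F, pf p x <> plim p) ->
  ~ injectively_closed TzS X.
Proof.
move=> FF sep esc Xcl; pose J := ({st : X * X | st.1 <> st.2} + X)%type.
pose p (j : J) : probe F := match j with
  | inl (exist _ st) => sval (cid (sep _ _ st))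
  | inr x => sval (cid (esc x))
  end.
pose P := tz_prod (fun j => pT (p j)); pose Y := tz_point P.
pose h (x : X) : Y := exist (@dom P) (fun j => pf (p j) x) (fun j => pf_dom (p j) x).
have hM : {morph h : x y / x * y >-> x * y}.
  move=> x y; apply: tz_point_inj; apply: functional_extensionality_dep => j.
  exact: pfM.
pose hh : {multiplicative X -> Y} := HB.pack h (isMultiplicative.Build X Y h hM).
have h_inj : injective h.
  move=> s t /(congr1 sval) /= hst; apply: contrapT => st.
  apply: (svalP (cid (sep _ _ st))).
  exact: (congr1 (fun f : P => f (inl (exist _ (s, t) st))) hst).
pose y : Y := exist (@dom P) (fun j => plim (p j)) (fun j => plim_dom (p j)).
have /(Xcl Y hh (tz_TzS _) h_inj)[x _ /(congr1 sval) /= hx] : closure (range hh) y.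
  move=> A [V yV VA]; have FV : F [set x | V (sval (h x))].
    elim: yV {VA} => {V}[V VT|j B V yB BV|B D V _ FB _ FD BDV].
    - by apply: filterS filterT => x _; exact: VT.
    - by apply: filterS (p_cvg yB) => x /= Bx; exact: BV.
    - by apply: filterS2 FB FD => x; exact: BDV.
  have /filter_ex[x Vx] := FV.
  by exists (h x); split; [exists x|exact: VA].
apply: (svalP (cid (esc x))).
exact: (congr1 (fun f : P => f (inr x)) hx).
Qed.

Definition prin (S : Type) (s : S) : set_system S := [set A | A s].

Lemma prin_inj (S : Type) (s t : S) : prin s = prin t -> s = t.
Proof.
by move=> /(congr1 (fun p => p [set s])) st; have : prin t [set s] by rewrite -st.
Qed.

Lemma prin_proper (S : Type) (s : S) : ProperFilter (prin s).
Proof. by apply: Build_ProperFilter_ex => [A As|]; [exists s|split=> // A B AB /AB]. Qed.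

Section DiscreteProbe.
Variables (X : semigroupType) (F : set_system X).
Hypothesis FF : ProperFilter F.
Variables (S : Type) (op : S -> S -> S).
Hypothesis opA : associative op.

Definition discrete_tzs : tzs.
Proof.
refine (@Tzs S setT op (@prin S) _ _ _ _ _ _ _) => //.
- by move=> x _; exact: prin_proper.
- by move=> x V _ Vx; exists V; split=> // z _; split.
- move=> x y _ _ xy; exists [set x]; split=> // yx; exact: xy.
- move=> x y V _ _ Vxy; exists [set x], [set y]; split=> // z w _ _ -> ->; exact: Vxy.
Defined.

Lemma discrete_probe (f : X -> S) c : (forall x y, f (x * y) = op (f x) (f y)) ->
  F [set x | f x = c] -> exists p : probe F,
    (forall s t, f s <> f t -> pf p s <> pf p t) /\
    (forall x, f x <> c -> pf p x <> plim p).
Proof.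
move=> fM Fc.
have cvg V : nb (c : discrete_tzs) V -> F [set x | V (f x)].
  by move=> Vc; apply: filterS Fc => x /= ->.
by exists (@Probe X F discrete_tzs f c (fun _ => I) I fM cvg).
Qed.

End DiscreteProbe.

(** * Adjoining the limit of a filter *)

Section FilterProduct.
Variables (S : Type) (op : S -> S -> S).
Hypothesis opA : associative op.
Hypothesis opC : commutative op.
Implicit Types p q r : set_system S.

(** Unlike the iterated product of ultrafilters, this one is commutative when [op] is; in return the
    product of two ultrafilters need not be an ultrafilter, so the square of the adjoined filter has
    to be controlled. *)
Definition fprod p q : set_system S :=
  [set Q | exists A B, [/\ p A, q B & forall a b, A a -> B b -> Q (op a b)]].

Lemma fprodA : associative fprod.
Proof.
move=> p q r; apply/seteqP; split=> Q.
  move=> [A [D [pA [B [C [qB rC BCD]]] ADQ]]].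
  exists [set x | exists a b, [/\ A a, B b & x = op a b]], C; split=> //.
    by exists A, B; split=> // a b Aa Bb; exists a, b.
  by move=> _ c [a [b [Aa Bb ->]]] Cc; rewrite -opA; apply: ADQ => //; exact: BCD.
move=> [D [C [[A [B [pA qB ABD]]] rC DCQ]]].
exists A, [set x | exists b c, [/\ B b, C c & x = op b c]]; split=> //.
  by exists B, C; split=> // b c Bb Cc; exists b, c.
by move=> a _ Aa [b [c [Bb Cc ->]]]; rewrite opA; apply: DCQ => //; exact: ABD.
Qed.

Lemma fprodC : commutative fprod.
Proof.
move=> p q; apply/seteqP; split=> Q [A [B [pA qB ABQ]]];
  by exists B, A; split=> // a b Ba Ab; rewrite opC; exact: ABQ.
Qed.

Lemma fprod_prin s t : fprod (prin s) (prin t) = prin (op s t).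
Proof.
apply/seteqP; split=> Q; first by move=> [A [B [As Bt ABQ]]]; exact: ABQ.
by move=> Qst; exists [set s], [set t]; split=> // _ _ -> ->.
Qed.

Lemma fprod_prinE s p : Filter p ->
  fprod (prin s) p = [set Q | p [set x | Q (op s x)]].
Proof.
move=> pF; apply/seteqP; split=> Q.
  move=> [A [B [As pB ABQ]]] /=; apply: filterS pB => x Bx.
  exact: (ABQ s x As).
by move=> pQ; exists [set s], [set x | Q (op s x)]; split=> // _ b ->.
Qed.

Lemma fprod_proper p q : ProperFilter p -> ProperFilter q ->
  ProperFilter (fprod p q).
Proof.
move=> pF qF; apply: Build_ProperFilter_ex.
  move=> Q [A [B [/filter_ex[a Aa] /filter_ex[b Bb] ABQ]]].
  by exists (op a b); exact: ABQ.
split.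
- by exists setT, setT; split=> //; exact: filterT.
- move=> P Q [A [B [pA qB ABP]]] [A' [B' [pA' qB' ABQ]]].
  exists (A `&` A'), (B `&` B'); split; [exact: filterI|exact: filterI|].
  by move=> a b [? ?] [? ?]; split; [exact: ABP|exact: ABQ].
- by move=> P Q PQ [A [B [pA qB ABP]]]; exists A, B; split=> // a b ? ?; exact/PQ/ABP.
Qed.

Variable F : set_system S.
Hypothesis FF : ProperFilter F.

(* The points of [S] are the principal filters. *)
Definition ext_dom : set (set_system S) := [set p |
  [\/ exists s, p = prin s, p = F | exists s, p = fprod (prin s) F]].

(** Such sets [A] are those for which the points [q] containing [A] form a clopen set. *)
Definition decided (A : set S) := forall q, ext_dom q -> q A \/ q (~` A).

Hypothesis Fsq : fprod F F = F \/ exists c, fprod F F = prin c.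
Hypothesis ext_base : forall p A, ext_dom p -> p A ->
  exists B, [/\ p B, B `<=` A & decided B].

Lemma ext_proper p : ext_dom p -> ProperFilter p.
Proof.
case=> [[s ->]|->|[s ->]]; [exact: prin_proper|exact: FF|].
by apply: fprod_proper => //; exact: prin_proper.
Qed.

Lemma ext_sub p q : ext_dom p -> ext_dom q -> p `<=` q -> p = q.
Proof.
move=> Dp Dq pq; have pF := ext_proper Dp; have qF := ext_proper Dq.
apply/seteqP; split=> // A qA; have [B [qB BA Bdec]] := ext_base Dq qA.
have [pB|/pq qCB] := Bdec _ Dp; first exact: filterS pB.
by have /filter_ex[x []] : q (B `&` ~` B) by exact: filterI.
Qed.

Lemma ext_prin s : ext_dom (prin s). Proof. by apply: Or31; exists s. Qed.

Lemma ext_prod p q : ext_dom p -> ext_dom q -> ext_dom (fprod p q).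
Proof.
have EF s : ext_dom (fprod (prin s) F) by apply: Or33; exists s.
have EFF : ext_dom (fprod F F).
  by case: Fsq => [->|[c ->]]; [exact: Or32|exact: ext_prin].
have EsFF s : ext_dom (fprod (prin s) (fprod F F)).
  case: Fsq => [->|[c ->]]; first exact: EF.
  by rewrite fprod_prin; exact: ext_prin.
case=> [[s ->]|->|[s ->]] [[t ->]|->|[t ->]].
- by rewrite fprod_prin; exact: ext_prin.
- exact: EF.
- by rewrite fprodA fprod_prin; exact: EF.
- by rewrite fprodC; exact: EF.
- exact: EFF.
- by rewrite fprodC -fprodA; exact: EsFF.
- by rewrite fprodC fprodA fprod_prin; exact: EF.
- by rewrite -fprodA; exact: EsFF.
- rewrite -fprodA (fprodA F) (fprodC F (prin t)) -(fprodA (prin t)) fprodA.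
  by rewrite fprod_prin; exact: EsFF.
Qed.

Definition ext_nb p : set_system (set_system S) :=
  [set V | exists2 A, p A & forall q, ext_dom q -> q A -> V q].

Definition ext_tzs : tzs.
Proof.
refine (@Tzs (set_system S) ext_dom fprod ext_nb ext_prod _ _ _ _ _ _).
- by move=> *; rewrite fprodA.
- move=> p /ext_proper pF; split; first by exists setT => //; exact: filterT.
    move=> V W [A pA AV] [B pB BW]; exists (A `&` B); first exact: filterI.
    move=> q Dq; have qF := ext_proper Dq => qAB.
    have qA : q A by apply: filterS qAB => x [].
    have qB : q B by apply: filterS qAB => x [].
    by split; [exact: AV|exact: BW].
  by move=> V W VW [A pA AV]; exists A => // q Dq qA; apply: VW; exact: AV.
- by move=> p V Dp [A pA AV]; exact: AV.
- move=> p V Dp [A pA AV]; have [B [pB BA Bdec]] := ext_base Dp pA.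
  exists [set q | q B]; split=> // [q Dq|q Dq qB]; last first.
    by have qF := ext_proper Dq; apply: AV => //; exact: (filterS BA qB).
  have qF := ext_proper Dq; split=> [qB|nqB]; first by exists B.
  have [//|qCB] := Bdec _ Dq; exists (~` B) => // r Dr rCB rB.
  have rF := ext_proper Dr.
  by have /filter_ex[x []] : r (B `&` ~` B) by exact: filterI.
- move=> p q Dp Dq pq; have [A [pA nA]] : exists A, p A /\ ~ q A.
    apply: contrapT => nA; apply: pq; apply: ext_sub => // A pA.
    by apply: contrapT => nqA; apply: nA; exists A.
  by exists [set r | r A]; split=> //; exists A.
- move=> p q V Dp Dq [Q [A [B [pA qB ABQ]]] QV].
  exists [set r | r A], [set r | r B]; split; [by exists A|by exists B|].
  move=> r s Dr Ds rA sB; apply: QV; first exact: ext_prod.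
  by exists A, B.
Defined.

Lemma ext_probe (X : semigroupType) (G : set_system X) (f : X -> S) :
  Filter G -> (forall x y, f (x * y) = op (f x) (f y)) ->
  (forall A, F A -> G [set x | A (f x)]) -> (forall s, F <> prin s) ->
  exists p : probe G, (forall s t, f s <> f t -> pf p s <> pf p t) /\
    (forall x, pf p x <> plim p).
Proof.
move=> GF fM FG Fs.
have pM x y : prin (f (x * y)) = fprod (prin (f x)) (prin (f y)).
  by rewrite fprod_prin fM.
have cvg V : nb (F : ext_tzs) V -> G [set x | V (prin (f x))].
  move=> [A FA AV]; apply: filterS (FG _ FA) => x Ax.
  by apply: AV => //; exact: ext_prin.
have pF : @dom ext_tzs F by exact: Or32.
exists (@Probe X G ext_tzs (fun x => prin (f x)) F (fun x => ext_prin (f x)) pF pM cvg).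
by split=> [s t st e|x e]; [exact: st (prin_inj e)|exact: (Fs _ (esym e))].
Qed.

End FilterProduct.

Section UltraProbe.
Variables (S : choiceType) (op : S -> S -> S).
Hypothesis opA : associative op.
Hypothesis opC : commutative op.
Variable u : set_system S.
Hypothesis uu : UltraFilter u.
Hypothesis usq : fprod op u u = u \/ exists c, fprod op u u = prin c.
Hypothesis ufree : forall s, u <> prin s.

(** Translates of an ultrafilter are ultrafilters, so every set is decided. *)
Lemma ultra_ext_ultra p A : ext_dom op u p -> p A \/ p (~` A).
Proof.
case=> [[s ->]|->|[s ->]]; first exact: EM.
  exact: in_ultra_setVsetC.
by rewrite fprod_prinE; exact: (in_ultra_setVsetC [set x | A (op s x)]).
Qed.

Lemma ultra_probe (X : semigroupType) (G : set_system X) (f : X -> S) :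
  Filter G -> (forall x y, f (x * y) = op (f x) (f y)) ->
  (forall A, u A -> G [set x | A (f x)]) ->
  exists p : probe G, (forall s t, f s <> f t -> pf p s <> pf p t) /\
    (forall x, pf p x <> plim p).
Proof.
move=> GF fM uG; apply: (@ext_probe _ op opA opC u _ usq _ X G f GF fM uG ufree).
by move=> p A Dp pA; exists A; split=> // q; exact: ultra_ext_ultra.
Qed.

End UltraProbe.

(** * Singular sets, chains and elements of infinite order *)

Section Necessity.
Variable X : semigroupType.
Hypothesis mulC : forall x y : X, x * y = y * x.
Hypothesis Xcl : injectively_closed TzS X.

Lemma closed_ultra_square (u : set_system X) : UltraFilter u ->
  (forall s, u <> prin s) ->
  fprod *%g u u = u \/ (exists c, fprod *%g u u = prin c) -> False.
Proof.
move=> uu ufree usq.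
have [p [psep pesc]] := @ultra_probe X *%g (@mulgA X) mulC u uu usq ufree
  X u id _ (fun _ _ => erefl) (fun _ uA => uA).
apply: (@not_injectively_closed X u _ _ _ Xcl).
- by move=> s t st; exists p; exact: psep.
- by move=> x; exists p; exact: pesc.
Qed.

Lemma free_nprin (A : set X) : infinite_set A -> exists u,
  [/\ UltraFilter u, u A & forall s, u <> prin s].
Proof.
move=> /free_ultrafilter[u [uu uA ufin]]; exists u; split=> // s us.
by apply: (ufin [set s]); [exact: finite_set1|rewrite us].
Qed.

Lemma closed_nonsingular : ~ singular X.
Proof.
move=> [A /free_nprin[u [uu uA ufree]] [c Ac]].
apply: closed_ultra_square ufree _; right; exists c.
have AcE a b : A a -> A b -> a * b = c.
  by move=> Aa Ab; have : mul_set A (a * b) by [exists a => //; exists b]; rewrite Ac.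
apply/seteqP; split=> Q.
  move=> [P [R [uP uR PRQ]]].
  have [a [Aa Pa]] := ultra_ex2 uu uA uP.
  have [b [Ab Rb]] := ultra_ex2 uu uA uR.
  by rewrite /prin /= -(AcE _ _ Aa Ab); exact: PRQ.
by move=> Qc; exists A, A; split=> // a b Aa Ab; rewrite (AcE _ _ Aa Ab).
Qed.

Lemma closed_chain_finite : chain_finite X.
Proof.
move=> A /free_nprin[u [uu uA ufree]]; apply: contrapT => nA.
have Axy x y : A x -> A y -> x * y = x \/ x * y = y.
  move=> Ax Ay; apply: contrapT => nxy; apply: nA; exists x, y; split=> //.
have AE x : A x -> x * x = x by move=> Ax; case: (Axy _ _ Ax Ax).
apply: closed_ultra_square ufree _; left; apply/seteqP; split=> Q.
  move=> [P [R [uP uR PRQ]]].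
  apply: filterS3 uA uP uR => x Ax Px Rx.
  by rewrite -(AE x Ax); exact: PRQ.
move=> uQ; exists (A `&` Q), (A `&` Q); split; [exact: filterI|exact: filterI|].
by move=> a b [Aa Qa] [Ab Qb]; have [->|->] := Axy _ _ Aa Ab.
Qed.

Lemma fact_dvd m n : (m <= n)%N -> (m`! %| n`!)%N.
Proof. by move=> mn; rewrite (fact_split mn) dvdn_mulr. Qed.

(** * Elements without an idempotent power *)

Section Aperiodic.
Variable x : X.
Hypothesis xE : forall n, (0 < n)%N -> ~ idempotents (pw x n).

Lemma aperiodic_inj m n : (0 < m)%N -> (m < n)%N -> pw x m <> pw x n.
Proof.
move=> m0 mn xmn; have d0 : (0 < n - m)%N by rewrite subn_gt0.
have step k t : (m <= k)%N -> pw x (k + t * (n - m)) = pw x k.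
  move=> mk; elim: t => [|t IHt]; first by rewrite mul0n addn0.
  rewrite -{}IHt mulSn; move: (t * (n - m))%N => r.
  have -> : (k + (n - m + r) = n + (k + r - m))%N by lia.
  have [krm|km] := posnP (k + r - m).
    by rewrite krm addn0 -xmn; congr pw; lia.
  by rewrite pwD // -?xmn -?pwD //; first congr pw; lia.
(* This exponent is a multiple of the period [n - m] and at least [m], so doubling it does not
   change the power. *)
apply: (xE (n := m * (n - m))); first by rewrite muln_gt0 m0.
by rewrite /idempotents /= -pwD ?muln_gt0 ?m0 // step // leq_pmulr.
Qed.

(** The exponents tend to infinity in the integers and to zero in the profinite integers. Sums of
    such exponents are of the same kind, which makes the limit idempotent, and any period is
    eventually invisible. *)
Definition fact_powers n : set X :=
  [set y | exists k, [/\ (n`! %| k)%N, (n <= k)%N, (0 < k)%N & y = pw x k]].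

Definition fact_filter : set_system X :=
  [set Q | exists n, fact_powers n `<=` Q].

Lemma fact_powersS m n : (m <= n)%N -> fact_powers n `<=` fact_powers m.
Proof.
move=> mn y [k [nk kn k0 ->]]; exists k; split=> //; last exact: leq_trans kn.
exact: dvdn_trans (fact_dvd mn) nk.
Qed.

Lemma fact_filter_proper : ProperFilter fact_filter.
Proof.
apply: Build_ProperFilter_ex.
  move=> Q [n nQ]; exists (pw x (n`! * n.+1)); apply: nQ.
  exists (n`! * n.+1)%N; split=> //; rewrite ?dvdn_mulr ?muln_gt0 ?fact_gt0 //.
  exact: leq_trans (leqnSn n) (leq_pmull _ (fact_gt0 n)).
split; first by exists 0%N.
  move=> P Q [m mP] [n nQ]; exists (maxn m n) => y ny; split.
    by apply: mP; apply: fact_powersS ny; exact: leq_maxl.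
  by apply: nQ; apply: fact_powersS ny; exact: leq_maxr.
by move=> P Q PQ [n nP]; exists n; exact: subset_trans PQ.
Qed.

(** [None] acts as a unit, so that the filter itself counts as one of its translates. *)
Definition omul (s : option X) y := if s is Some s then s * y else y.

Lemma omul_pw s m n : (0 < m)%N -> (0 < n)%N ->
  omul s (pw x (m + n)) = omul s (pw x m) * pw x n.
Proof. by move=> m0 n0; case: s => [s|] /=; rewrite pwD // mulgA. Qed.

Definition fact_translate s : set_system X :=
  [set Q | exists n, forall y, fact_powers n y -> Q (omul s y)].

Lemma ext_dom_fact p : ext_dom *%g fact_filter p ->
  (exists s, p = prin s) \/ exists s, p = fact_translate s.
Proof.
have FF := fact_filter_proper.
case=> [|->|[s ->]]; first by left.
  by right; exists None.
by right; exists (Some s); rewrite fprod_prinE.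
Qed.

Lemma omul_shift s t k l k' : (0 < k)%N -> (0 < l)%N -> (k < k')%N ->
  omul t (pw x k) = omul s (pw x l) ->
  omul t (pw x k') = omul s (pw x (l + (k' - k))).
Proof.
move=> k0 l0 kk' ts; have d0 : (0 < k' - k)%N by rewrite subn_gt0.
by rewrite omul_pw // -ts -omul_pw // subnKC // ltnW.
Qed.

(** One coincidence between the two translates propagates: adding [k' - k] to both exponents keeps
    the equality, and [n!] divides the shift when it divides [k] and [k']. *)
Lemma fact_translate_decided s n p : ext_dom *%g fact_filter p ->
  let B := [set z | exists2 y, fact_powers n y & z = omul s y] in
  p B \/ p (~` B).
Proof.
move=> /ext_dom_fact[[t ->]|[t ->]] B; first exact: EM.
have [[k [l [nk k0 nl ts]]]|nB] := pselect (exists k l, [/\ (n`! %| k)%N,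
    (0 < k)%N, fact_powers n (pw x l) /\ ((n`! %| l)%N /\ (n <= l)%N /\ (0 < l)%N) &
    omul t (pw x k) = omul s (pw x l)]).
  left; exists (maxn n k.+1) => _ [k' [dk' k'n k'0 ->]].
  have [_ [dl [nl' l0]]] := nl.
  have kk' : (k < k')%N by apply: leq_trans k'n; rewrite leq_maxr.
  exists (pw x (l + (k' - k))); last exact: omul_shift.
  exists (l + (k' - k))%N; split=> //; last by rewrite addn_gt0 l0.
    rewrite dvdn_add // dvdn_subr //; first exact: ltnW.
    by apply: dvdn_trans dk'; rewrite fact_dvd // leq_maxl.
  exact: leq_trans (leq_addr _ _).
right; exists n => y [k [nk kn k0 ->]] [_ [l [nl ln l0 ->]] e].
by apply: nB; exists k, l; split=> //; split=> //; exists l.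
Qed.

(** Two occurrences of [s], at [k < k'], make the powers translated by [t] periodic beyond [k] with
    period [d = k' - k]. For [n] at least [d] and greater than [k], all exponents in [fact_powers n]
    are multiples of [d] beyond [k], so they give one value. *)
Lemma fact_translate_prin s t : (forall n, exists2 y, fact_powers n y & s = omul t y) ->
  exists n, forall y, fact_powers n y -> omul t y = s.
Proof.
move=> st; have [_ [k [_ _ k0 ->]] sk] := st 0%N.
have [_ [k' [_ kk' k'0 ->]] sk'] := st k.+1.
pose d := (k' - k)%N; have d0 : (0 < d)%N by rewrite subn_gt0.
have step j : (0 < j)%N -> omul t (pw x (k + j + d)) = omul t (pw x (k + j)).
  move=> j0; rewrite [in LHS]addnAC omul_pw // ?addn_gt0 ?k0 //.
  by rewrite subnKC 1?ltnW // -sk' sk -omul_pw.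
have stepn j i : (0 < j)%N -> omul t (pw x (k + j + i * d)) = omul t (pw x (k + j)).
  move=> j0; elim: i => [|i IHi]; first by rewrite mul0n addn0.
  rewrite mulSn; move: (i * d)%N IHi => r IHi.
  have -> : (k + j + (d + r) = k + (j + r) + d)%N by lia.
  by rewrite step ?addn_gt0 ?j0 // addnA.
pose n := (maxn d k.+1); exists n => _ [j [nj jn j0 ->]].
have [_ [i [ni iin i0 ->]] ->] := st n.
have dvd l : (n`! %| l)%N -> (d %| l)%N.
  by apply: dvdn_trans; rewrite dvdn_fact // d0 leq_maxl.
have kn : (k < n)%N by rewrite leq_maxr.
have H a b : (a <= b)%N -> (n <= a)%N -> (d %| a)%N -> (d %| b)%N ->
    omul t (pw x b) = omul t (pw x a).
  move=> ab na da db; have -> : (b = k + (a - k) + ((b - a) %/ d) * d)%N.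
    by rewrite divnK ?dvdn_sub //; lia.
  by rewrite stepn; [congr (omul t (pw x _))|]; lia.
by have [ji|/ltnW ij] := leqP j i; [symmetry|]; apply: H => //; exact: dvd.
Qed.

Lemma fact_base p A : ext_dom *%g fact_filter p -> p A ->
  exists B, [/\ p B, B `<=` A & decided *%g fact_filter B].
Proof.
move=> /ext_dom_fact[[s ->] As|[s -> [n nA]]].
  exists [set s]; split=> //; first by move=> _ ->.
  move=> q /ext_dom_fact[[t ->]|[t ->]]; first exact: EM.
  have [/fact_translate_prin[n nt]|nst] :=
      pselect (forall n, exists2 y, fact_powers n y & s = omul t y).
    by left; exists n.
  have [n nn] : exists n, ~ exists2 y, fact_powers n y & s = omul t y.
    by apply: contrapT => nn; apply: nst => n; apply: contrapT => ny; apply: nn; exists n.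
  by right; exists n => y ny e; apply: nn; exists y.
exists [set z | exists2 y, fact_powers n y & z = omul s y]; split.
- by exists n => y ny; exists y.
- by move=> _ [y ny ->]; exact: nA.
- by move=> q; exact: fact_translate_decided.
Qed.

Lemma fact_filter_nprin s : fact_filter <> prin s.
Proof.
move=> Fs; have [n ns] : fact_filter [set s] by rewrite Fs.
have pn j : pw x (n`! * (n + j.+1)) = s.
  apply: ns; exists (n`! * (n + j.+1))%N; split=> //; first exact: dvdn_mulr.
    exact: leq_trans (leq_addr _ _) (leq_pmull _ (fact_gt0 n)).
  by rewrite muln_gt0 fact_gt0 addnS.
apply: (@aperiodic_inj (n`! * (n + 1)) (n`! * (n + 2))); last by rewrite !pn.
  by rewrite muln_gt0 fact_gt0 addn1.
by rewrite ltn_mul2l fact_gt0 ltn_add2l.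
Qed.

Lemma fact_filter_sq : fprod *%g fact_filter fact_filter = fact_filter.
Proof.
apply/seteqP; split=> Q; last first.
  move=> [n nQ]; exists (fact_powers n), (fact_powers n).
  split; [by exists n|by exists n|] => _ _ [k [nk kn k0 ->]] [l [nl ln l0 ->]].
  apply: nQ; rewrite -pwD //; exists (k + l)%N; split=> //.
  - exact: dvdn_add.
  - exact: leq_trans (leq_addr _ _).
  - by rewrite addn_gt0 k0.
move=> [A [B [[a aA] [b bB] ABQ]]].
(* [c] is one fixed exponent admissible for both sets; an exponent [k] divisible by a larger
   factorial is split as [c + (k - c)]. *)
pose n := maxn a b; pose c := (n`! * n.+1)%N.
have c0 : (0 < c)%N by rewrite muln_gt0 fact_gt0.
have nc : (n <= c)%N.
  exact: leq_trans (leqnSn n) (leq_pmull _ (fact_gt0 n)).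
have nk k : (c + n.+1)`! %| k -> n`! %| k.
  by apply: dvdn_trans; rewrite fact_dvd //; lia.
exists (c + n.+1)%N => _ [k [/nk dk kc k0 ->]].
have -> : k = (c + (k - c))%N by lia.
rewrite pwD //; last lia.
apply: ABQ.
  by apply: aA; apply: (@fact_powersS _ n); [exact: leq_maxl|exists c; rewrite dvdn_mulr].
apply: bB; apply: (@fact_powersS _ n); first exact: leq_maxr.
exists (k - c)%N; split=> //; [|lia|lia].
by rewrite dvdn_sub // dvdn_mulr.
Qed.

End Aperiodic.

Lemma closed_periodic : periodic X.
Proof.
move=> x; apply: contrapT => nx.
have xE n : (0 < n)%N -> ~ idempotents (pw x n).
  by move=> n0 En; apply: nx; exists n.
have FF := fact_filter_proper x.
have [p [psep pesc]] := @ext_probe X *%g (@mulgA X) mulC (fact_filter x) FF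
  (or_introl (fact_filter_sq x)) (@fact_base x) X (fact_filter x) id _
  (fun _ _ => erefl) (fun _ FA => FA) (fact_filter_nprin xE).
apply: (@not_injectively_closed X (fact_filter x) _ _ _ Xcl).
- by move=> s t st; exists p; exact: psep.
- by move=> y; exists p; exact: pesc.
Qed.

End Necessity.

(** * Infinite subgroups *)

Section Rees.
Variables (X : semigroupType) (J : set X).
Hypothesis mulC : forall x y : X, x * y = y * x.
Hypothesis Jideal : forall x y, J x -> J (x * y).

(** The Rees quotient by [J], with [None] for the class of [J]. The points [Some x] with [x] in [J]
    are outside the image of [rees], but associativity holds for them too. *)
Definition rees_op (a b : option X) : option X :=
  if a is Some x then if b is Some y then
    if `[< J (x * y) >] then None else Some (x * y) else None else None.

Definition rees x : option X := if `[< J x >] then None else Some x.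

Lemma rees_opC : commutative rees_op.
Proof. by move=> [x|] [y|] //=; rewrite mulC. Qed.

Lemma rees_opA : associative rees_op.
Proof.
move=> [x|] [y|] [z|] //=; last by case: asboolP.
have [yz|yz] := asboolP (J (y * z)); have [xy|xy] := asboolP (J (x * y)) => //=.
- case: asboolP => //; case.
  by rewrite -mulgA mulC; exact: Jideal.
- case: asboolP => //; case.
  by rewrite mulgA; exact: Jideal.
- by rewrite mulgA.
Qed.

Lemma reesM x y : rees (x * y) = rees_op (rees x) (rees y).
Proof.
rewrite /rees; have [Jx|nJx] := asboolP (J x) => /=.
  by case: asboolP => // -[]; exact: Jideal.
have [Jy|//] := asboolP (J y) => /=.
by case: asboolP => // -[]; rewrite mulC; exact: Jideal.
Qed.

Lemma rees_inj x y : x <> y -> ~ (J x /\ J y) -> rees x <> rees y.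
Proof.
rewrite /rees => xy nJ; have [Jx|_] := asboolP (J x); have [Jy|_] := asboolP (J y) => //.
  by case: nJ.
by case.
Qed.

Lemma rees_probe (F : set_system X) : ProperFilter F -> F J ->
  exists p : probe F, (forall s t, s <> t -> ~ (J s /\ J t) -> pf p s <> pf p t) /\
    (forall x, ~ J x -> pf p x <> plim p).
Proof.
move=> FF FJ.
have [|p [psep pesc]] := @discrete_probe X F FF _ _ rees_opA rees None reesM.
  by apply: filterS FJ => x Jx; rewrite /= /rees asboolT.
exists p; split=> [s t st nJ|x nJx]; first by apply: psep; exact: rees_inj.
by apply: pesc; rewrite /rees asboolF.
Qed.

End Rees.

Section Translates.
Variable X : semigroupType.
Hypothesis mulC : forall x y : X, x * y = y * x.

Definition set_op (A B : set X) : set X := [set a * b | a in A & b in B].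

Lemma set_opA : associative set_op.
Proof.
move=> A B D; apply/seteqP; split=> z.
  move=> [a Aa [_ [b Bb [d Dd <-]] <-]].
  exists (a * b); first by exists a => //; exists b.
  by exists d; rewrite // mulgA.
move=> [_ [a Aa [b Bb <-]] [d Dd <-]]; exists a => //.
by exists (b * d); [exists b => //; exists d|rewrite mulgA].
Qed.

Variables (e : X) (V : set X).
Hypothesis Ve : V e.
Hypothesis VM : forall x y, V x -> V y -> V (x * y).
Hypothesis Vid : forall x, V x -> e * x = x.

(** The coset map of [V], with values in the semigroup of subsets of [X], so that no quotient has to
    be formed. *)
Definition translate x : set X := [set v * x | v in V].

Lemma translateM x y : translate (x * y) = set_op (translate x) (translate y).
Proof.
apply/seteqP; split=> z.
  move=> [v Vv <-]; exists (v * x); first by exists v.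
  exists (e * y); first by exists e.
  by rewrite mulACA // (mulC v e) Vid.
move=> [_ [v Vv <-] [_ [w Vw <-] <-]]; exists (v * w); first exact: VM.
by rewrite mulACA.
Qed.

Lemma translate_id v x : V v -> (exists2 w, V w & v * w = e) ->
  translate (v * x) = translate x.
Proof.
move=> Vv [w Vw vw]; apply/seteqP; split=> z [v' Vv' <-].
  by exists (v' * v); [exact: VM|rewrite mulgA].
exists (v' * w); first exact: VM.
by rewrite mulgA -(mulgA v') (mulC w v) vw (mulC v' e) Vid.
Qed.

End Translates.

Section InfiniteGroup.
Variable X : semigroupType.
Hypothesis mulC : forall x y : X, x * y = y * x.
Hypothesis Xcl : injectively_closed TzS X.
Hypothesis per : periodic X.
Hypothesis ns : ~ singular X.
Variable e : X.
Hypothesis eE : idempotents e.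

Let piM := piM mulC per.
Let pi_idem := pi_idem per.

Let HcM := @HcM X mulC per e.

Lemma Hc_mul1 x : Hc e x -> e * x = x.
Proof. by move=> [cx <-]. Qed.

Lemma Hc_le x : e * pi x = e -> Hc e (e * x).
Proof.
move=> ex; split; first exact: clf_le.
by rewrite piM (pi_id per eE).
Qed.

(** Subgroups of the maximal group at [e]; inverses are powers, by periodicity, see [sub_inv]. *)
Definition sub G := [/\ G e, forall x y : X, G x -> G y -> G (x * y) & G `<=` Hc e].

Lemma sub_pw G x n : sub G -> G x -> G (pw x n).
Proof.
move=> [_ GM _] Gx; case: n => // n; elim: n => // n IHn.
by rewrite pwSS; exact: GM.
Qed.

Lemma sub_inv G x : sub G -> G x -> exists2 y, G y & x * y = e.
Proof.
move=> Gs Gx; have [_ _ /(_ _ Gx)[cx xe]] := Gs.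
have [n n0 nx] := pi_pw per x; exists (pw x (n + n).-1); first exact: sub_pw.
by rewrite -pwS ?prednK ?pwD ?nx ?xe ?eE //; lia.
Qed.

Lemma sub_cancel G x y : sub G -> G x -> G (x * y) -> e * y = y -> G y.
Proof.
move=> Gs Gx Gxy ey; have [z Gz xz] := sub_inv Gs Gx; have [_ GM _] := Gs.
by rewrite -ey -xz mulAC // (mulC _ z); exact: GM.
Qed.

Lemma finite_exponent (D : set X) : finite_set D ->
  exists2 M, (0 < M)%N & forall x, D x -> idempotents (pw x M).
Proof.
move=> /finite_seqP[s ->]; elim: s => [|x s [M M0 sM]]; first by exists 1%N.
have [n n0 nx] := pi_pw per x; exists (n * M)%N; first by rewrite muln_gt0 n0.
move=> y /=; rewrite inE => /orP[/eqP ->|ys].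
  by rewrite -pw_mul // nx pw_idem; exact: pi_idem.
by rewrite mulnC -pw_mul // pw_idem; exact: sM.
Qed.

Lemma sub_exponent G : sub G -> finite_set G ->
  exists2 M, (0 < M)%N & forall x, G x -> pw x M = e.
Proof.
move=> Gs /finite_exponent[M M0 GM]; exists M => // x Gx.
have [_ _ /(_ _ Gx)[_ <-]] := Gs.
by rewrite (pi_eq per M0) //; exact: GM.
Qed.

Lemma sub_Hc : sub (Hc e).
Proof. by split; [exact: Hc_id|exact: HcM|]. Qed.

(* Along [x_i^-1 x_j], where [j] tends to infinity and then [i]. *)
Definition quotient_filter (v : set_system nat) (x y : nat -> X) : set_system X :=
  [set Q | v [set i | v [set j | Q (y i * x j)]]].

Lemma quotient_filter_proper v x y : ProperFilter v ->
  ProperFilter (quotient_filter v x y).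
Proof.
move=> vF; apply: Build_ProperFilter_ex.
  move=> Q vQ; have [i vi] := @filter_ex _ v _ _ vQ.
  by have [j Qij] := @filter_ex _ v _ _ vi; exists (y i * x j).
split.
- change (v [set i | v [set j | True]]).
  by apply: filterS filterT => i _; exact: filterT.
- move=> P Q vP vQ; change (v [set i | v [set j | P (y i * x j) /\ Q (y i * x j)]]).
  apply: (@filterS2 _ v _ _ _ _ _ vP vQ) => i Pi Qi.
  by apply: (@filterS2 _ v _ _ _ _ _ Pi Qi) => j; split.
- move=> P Q PQ vP; change (v [set i | v [set j | Q (y i * x j)]]).
  apply: (@filterS _ v _ _ _ _ vP) => i Pi.
  by apply: (@filterS _ v _ _ _ _ Pi) => j; exact: PQ.
Qed.

(** * Maximal groups of unbounded exponent *)

Section Unbounded.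
Hypothesis unb : forall N, (0 < N)%N -> exists2 h, Hc e h & pw h N <> e.
Hypothesis Hfin : forall g, idempotents g -> g * e = g -> g <> e ->
  finite_set (Hc g).

Definition fsub G := sub G /\ finite_set G.

(** Let [M] be an exponent of [G]. If every [h] had some [h ^ k] in [G] with [k <= n], then
    [h ^ (k M) = e], and [n! * M] would be an exponent of the whole group. *)
Lemma fsub_extend (n : nat) G : fsub G -> exists x, [/\ Hc e x,
  forall k, (0 < k <= n)%N -> ~ G (pw x k) &
  fsub [set y | exists g k, [/\ G g, (0 < k)%N & y = g * pw x k]]].
Proof.
move=> [Gs Gfin]; have [M M0 GM] := sub_exponent Gs Gfin.
have [x Hx xN] : exists2 x, Hc e x & forall k, (0 < k <= n)%N -> ~ G (pw x k).
  apply: contrapT => nx.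
  have nM0 : (0 < n`! * M)%N by rewrite muln_gt0 fact_gt0.
  have [h Hh] := unb nM0; apply.
  have [k [/andP[k0 kn] Gk]] : exists k, (0 < k <= n)%N /\ G (pw h k).
    apply: contrapT => nk; apply: nx; exists h => // k kn Gk.
    by apply: nk; exists k.
  have /dvdnP[m nE] : (k %| n`!)%N by rewrite dvdn_fact // k0.
  have m0 : (0 < m)%N by move: (fact_gt0 n); rewrite nE; case: (m).
  rewrite nE mulnC mulnA mulnAC -pw_mul ?muln_gt0 ?M0 //.
  by rewrite (mulnC M) -pw_mul // GM // pw_idem.
exists x; split=> //; have [Ge GM' GH] := Gs.
have [N N0 Nx] := pi_pw per x; have [_ xe] := Hx; rewrite xe in Nx.
have HP k : Hc e (pw x k) by exact: sub_pw sub_Hc Hx.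
split; first split.
- by exists e, N; split=> //; rewrite Nx.
- move=> _ _ [g [k [Gg k0 ->]]] [h [l [Gh l0 ->]]]; exists (g * h), (k + l)%N.
  by split; [exact: GM'|rewrite addn_gt0 k0|rewrite pwD // mulACA].
- by move=> _ [g [k [Gg k0 ->]]]; apply: HcM => //; exact: GH.
(* Since [pw x 0] is a junk value, residues modulo [N] are represented by exponents from [N] to
   [2 N - 1]. *)
pose D := [set pw x k | k in `I_(N + N)].
apply: (@sub_finite_set _ _ [set g * d | g in G & d in D]); last first.
  by apply: finite_image2 => //; exact/finite_image/finite_II.
move=> _ [g [k [Gg k0 ->]]]; exists g => //.
exists (pw x (N + k %% N)).
  by exists (N + k %% N)%N => //=; rewrite ltn_add2l ltn_pmod.
congr (_ * _).
have period q r : (0 < r)%N -> pw x (r + q * N) = pw x r.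
  move=> r0; have [->|q0] := posnP q; first by rewrite addn0.
  by rewrite pwD ?muln_gt0 ?q0 // mulnC -pw_mul // Nx (pw_idem q eE) mulC Hc_mul1.
rewrite -(period 1%N k) // mul1n {2}(divn_eq k N).
rewrite -(period (k %/ N) (N + k %% N)%N) ?addn_gt0 ?N0 //.
by congr pw; lia.
Qed.

Lemma Hc_sequence : exists (x : nat -> X) (G : nat -> set X), [/\
  forall i, Hc e (x i), forall i, sub (G i),
  forall i j, (i <= j)%N -> G i `<=` G j,
  forall i, G i.+1 (x i) &
  forall i k, (0 < k <= 2 ^ i)%N -> ~ G i (pw (x i) k)].
Proof.
have /choice[f fP] : forall p : nat * set X, exists x, fsub p.2 -> [/\ Hc e x,
    forall k, (0 < k <= 2 ^ p.1)%N -> ~ p.2 (pw x k) &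
    fsub [set y | exists g k, [/\ p.2 g, (0 < k)%N & y = g * pw x k]]].
  move=> [i G]; have [fG|nG] := pselect (fsub G); last by exists e.
  by have [x xP] := fsub_extend (2 ^ i) fG; exists x.
pose next i G := [set y | exists g k, [/\ G g, (0 < k)%N & y = g * pw (f (i, G)) k]].
pose G i := iteri i next [set e].
have fG i : fsub (G i).
  elim: i => [|i IHi]; last by have [] := fP (i, G i) IHi.
  split; last exact: finite_set1.
  by split=> // [_ _ -> ->|_ ->] //; exact: Hc_id.
have GS i : G i `<=` G i.+1.
  move=> g Gg; have [Hx _ _] := fP (i, G i) (fG i).
  have [N N0 Nx] := pi_pw per (f (i, G i)); exists g, N; split=> //.
  have [_ _ GH] := (fG i).1.
  by rewrite Nx (Hx.2) mulC Hc_mul1 //; exact: GH.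
exists (fun i => f (i, G i)), G; split.
- by move=> i; have [] := fP (i, G i) (fG i).
- by move=> i; have [] := fG i.
- move=> i j; elim: j => [|j IHj]; first by rewrite leqn0 => /eqP ->.
  by rewrite leq_eqVlt => /orP[/eqP -> //|/IHj ij]; exact: subset_trans (GS j).
- move=> i; have [Hx _ _] := fP (i, G i) (fG i); have [Ge _ _] := (fG i).1.
  by exists e, 1%N; split=> //; rewrite Hc_mul1.
- by move=> i k; have [_ + _] := fP (i, G i) (fG i); exact.
Qed.

Section Sequence.
Variables (x : nat -> X) (G : nat -> set X).
Hypothesis Hx : forall i, Hc e (x i).
Hypothesis Gsub : forall i, sub (G i).
Hypothesis GS : forall i j, (i <= j)%N -> G i `<=` G j.
Hypothesis Gx : forall i, G i.+1 (x i).
Hypothesis xG : forall i k, (0 < k <= 2 ^ i)%N -> ~ G i (pw (x i) k).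

(* These sets tend to infinity in [\bigcup_i G i]: they are closed under
   multiplication up to the index and invariant under [G m]. *)
Definition gtail m : set X := [set y | exists i g k,
  [/\ (m <= i)%N, G i g, (0 < k)%N, (k * 2 ^ m <= 2 ^ i)%N & y = g * pw (x i) k]].

Let GM i a b : G i a -> G i b -> G i (a * b).
Proof. by have [_ + _] := Gsub i; exact. Qed.

Let GHc i a : G i a -> Hc e a.
Proof. by have [_ _] := Gsub i; exact. Qed.

Let Ge i : G i e. Proof. by have [] := Gsub i. Qed.

Lemma gtailS m n : (m <= n)%N -> gtail n `<=` gtail m.
Proof.
move=> mn y [i [g [k [ni Gg k0 ki ->]]]]; exists i, g, k; split=> //.
  exact: leq_trans ni.
by apply: leq_trans ki; rewrite leq_mul2l leq_exp2l // mn orbT.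
Qed.

Lemma gtail_bigcup m y : gtail m y -> exists j, G j y.
Proof.
move=> [i [g [k [mi Gg k0 ki ->]]]]; exists i.+1; apply: GM.
  by apply: GS Gg; exact: leqnSn.
exact: sub_pw (Gsub _) (Gx i).
Qed.

Lemma gtail_Hc m y : gtail m y -> Hc e y.
Proof. by move=> /gtail_bigcup[j /GHc]. Qed.

Lemma gtail_notin m y : gtail m y -> ~ G m y.
Proof.
move=> [i [g [k [mi Gg k0 ki ->]]]] Gy; apply: (xG (i := i) (k := k)).
  by rewrite k0 /=; apply: leq_trans ki; rewrite leq_pmulr // expn_gt0.
apply: sub_cancel Gg (GS mi Gy) _ => //.
by apply: Hc_mul1; exact: sub_pw sub_Hc (Hx i).
Qed.

Lemma gtail_mull m h y : G m h -> gtail m y -> gtail m (h * y).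
Proof.
move=> Gh [i [g [k [mi Gg k0 ki ->]]]]; exists i, (h * g), k; split=> //.
  by apply: GM => //; exact: GS Gh.
by rewrite mulgA.
Qed.

Lemma gtail_x m : gtail m (x m).
Proof.
exists m, e, 1%N; split; [by []|exact: Ge|by []|by rewrite mul1n|].
exact/esym/Hc_mul1/Hx.
Qed.

(** If the indices differ, the factor of smaller index is absorbed into the group at the larger
    index. If they agree, the exponents add up, and the stricter bound at [m.+1] leaves room for a
    factor of two. *)
Lemma gtailM m y z : gtail m.+1 y -> gtail m.+1 z -> gtail m (y * z).
Proof.
have up i k : (k * 2 ^ m.+1 <= 2 ^ i -> k * 2 ^ m <= 2 ^ i)%N.
  by apply: leq_trans; rewrite leq_mul2l leq_exp2l // leqnSn orbT.
move=> [i [g [k [mi Gg k0 ki ->]]]] [j [h [l [mj Gh l0 lj ->]]]].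
have mulE a b c d : a * b * (c * d) = a * (c * d) * b :> X by rewrite mulAC.
have [ij|ji|ij] := ltngtP i j.
- exists j, (g * pw (x i) k * h), l.
  split; [exact: ltnW| |by []|exact: up|by rewrite mulgA].
  apply: GM => //; apply: GM; first by apply: GS Gg; exact: ltnW.
  by apply: GS ij _ _; exact: sub_pw (Gsub _) (Gx i).
- exists i, (g * (h * pw (x j) l)), k; split; [exact: ltnW| |by []|exact: up|exact: mulE].
  apply: GM => //; apply: GM; first by apply: GS Gh; exact: ltnW.
  by apply: GS ji _ _; exact: sub_pw (Gsub _) (Gx j).
- rewrite -{}ij in Gh lj *; exists i, (g * h), (k + l)%N; split.
  + exact: ltnW.
  + exact: GM.
  + by rewrite addn_gt0 k0.
  + by move: ki lj; rewrite expnS mulnDl; lia.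
  + by rewrite pwD // mulACA.
Qed.

(** Write [y = x_m (x_m^-1 y)]: the inverse lies in [G m.+1], so the second factor stays in the
    tail. With [gtailM] this makes the filter of tails idempotent. *)
Lemma gtail_split m y : gtail m.+1 y -> exists a b,
  [/\ gtail m a, gtail m b & y = a * b].
Proof.
move=> [i [g [k [mi Gg k0 ki ->]]]].
have [z Gz xz] := sub_inv (Gsub _) (Gx m).
have xiH : Hc e (pw (x i) k) by exact: sub_pw sub_Hc (Hx i).
exists (x m), (z * g * pw (x i) k); split.
- exact: gtail_x.
- exists i, (z * g), k; split; [by lia| |by []| |by []].
    by apply: GM => //; apply: (GS mi).
  by apply: leq_trans ki; rewrite leq_mul2l leq_exp2l // leqnSn orbT.
- by rewrite !mulgA xz -mulgA Hc_mul1 //; apply: HcM => //; exact: GHc Gg.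
Qed.

(** The ideal of elements whose idempotent is not above [e]. The map [q] below sends it to zero and
    all other elements into the group at [e]. *)
Let J : set X := [set y | e * pi y <> e].

Lemma Jideal a b : J a -> J (a * b).
Proof.
rewrite /J /= piM => ea eab; apply: ea.
by rewrite -{1}eab mulAC // -mulgA mul_idem.
Qed.

Lemma Hc_notJ y : Hc e y -> ~ J y.
Proof. by move=> [_ ye] Jy; apply: Jy; rewrite ye. Qed.

Let op := rees_op J.
Let opC : commutative op := rees_opC J mulC.
Let opA : associative op := rees_opA mulC Jideal.
Let q y := rees J (e * y).

Let qM a b : q (a * b) = op (q a) (q b).
Proof. by rewrite /q /op -reesM //; [congr rees; rewrite mulACA // eE|exact: Jideal]. Qed.

Lemma qE y : e * pi y = e -> q y = Some (e * y).
Proof.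
move=> ey; rewrite /q /rees asboolF //; apply: Hc_notJ; exact: Hc_le.
Qed.

Lemma qN y : e * pi y <> e -> q y = None.
Proof. by move=> ey; rewrite /q /rees asboolT // /J /= piM (pi_id per eE) mul_idem. Qed.

Definition gfilter : set_system (option X) :=
  [set Q | exists m, forall y, gtail m y -> Q (Some y)].

Lemma gtail_xi i j m : (i < j)%N -> (m <= j)%N ->
  forall y, G i.+1 y -> gtail m (y * x j).
Proof.
move=> ij mj y Gy; exists j, y, 1%N; split=> //; first exact: GS Gy.
by rewrite mul1n leq_exp2l.
Qed.

Lemma gfilter_proper : ProperFilter gfilter.
Proof.
apply: Build_ProperFilter_ex.
  move=> Q [m mQ]; exists (Some (x m)); apply: mQ; exact: gtail_x.
split; first by exists 0%N.
  move=> P Q [m mP] [n nQ]; exists (maxn m n) => y ny; split.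
    by apply: mP; apply: gtailS ny; exact: leq_maxl.
  by apply: nQ; apply: gtailS ny; exact: leq_maxr.
by move=> P Q PQ [m mP]; exists m => y /mP/PQ.
Qed.

Definition gtrans h : set_system (option X) :=
  [set Q | exists m, forall y, gtail m y -> Q (Some (h * y))].

Lemma ext_dom_g p : ext_dom op gfilter p ->
  (exists s, p = prin s) \/ exists2 h, Hc e h & p = gtrans h.
Proof.
have FF := gfilter_proper; have Fe : gfilter = gtrans e.
  apply/seteqP; split=> Q [m mQ]; exists m => y my; first rewrite Hc_mul1 //.
  - exact: mQ.
  - exact: gtail_Hc my.
  - by have := mQ _ my; rewrite Hc_mul1 //; exact: gtail_Hc my.
case=> [|->|[s ->]]; first by left.
  by right; exists e => //; exact: Hc_id.
rewrite fprod_prinE; have none P : (forall m y, gtail m y -> op s (Some y) = None) ->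
    gfilter [set a | P (op s a)] <-> P None.
  move=> sN; split=> [[m mP]|PN]; last by exists 0%N => y /sN /= ->.
  by have := mP _ (gtail_x m); rewrite /= (sN _ _ (gtail_x m)).
case: s none => [s|] none; last first.
  by left; exists None; apply/seteqP; split=> P /none; exact.
have piy m y : gtail m y -> pi y = e by move=> /gtail_Hc[].
have [es|nes] := pselect (e * pi s = e); last first.
  have sN m y : gtail m y -> op (Some s) (Some y) = None.
    by move=> /piy ye; rewrite /= asboolT // /J /= piM ye (mulC (pi s)) mul_idem.
  by left; exists None; apply/seteqP; split=> P /(none P sN).
right; exists (e * s); first exact: Hc_le.
have opE m y : gtail m y -> op (Some s) (Some y) = Some (e * s * y).
  move=> my; rewrite /= asboolF; last first.
    by rewrite /J /= piM (piy _ _ my) (mulC (pi s)) mul_idem // es => /(_ erefl).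
  by rewrite (mulAC mulC) Hc_mul1 1?(mulC y) //; exact: gtail_Hc my.
apply/seteqP; split=> Q [m mQ]; exists m => y my; have := mQ _ my => /=.
  by rewrite -(opE _ _ my).
by rewrite -(opE _ _ my).
Qed.

Lemma gfilter_sq : fprod op gfilter gfilter = gfilter.
Proof.
have opE y z m n : gtail m y -> gtail n z -> op (Some y) (Some z) = Some (y * z).
  move=> /gtail_Hc[_ ye] /gtail_Hc[_ ze].
  by rewrite /= asboolF // /J /= piM ye ze eE => /(_ eE).
apply/seteqP; split=> Q.
  move=> [A [B [[a aA] [b bB] ABQ]]]; exists (maxn a b).+1.
  move=> y /gtail_split[y1 [y2 [y1m y2m ->]]]; rewrite -(opE _ _ _ _ y1m y2m).
  apply: ABQ; [apply: aA; apply: gtailS y1m; exact: leq_maxl|].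
  by apply: bB; apply: gtailS y2m; exact: leq_maxr.
move=> [m mQ]; pose B := [set a | exists2 y, gtail m.+1 y & a = Some y].
have gB : gfilter B by exists m.+1 => y my; exists y.
exists B, B; split=> // _ _ [y my ->] [z mz ->]; rewrite (opE _ _ _ _ my mz).
by apply: mQ; exact: gtailM.
Qed.

Lemma mulI_Hc h y z : Hc e h -> e * y = y -> e * z = z -> h * y = h * z -> y = z.
Proof.
move=> Hh ey ez hyz; have [k _ hk] := sub_inv sub_Hc Hh.
by rewrite -ey -ez -hk (mulC h) -!mulgA hyz.
Qed.

(** Let [U] be the union of the [G i]. Translates by elements of one coset of [U] have the same
    tails eventually, because tails are invariant under each [G i]; translates by elements of
    different cosets are disjoint. Singletons are avoided because [gtail i] misses [G i]. *)
Lemma gbase p A : ext_dom op gfilter p -> p A ->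
  exists B, [/\ p B, B `<=` A & decided op gfilter B].
Proof.
have GHcE i g : G i g -> e * g = g by move=> /GHc/Hc_mul1.
move=> /ext_dom_g[[s ->] As|[h Hh -> [m mA]]].
  exists [set s]; split=> //; first by move=> _ ->.
  move=> r /ext_dom_g[[t ->]|[h Hh ->]]; first exact: EM.
  right; case: s {As} => [z|]; last by exists 0%N.
  have [[i [g [Gg zE]]]|nz] := pselect (exists i g, G i g /\ z = h * g).
    exists i => y iy [] yz; apply: (gtail_notin iy).
    suff -> : y = g by [].
    by apply: (mulI_Hc Hh); [exact/Hc_mul1/(gtail_Hc iy)|exact: GHcE Gg|rewrite yz].
  exists 0%N => y /gtail_bigcup[i Gy] [] yz; apply: nz; exists i, y.
  by split.
pose B := [set a | exists2 y, gtail m y & a = Some (h * y)].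
exists B; split.
- by exists m => y my; exists y.
- by move=> _ [y my ->]; exact: mA.
move=> r /ext_dom_g[[t ->]|[h' Hh' ->]]; first exact: EM.
have [[i [g [Gg h'E]]]|nh] := pselect (exists i g, G i g /\ h' = h * g).
  left; exists (maxn i m) => y my; exists (g * y); last by rewrite h'E mulgA.
  have /gtailS : (m <= maxn i m)%N by exact: leq_maxr.
  by apply; apply: gtail_mull my; apply: GS Gg; exact: leq_maxl.
right; exists 0%N => y /gtail_bigcup[i Gy] [z /gtail_bigcup[j Gz] [] yz].
apply: nh; have Gy' : G (maxn i j) y by apply: GS Gy; exact: leq_maxl.
have Gz' : G (maxn i j) z by apply: GS Gz; exact: leq_maxr.
have [w Gw yw] := sub_inv (Gsub _) Gy'.
exists (maxn i j), (z * w); split; first exact: GM.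
by rewrite mulgA -yz -mulgA yw mulC Hc_mul1.
Qed.

Lemma gfilter_nprin s : gfilter <> prin s.
Proof.
move=> Fs; have [m ms] : gfilter [set s] by rewrite Fs.
have := ms _ (gtail_x m); have mx : gtail m (x m.+1).
  by apply: gtailS (gtail_x m.+1); exact: leqnSn.
have <- := ms _ mx; move=> [] xx; apply: (xG (i := m.+1) (k := 1)).
  by rewrite expn_gt0.
by rewrite -xx; exact: Gx.
Qed.

(** The extension built on [q] excludes all limits in [X], but it does not separate points of [e X]
    that are not above [e]. The groups below [e] being finite, [x_i^-1 x_j] eventually fixes any two
    such points [s] and [t]. Hence the common stabiliser [V] of [s] and [t] is large, its coset map
    is constant along the filter, and it sends [s] and [t] to distinct singletons. *)
Lemma sequence_absurd : False.
Proof.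
have [v [vu vT vfin]] := free_ultrafilter infinite_nat.
have tail m : v [set j | (m <= j)%N].
  apply: contrapT => /(ultraN vu) nm; apply: (vfin _ (finite_II m)).
  by apply: filterS nm => j /=; rewrite ltnNge => /negP.
have /choice[y yP] : forall i, exists y, G i.+1 y /\ x i * y = e.
  by move=> i; have [y Gy xy] := sub_inv (Gsub _) (Gx i); exists y.
pose F := quotient_filter v x y.
have FF : ProperFilter F by exact: quotient_filter_proper.
have FHc : F (Hc e).
  change (v [set i | v [set j | Hc e (y i * x j)]]).
  apply: filterS filterT => i _; apply: filterS filterT => j _ /=.
  by apply: HcM => //; have [/GHc] := yP i.
have Fg A : gfilter A -> F [set z | A (q z)].
  move=> [m mA]; change (v [set i | v [set j | A (q (y i * x j))]]).
  apply: filterS filterT => i _.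
  apply: filterS2 (tail i.+1) (tail m) => j ij mj /=; have [Gy _] := yP i.
  have Hyx : Hc e (y i * x j) by apply: HcM => //; exact: GHc Gy.
  rewrite qE ?(Hyx.2) // Hc_mul1 //; apply: mA.
  exact: gtail_xi ij mj _ Gy.
have GF := gfilter_proper.
have [p0 [p0sep p0esc]] := @ext_probe _ op opA opC gfilter GF (or_introl gfilter_sq)
  gbase X F q _ qM Fg gfilter_nprin.
pose K : set X := [set z | e * z = z].
have Kideal a b : K a -> K (a * b) by rewrite /K /= mulgA => ->.
have FK : F K by apply: filterS FHc => z; exact: Hc_mul1.
have [p1 [p1sep _]] := rees_probe mulC Kideal FF FK.
apply: (@not_injectively_closed X F _ _ _ Xcl); last by move=> z; exists p0; exact: p0esc.
move=> s t st; have [[Ks Kt]|nK] := pselect (K s /\ K t); last first.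
  by exists p1; exact: p1sep.
have [qst|qst] := pselect (q s = q t); last by exists p0; exact: p0sep.
have [es|es] := pselect (e * pi s = e).
  move: qst; rewrite (qE es); have [et|et] := pselect (e * pi t = e).
    by rewrite qE // Ks Kt => -[/st].
  by rewrite qN.
have [et|et] := pselect (e * pi t = e); first by move: qst; rewrite qN // qE.
(* Here [pi z] is strictly below [e], so its group is finite and [z * x j] is constant for most [j],
   by nonsingularity; multiplication by the inverse of [x i] then returns [z]. *)
have fixes z : K z -> e * pi z <> e -> F [set a | a * z = z].
  move=> Kz ez; have ze : pi z * e = pi z.
    by rewrite -{2}Kz piM (pi_id per eE) mulC.
  have [d zd] : ucst v (fun j => z * x j).
    apply: nonsingular_pi => //; apply: (Hc_ucst vu (e := pi z)).
      by apply: Hfin => // zeq; apply: ez; rewrite zeq.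
    apply: filterS filterT => j _ /=; have [_ xe] := Hx j.
    split; last by rewrite piM xe pi_mul.
    by apply: clf_le; rewrite ?xe //; exact: pi_idem.
  change (v [set i | v [set j | y i * x j * z = z]]).
  apply: filterS (zd) => i /= zi; apply: filterS zd => j /= zj.
  rewrite -mulgA (mulC (x j)) zj -zi (mulC (y i)) -mulgA.
  by have [_ ->] := yP i; rewrite mulC.
pose V : set X := [set a | [/\ Hc e a, a * s = s & a * t = t]].
have Ve : V e by split=> //; exact: Hc_id.
have VM a b : V a -> V b -> V (a * b).
  move=> [Ha as_ at_] [Hb bs bt]; split; first exact: HcM.
    by rewrite -mulgA bs.
  by rewrite -mulgA bt.
have Vid a : V a -> e * a = a by move=> [/Hc_mul1].
have Vsub : sub V by split=> // a [].
have FV : F [set a | translate V a = translate V e].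
  apply: filterS3 (FHc) (fixes _ Ks es) (fixes _ Kt et) => a Ha as_ at_.
  have Va : V a by [].
  rewrite /= -{1}(Vid _ Va) mulC.
  exact: (translate_id mulC VM Vid e Va (sub_inv Vsub Va)).
have fix1 z : (forall a, V a -> a * z = z) -> translate V z = [set z].
  move=> Vz; apply/seteqP; split=> [_ [a Va <-]|_ ->]; first exact: Vz.
  by exists e => //; exact: Vz.
have [p2 [p2sep _]] := @discrete_probe X F FF _ _ (@set_opA X) (translate V)
  (translate V e) (translateM mulC Ve VM Vid) FV.
exists p2; apply: p2sep; rewrite !fix1 => [E||]; last 2 first.
- by move=> a [].
- by move=> a [].
by apply: st; have : [set t] s by rewrite -E.
Qed.

End Sequence.

Lemma unbounded_absurd : False.
Proof.
by have [x [G [Hx Gs GS Gx xG]]] := Hc_sequence; exact: (sequence_absurd Hx Gs GS Gx xG).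
Qed.

End Unbounded.

(** * Countable groups of prime exponent *)

Section Elementary.
Variables (p : nat) (G : set X) (gn : nat -> X).
Hypothesis p_prime : prime p.
Hypothesis Gsub : sub G.
Hypothesis Ginf : infinite_set G.
Hypothesis Gp : forall g, G g -> pw g p = e.
Hypothesis gnP : forall g, G g -> exists n, g = gn n.

Let p_gt0 : (0 < p)%N. Proof. exact: prime_gt0. Qed.
Let Ge : G e. Proof. by have [] := Gsub. Qed.
Let GM a b : G a -> G b -> G (a * b). Proof. by have [_ + _] := Gsub; exact. Qed.
Let GHc a : G a -> Hc e a. Proof. by have [_ _] := Gsub; exact. Qed.

(** Viewing [G] as a vector space over the field with [p] elements, these are its hyperplanes and
    [G] itself. Exponents run from 1 to [p] to avoid [pw h 0]. *)
Definition cofinite_sub V := [/\ sub V, V `<=` G & exists2 h, G h &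
  forall g, G g -> exists k v, [/\ (0 < k <= p)%N, V v & g = pw h k * v]].

Lemma pw_reduce g k : G g -> (0 < k)%N ->
  exists2 l, (0 < l <= p)%N & pw g k = pw g l.
Proof.
move=> Gg k0.
have mulp q : (0 < q)%N -> pw g (q * p) = e.
  by move=> q0; rewrite mulnC -pw_mul // Gp // (pw_idem q eE).
have [r0|r0] := posnP (k %% p).
  exists p; first by rewrite p_gt0 leqnn.
  have q0 : (0 < k %/ p)%N.
    by rewrite lt0n; apply/eqP => q0; move: k0; rewrite (divn_eq k p) q0 r0.
  by rewrite [in LHS](divn_eq k p) r0 addn0 mulp // Gp.
exists (k %% p)%N; first by rewrite r0 ltnW // ltn_pmod.
rewrite [in LHS](divn_eq k p); have [->//|q0] := posnP (k %/ p).
rewrite pwD ?muln_gt0 ?q0 // mulp // Hc_mul1 //.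
by apply: sub_pw sub_Hc _; exact: GHc.
Qed.

(** Take [V] maximal among the subgroups of [G] that contain [S] and miss [h]. For [g] outside [V],
    the subgroup generated by [V] and [g] contains [h], and the relation is solved for [g] modulo
    [p]. *)
Lemma hyperplane S h : sub S -> S `<=` G -> G h -> ~ S h ->
  exists V, [/\ sub V, V `<=` G, S `<=` V, ~ V h & forall g, G g ->
    exists k v, [/\ (0 < k <= p)%N, V v & g = pw h k * v]].
Proof.
move=> Ss SG Gh nSh.
pose P (A : set X) := A = set0 \/ [/\ sub A, A `<=` G, S `<=` A & ~ A h].
have [V [PV Vmax]] : exists A, P A /\ forall B, A `<` B -> ~ P B.
  apply: Zorn_bigcup => F FP Ftot.
  have [[A [FA A0]]|nF] := pselect (exists A, F A /\ A !=set0); last first.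
    left; rewrite -subset0 => x [A FA Ax]; apply: nF; exists A; split=> //.
    by exists x.
  have FPn B : F B -> B !=set0 -> [/\ sub B, B `<=` G, S `<=` B & ~ B h].
    by move=> FB [x Bx]; case: (FP _ FB) => // B0; move: Bx; rewrite B0.
  have [As AG SA nAh] := FPn _ FA A0.
  right; split.
  - split.
    + by exists A => //; have [] := As.
    + move=> x y [B FB Bx] [D FD Dy].
      have [[_ BM _] _ _ _] := FPn _ FB (ex_intro _ x Bx).
      have [[_ DM _] _ _ _] := FPn _ FD (ex_intro _ y Dy).
      have [BD|DB] := Ftot _ _ FB FD.
        by exists D => //; apply: DM => //; exact: BD.
      by exists B => //; apply: BM => //; exact: DB.
    + move=> x [B FB Bx].
      by have [[_ _ BH] _ _ _] := FPn _ FB (ex_intro _ x Bx); exact: BH.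
  - by move=> x [B FB Bx]; have [_ BG _ _] := FPn _ FB (ex_intro _ x Bx); exact: BG.
  - by move=> x Sx; exists A => //; exact: SA.
  - by move=> [B FB Bh]; have [_ _ _] := FPn _ FB (ex_intro _ h Bh).
have [Vs VG SV nVh] : [/\ sub V, V `<=` G, S `<=` V & ~ V h].
  case: PV => // V0; have [Se _ _] := Ss.
  by exfalso; apply: (Vmax S); [rewrite V0; split=> // /(_ _ Se)|right; split].
have [Ve VM VH] := Vs.
exists V; split=> // g Gg.
have [Vg|nVg] := pselect (V g).
  by exists p, g; rewrite p_gt0 leqnn Gp // Hc_mul1 //; exact: VH.
pose V' : set X := [set y | exists k v, [/\ (0 < k)%N, V v & y = pw g k * v]].
have VV' : V `<=` V'.
  by move=> v Vv; exists p, v; split=> //; rewrite Gp // Hc_mul1 //; exact: VH.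
have V'G : V' `<=` G.
  by move=> _ [k [v [k0 Vv ->]]]; apply: GM; [exact: sub_pw Gsub _|exact: VG].
have [k [v [k0 Vv hE]]] : V' h.
  apply: contrapT => nV'h; apply: (Vmax V').
    split=> // V'V; apply/nVg/V'V; exists 1%N, e; split=> //.
    by rewrite mulC Hc_mul1 //; exact: GHc.
  right; split=> //; last exact: subset_trans VV'.
  split; [exact: VV'| |by move=> y /V'G/GHc].
  move=> _ _ [k [v [k0 Vv ->]]] [l [w [l0 Vw ->]]]; exists (k + l)%N, (v * w).
  by rewrite addn_gt0 k0 pwD // mulACA //; split=> //; exact: VM.
have kp : coprime k p.
  rewrite coprime_sym prime_coprime //; apply/negP => /dvdnP[q kE]; apply: nVh.
  have q0 : (0 < q)%N by move: k0; rewrite kE; case: (q).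
  rewrite hE kE mulnC -pw_mul // Gp // (pw_idem q eE) Hc_mul1 //; exact: VH.
(* Bézout gives [a * k = b * p + 1]; raising [h = g ^ k v] to the power [a] yields
   [h ^ a = g v ^ a]. *)
have [a b abE _] := egcdnP p k0; rewrite (eqP kp) in abE.
have a0 : (0 < a)%N by move: abE; case: (a) => //; rewrite mul0n addn1.
have ga : pw g (a * k) = g.
  rewrite abE; have [->|b0] := posnP b; first by rewrite mul0n.
  rewrite pwD ?muln_gt0 ?b0 // mulnC -pw_mul // Gp // (pw_idem b eE) Hc_mul1 //.
  exact: GHc.
have [w Vw vw] := sub_inv Vs (sub_pw a Vs Vv).
have [l lp hl] := pw_reduce Gh a0.
exists l, w; split=> //; rewrite -hl hE pwM // pw_mul // mulnC ga -mulgA vw.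
by rewrite mulC Hc_mul1 //; exact: GHc.
Qed.

Lemma translate_cst V (u : set_system X) : UltraFilter u -> u G ->
  cofinite_sub V -> exists c, u [set g | translate V g = c].
Proof.
move=> uu uG [Vs VG [h Gh hV]]; have [Ve VM VH] := Vs.
have /choice[kap kapP] : forall g, exists k, G g ->
    (0 < k <= p)%N /\ exists2 v, V v & g = pw h k * v.
  move=> g; have [Gg|nGg] := pselect (G g); last by exists 0%N.
  by have [k [v [kp Vv gE]]] := hV _ Gg; exists k => _; split=> //; exists v.
have [||k0 _ uk] := @ultra_finite X nat u kap `I_p.+1 uu.
- exact: finite_II.
- by apply: filterS uG => g /kapP[/andP[_ kp] _]; rewrite /= ltnS.
exists (translate V (pw h k0)); apply: filterS2 uG uk => g /= /kapP[_ [v Vv gE]] gk.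
rewrite gE gk mulC; apply: (translate_id mulC VM _ _ Vv (sub_inv Vs Vv)).
by move=> w /VH/Hc_mul1.
Qed.

Lemma cofinite_subG : cofinite_sub G.
Proof.
split=> //; exists e => // g Gg; exists p, g; rewrite p_gt0 leqnn; split=> //.
by rewrite (pw_idem p eE) Hc_mul1 //; exact: GHc.
Qed.

(** Infinitely many elements of [W] lie in one coset of [V]; dividing them by one of their number
    moves them into [W] and [V]. *)
Lemma cofinite_infinite W V : sub W -> W `<=` G -> infinite_set W ->
  cofinite_sub V -> infinite_set (W `&` V).
Proof.
move=> Ws WG /free_ultrafilter[u [uu uW ufin]] [Vs VG [h Gh hV]] WVfin.
have [Ve VM VH] := Vs; have [We WM WH] := Ws.
have /choice[kap kapP] : forall g, exists k, G g ->
    (0 < k <= p)%N /\ exists2 v, V v & g = pw h k * v.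
  move=> g; have [Gg|nGg] := pselect (G g); last by exists 0%N.
  by have [k [v [kp Vv gE]]] := hV _ Gg; exists k => _; split=> //; exists v.
have uG : u G by apply: filterS uW.
have [||k0 _ uk] := @ultra_finite X nat u kap `I_p.+1 uu.
- exact: finite_II.
- by apply: filterS uG => g /kapP[/andP[_ kp] _]; rewrite /= ltnS.
have [w0 [Ww0 w0k]] := ultra_ex2 uu uW uk.
have [z Wz wz] := sub_inv Ws Ww0.
have [_ [v0 Vv0 w0E]] := kapP _ (WG _ Ww0).
have [v1 Vv1 v01] := sub_inv Vs Vv0.
have hz : pw h k0 * z = v1.
  have : w0 * z * v1 = v1 by rewrite wz Hc_mul1 //; exact: VH.
  rewrite w0E w0k => <-.
  rewrite -(mulgA (pw h k0)) -(mulgA (pw h k0)); congr (_ * _).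
  by rewrite (mulAC mulC) v01 Hc_mul1 //; exact: WH.
have [|d _ ud] := @ultra_finite X X u (fun w => w * z) (W `&` V) uu WVfin.
  apply: filterS2 uW uk => w Ww wk; split; first exact: WM.
  have [_ [v Vv wE]] := kapP _ (WG _ Ww).
  by rewrite wE wk (mulAC mulC) hz; exact: VM.
apply: (ufin [set d * w0]); first exact: finite_set1.
apply: filterS2 uW ud => w Ww /= <-.
by rewrite -mulgA (mulC z) wz mulC Hc_mul1 //; exact: WH.
Qed.

Definition coset_state := (set X * X)%type.

Definition good_state (st : coset_state) :=
  [/\ sub st.1, st.1 `<=` G, infinite_set st.1 & G st.2].

Definition coset (st : coset_state) : set X := [set st.2 * w | w in st.1].

(** For [h] in [W] other than [e], choose a hyperplane [V] missing [h]. Then [a] and [a h] lie in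
    different cosets of [V], so one of them avoids that of [x]; pass to its coset of the
    intersection of [W] and [V], which is still infinite. *)
Lemma coset_step st x : good_state st -> exists st', [/\ good_state st',
  coset st' `<=` coset st & exists2 V, cofinite_sub V &
    forall g, coset st' g -> translate V g <> translate V x].
Proof.
case: st => W a [/= Ws WG Winf Ga]; have [We WM WH] := Ws.
have [h [Wh he]] : exists h, W h /\ h <> e.
  apply: contrapT => nh; apply: Winf; apply: (@sub_finite_set _ _ [set e]).
    by move=> w Ww; apply: contrapT => we; apply: nh; exists w.
  exact: finite_set1.
have Gh := WG _ Wh.
have se : sub [set e].
  by split=> // [_ _ -> ->|_ ->] //; exact: Hc_id.
have [||//|V [Vs VG _ nVh hV]] := @hyperplane [set e] h se.
- by move=> _ ->.
- exact: Gh.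
have [Ve VM VH] := Vs.
have cV : cofinite_sub V by split=> //; exists h.
have Vid v : V v -> e * v = v by move=> /VH/Hc_mul1.
have [a' [Wa' aa' a'x]] : exists a', [/\ G a', exists2 w, W w & a' = a * w &
    translate V a' <> translate V x].
  have [ax|ax] := pselect (translate V a = translate V x); last first.
    by exists a; split=> //; exists e; rewrite // mulC Hc_mul1 //; exact: GHc.
  exists (a * h); split; [exact: GM|by exists h|rewrite -ax => ah].
  have : translate V (a * h) (a * h).
    by exists e => //; rewrite Hc_mul1 //; apply: GHc; exact: GM.
  rewrite ah => -[v Vv va]; apply: nVh.
  suff <- : v = h by [].
  apply: (mulI_Hc (GHc Ga)); [exact: Vid|exact/Hc_mul1/WH|by rewrite mulC].
have WVs : sub (W `&` V).
  split=> // [x1 y1 [W1 V1] [W2 V2]|w [/WH]] //.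
  by split; [exact: WM|exact: VM].
exists (W `&` V, a'); split.
- by split=> //=; [move=> w [/WG]|exact: cofinite_infinite].
- move=> _ [w [/= Ww Vw] <-]; have [w' Ww' ->] := aa'.
  by exists (w' * w); [exact: WM|rewrite mulgA].
- exists V => // _ [w [/= Ww Vw] <-].
  by rewrite mulC (translate_id mulC VM Vid _ Vw (sub_inv Vs Vw)).
Qed.

(** The cosets produced along the enumeration [gn] shrink away from every point of [G], and an
    ultrafilter refining them is constant modulo each hyperplane. If [t = g s] differs from [s],
    then [g] is not in the stabiliser of [s], and a hyperplane that contains this stabiliser and
    misses [g] separates [s] from [t]. *)
Lemma elementary_absurd : False.
Proof.
have /choice[f fP] : forall nst : nat * coset_state, exists st', good_state nst.2 ->
    [/\ good_state st', coset st' `<=` coset nst.2 & exists2 V, cofinite_sub V &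
    forall g, coset st' g -> translate V g <> translate V (gn nst.1)].
  move=> [n st]; have [gst|nst] := pselect (good_state st); last by exists st.
  by have [st' st'P] := coset_step (gn n) gst; exists st'.
pose st n := iteri n (fun n s => f (n, s)) (G, e).
have gst n : good_state (st n).
  elim: n => [|n IHn]; first by split.
  by have [] := fP (n, st n) IHn.
have Qmono m n : (m <= n)%N -> coset (st n) `<=` coset (st m).
  elim: n => [|n IHn]; first by rewrite leqn0 => /eqP ->.
  rewrite leq_eqVlt => /orP[/eqP -> //|/IHn]; apply: subset_trans.
  by have [] := fP (n, st n) (gst n).
pose F : set_system X := [set Q | exists n, coset (st n) `<=` Q].
have FF : ProperFilter F.
  apply: Build_ProperFilter_ex.
    move=> Q [n nQ]; have [[We _ _] _ _ _] := gst n.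
    by exists ((st n).2 * e); apply: nQ; exists e.
  split; first by exists 0%N.
    move=> P Q [m mP] [n nQ]; exists (maxn m n) => y ny; split.
      by apply: mP; apply: Qmono ny; exact: leq_maxl.
    by apply: nQ; apply: Qmono ny; exact: leq_maxr.
  by move=> P Q PQ [n nP]; exists n; exact: subset_trans PQ.
have [u [uu Fu]] := ultraFilterLemma FF.
have uG : u G.
  by apply: Fu; exists 0%N => _ [g /= Gg <-]; exact: GM.
have uP : ProperFilter u by exact: ultra_proper.
pose K : set X := [set z | e * z = z].
have Kideal a b : K a -> K (a * b) by rewrite /K /= mulgA => ->.
have uK : u K by apply: filterS uG => z /GHc; exact: Hc_mul1.
have [p1 [p1sep p1esc]] := rees_probe mulC Kideal uP uK.
have pV V : cofinite_sub V -> exists c, u [set g | translate V g = c] /\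
    exists q : probe u,
    (forall s t, translate V s <> translate V t -> pf q s <> pf q t) /\
    (forall x, translate V x <> c -> pf q x <> plim q).
  move=> cV; have [c uc] := translate_cst uu uG cV; exists c; split=> //.
  have [[Ve VM VH] _ _] := cV.
  apply: (discrete_probe uP (@set_opA X) (translateM mulC Ve VM _) uc).
  by move=> w /VH/Hc_mul1.
apply: (@not_injectively_closed X u uP _ _ Xcl).
  move=> s t st_; have [[Ks Kt]|nK] := pselect (K s /\ K t); last first.
    by exists p1; exact: p1sep.
  have [sG|sG] := pselect (translate G s = translate G t); last first.
    have [c [_ [q [qsep _]]]] := pV _ cofinite_subG; exists q; exact: qsep.
  have [g Gg ts] : translate G s t by rewrite sG; exists e.
  pose S : set X := [set a | G a /\ a * s = s].
  have Ss : sub S.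
    split=> // [a b [Ga as_] [Gb bs]|a [/GHc]] //.
    by split; [exact: GM|rewrite -mulgA bs].
  have [||V [Vs VG SV nVg gV]] := @hyperplane S g Ss _ Gg.
  - by move=> a [].
  - by move=> [_ gs]; apply: st_; rewrite -ts gs.
  have [Ve VM VH] := Vs.
  have [|c [_ [q [qsep _]]]] := pV V; first by split=> //; exists g.
  exists q; apply: qsep => Vst; have [v Vv vt] : translate V s t by rewrite Vst; exists e.
  apply: nVg; have [w Vw vw] := sub_inv Vs Vv.
  suff : V (g * w).
    by move=> Vgw; apply: (sub_cancel Vs Vw); [rewrite mulC|exact/Hc_mul1/GHc].
  apply: SV; split; first by apply: GM => //; exact: VG.
  by rewrite (mulAC mulC) ts -vt (mulAC mulC) vw.
move=> x; have [Kx|nK] := pselect (K x); last by exists p1; exact: p1esc.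
have [Gx|nGx] := pselect (G x).
  have [n xn] := gnP Gx; have [_ _ [V cV Vn]] := fP (n, st n) (gst n).
  have [c [uc [q [_ qesc]]]] := pV _ cV; exists q; apply: qesc => xc.
  have uQ : u (coset (st n.+1)) by apply: Fu; exists n.+1.
  have [g [gc Qg]] := ultra_ex2 uu uc uQ.
  by apply: (Vn _ Qg); rewrite /= -xn xc.
have [c [uc [q [_ qesc]]]] := pV _ cofinite_subG; exists q; apply: qesc => xc.
have [g [gc Gg]] := ultra_ex2 uu uc uG; apply: nGx.
have [h Gh hg] : translate G x g.
  by rewrite xc -gc; exists e => //; rewrite Hc_mul1 //; exact: GHc.
by apply: (sub_cancel Gsub Gh) => //; rewrite hg.
Qed.

End Elementary.

(** * Reduction of bounded exponent to prime exponent *)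

Section Bounded.
Variable N : nat.
Hypothesis N_gt0 : (0 < N)%N.
Hypothesis Hinf : infinite_set (Hc e).
Hypothesis HN : forall h, Hc e h -> pw h N = e.

(** Let [n] be least with infinite [n]-torsion and [p] a prime factor of [n]. The power map with
    exponent [p] sends the [n]-torsion to the finite [n / p]-torsion, so one of its fibres is
    infinite, and a fibre is a translate of [p]-torsion elements. *)
Lemma prime_torsion : exists2 p, prime p &
  infinite_set [set h | Hc e h /\ pw h p = e].
Proof.
pose T n : set X := [set h | Hc e h /\ pw h n = e].
have exN : exists n, `[< (0 < n)%N /\ infinite_set (T n) >].
  exists N; apply/asboolP; split=> //; apply: sub_infinite_set Hinf => h Hh.
  by split=> //; exact: HN.
have [n /asboolP[n0 Tn] nmin] := ex_minnP exN.
have n1 : (1 < n)%N.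
  rewrite ltn_neqAle n0 andbT; apply/eqP => n1; apply: Tn; rewrite -n1.
  apply: (@sub_finite_set _ _ [set e]); last exact: finite_set1.
  by move=> h [_ /= he]; rewrite -he.
exists (pdiv n); first exact: pdiv_prime.
have /dvdnP[m nE] := pdiv_dvd n; set p := pdiv n in nE *.
have p0 : (0 < p)%N by exact: pdiv_gt0.
have m0 : (0 < m)%N by move: n0; rewrite nE; case: (m).
have Tm : finite_set (T m).
  apply: contrapT => mi; have : (n <= m)%N by apply: nmin; apply/asboolP.
  by rewrite leqNgt nE ltn_Pmulr // prime_gt1 // pdiv_prime.
move=> Tp; have [u [uu uT ufin]] := free_ultrafilter Tn.
have [|c _ uc] := @ultra_finite X X u (fun h : X => pw h p) (T m) uu Tm.
  apply: filterS uT => h [Hh hn]; split; first exact: sub_pw sub_Hc Hh.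
  by rewrite pw_mul // mulnC -nE.
have [h0 [[Hh0 _] h0c]] := ultra_ex2 uu uT uc.
have [k Hk hk] := sub_inv sub_Hc Hh0.
have [|d _ ud] := @ultra_finite X X u (fun h => k * h) (T p) uu Tp.
  apply: filterS2 uT uc => h [Hh _] hc; split; first exact: HcM.
  by rewrite pwM // hc -h0c -pwM // mulC hk (pw_idem p eE).
apply: (ufin [set h0 * d]); first exact: finite_set1.
apply: filterS2 uT ud => h [Hh _] /= <-.
by rewrite mulgA hk Hc_mul1.
Qed.

Lemma bounded_absurd : False.
Proof.
have [p pp /free_ultrafilter[u [uu uT ufin]]] := prime_torsion.
have [|b [bT b_inj]] := @ultra_sequence _ u _ (fun i j => i <> j) uu uT.
  apply: filterS filterT => i _; apply: (ultraN uu) => ui.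
  by apply: (ufin [set i]); [exact: finite_set1|apply: filterS ui => j /= ->].
(* Products of finite words in the [b i]: they form a countable subgroup, enumerated through
   [pickle], as the diagonal construction requires. *)
pose ev (s : seq nat) := foldr (fun i a => b i * a) e s.
have evH s : Hc e (ev s).
  elim: s => [|i s IHs] /=; first exact: Hc_id.
  by apply: HcM => //; have [] := bT i.
have evp s : pw (ev s) p = e.
  elim: s => [|i s IHs] /=; first exact: pw_idem.
  by rewrite pwM // IHs (bT i).2 eE.
have ev_cat s t : ev (s ++ t) = ev s * ev t.
  elim: s => [|i s IHs] /=; first by rewrite Hc_mul1.
  by rewrite IHs mulgA.
apply: (@elementary_absurd p (range ev) (fun n => ev (odflt [::] (unpickle n))) pp).
- split; first by exists [::].
    by move=> _ _ [s _ <-] [t _ <-]; exists (s ++ t).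
  by move=> _ [s _ <-].
- apply: sub_infinite_set (infinite_range b_inj) => _ [i _ <-].
  by exists [:: i] => //=; rewrite mulC Hc_mul1 //; have [] := bT i.
- by move=> _ [s _ <-].
- by move=> _ [s _ <-]; exists (pickle s); rewrite pickleK.
Qed.

End Bounded.
End InfiniteGroup.

Section GroupFinite.
Variable X : semigroupType.
Hypothesis mulC : forall x y : X, x * y = y * x.
Hypothesis Xcl : injectively_closed TzS X.

(** A minimal idempotent with an infinite group is chosen so that the groups strictly below it are
    finite, as the unbounded case demands. *)
Lemma closed_Hc_finite e : finite_set (@Hc X e).
Proof.
have per := closed_periodic mulC Xcl; have ns := closed_nonsingular mulC Xcl.
have cf := closed_chain_finite mulC Xcl.
apply: contrapT => Hinf; have [x [_ xe]] := infinite_setN0 Hinf.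
have [||t [tE Ht] tmin] := @idem_min X mulC cf
    [set t | idempotents t /\ infinite_set (Hc t)].
- by move=> t [].
- by exists e; split=> //; rewrite -xe; exact: pi_idem.
have [[N N0 HN]|nN] := pselect (exists2 N, (0 < N)%N & forall h, Hc t h -> pw h N = t).
  exact: (bounded_absurd mulC Xcl per tE N0 Ht HN).
apply: (unbounded_absurd mulC Xcl per ns tE).
  move=> N N0; apply: contrapT => nh; apply: nN; exists N => // h Hh.
  by apply: contrapT => hN; apply: nh; exists h.
move=> g gE gt ngt; apply: contrapT => Hg; apply: ngt; apply: tmin => //.
Qed.

End GroupFinite.

(** * Clifford-singular sets *)

Section Separation.
Variable X : semigroupType.
Hypothesis mulC : forall x y : X, x * y = y * x.
Hypothesis per : periodic X.
Hypothesis cf : chain_finite X.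
Hypothesis Hfin : forall e : X, finite_set (Hc e).

(* If the idempotents [pi (w i)] converge to [l], then [x |-> l x] is constant on
   a member of [u]; two points with the same image are not both multiples of
   [pi (w i)] for most [i], so that some Rees quotient separates them. *)
Lemma separation (I : choiceType) (u : set_system I) (w : I -> X) s t :
  UltraFilter u -> u [set i | clf (w i)] -> s <> t ->
  exists (S : Type) (op : S -> S -> S) (f : X -> S), [/\ associative op,
    forall x y, f (x * y) = op (f x) (f y), f s <> f t & ucst u (f \o w)].
Proof.
move=> uu uw st; have piE i : idempotents (pi (w i)) by exact: pi_idem.
have [l [lE ul lP]] := idem_lim mulC cf uu piE.
have [lst|lst] := pselect (l * s = l * t); last first.
  exists X, *%g, ( *%g l).
  split=> //; [exact: mulgA|by move=> x y; rewrite mulACA // lE|].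
  apply: (Hc_ucst uu (Hfin l)); apply: filterS ul => i /= li; split.
    exact: clf_le.
  by rewrite piM // (pi_id per lE).
have [P [uP nP]] : exists P : set I, u P /\
    ~ ((exists2 i, P i & pi (w i) * s = s) /\ (exists2 i, P i & pi (w i) * t = t)).
  have [us|/(ultraN uu) us] := pselect (u [set i | s * pi (w i) = s]); last first.
    by exists (~` [set i | s * pi (w i) = s]); split=> // -[[i nsi]]; rewrite mulC.
  have [ut|/(ultraN uu) ut] := pselect (u [set i | t * pi (w i) = t]); last first.
    by exists (~` [set i | t * pi (w i) = t]); split=> // -[_ [i nsi]]; rewrite mulC.
  by case: st; rewrite -(lP _ us) -(lP _ ut) mulC lst mulC.
pose J : set X := [set z | exists2 i, P i & pi (w i) * z = z].
have Jideal a b : J a -> J (a * b).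
  by move=> [i Pi ia]; exists i => //; rewrite mulgA ia.
exists (option X), (rees_op J), (rees J); split.
- exact: rees_opA.
- exact: reesM.
- exact: rees_inj.
- exists None; apply: filterS2 uP uw => i Pi wi /=.
  by rewrite /rees asboolT //; exists i.
Qed.

End Separation.

Section CliffordSingular.
Variable X : semigroupType.
Hypothesis mulC : forall x y : X, x * y = y * x.
Hypothesis Xcl : injectively_closed TzS X.
Let per : periodic X := closed_periodic mulC Xcl.
Let ns : ~ singular X := closed_nonsingular mulC Xcl.
Let cf : chain_finite X := closed_chain_finite mulC Xcl.
Let Hfin : forall e : X, finite_set (Hc e) := closed_Hc_finite mulC Xcl.

Definition clifford_singular_set (A : set X) := [/\ infinite_set A,
  forall a, A a -> ~ clf a & forall a b, A a -> A b -> clf (a * b)].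

Definition no_clifford_singular e := forall B : set X,
  (forall b, B b -> e * b = b) -> ~ clifford_singular_set B.

(** If the idempotents were constantly [e] on a large set, then [e * x], in a finite group, would be
    a constant [h], and the Clifford products [x * y] would all equal [h * h], against
    nonsingularity. *)
Lemma clifford_antichain A : clifford_singular_set A ->
  exists s : nat -> X, (forall n, A (s n)) /\ forall m n, m <> n ->
    pi (s m) * pi (s n) <> pi (s m).
Proof.
move=> [Ainf nA AA]; have [u [uu uA ufin]] := free_ultrafilter Ainf.
have piE x : idempotents (@pi X x) by exact: pi_idem.
have ncst : ~ ucst u (@pi X).
  move=> [e ue]; have [|h uh] := @Hc_ucst X X u uu (fun x => e * x) e (Hfin e).
    apply: filterS ue => x /= <-; split; first exact: clf_pi_mul.
    by rewrite piM // pi_mul // pi_pi.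
  have hE x y : [/\ A x, pi x = e & e * x = h] -> [/\ A y, pi y = e & e * y = h] ->
      x * y = h * h.
    move=> [Ax xe ex] [Ay ye ey]; rewrite -{1}ex -ey mulACA //.
    by have := AA _ _ Ax Ay; rewrite /clf piM // xe ye => ->.
  have uQ : u [set x | [/\ A x, pi x = e & e * x = h]].
    by apply: filterS3 uA ue uh => x.
  have [||c uc] := nonsingular_ultra mulC uu (w := id) (c := h * h) ns _ _.
  - by apply: filterS (uQ) => x Qx; exact: hE.
  - by apply: filterS (uQ) => x Qx; apply: filterS uQ => y Qy; exact: hE.
  - by apply: (ufin [set c]); [exact: finite_set1|exact: uc].
have [s [sA sR]] := ultra_sequence uu uA (antichain_ultra mulC cf uu piE ncst).
exists s; split=> // m n; have [mn|nm|//] := ltngtP m n => _.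
  by have [] := sR _ _ mn.
by rewrite mulC; have [] := sR _ _ nm.
Qed.

Lemma option_ultra (u : set_system X) : UltraFilter u ->
  UltraFilter [set Q : set (option X) | u [set x | Q (Some x)]].
Proof.
move=> uu; split.
  apply: Build_ProperFilter_ex => Q uQ.
  by have [x Qx] := @filter_ex _ u _ _ uQ; exists (Some x).
move=> F FF uF; apply/seteqP; split=> // Q FQ; apply: contrapT => /(ultraN uu) nQ.
have FnQ : F (~` Q) by exact: uF.
by have /filter_ex[x []] : F (Q `&` ~` Q) by exact: filterI.
Qed.

(** Pass to an antichain [A']. The ideal [J] generated by its products misses [A'], so modulo [J] a
    free ultrafilter on [A'] has zero square and can be adjoined. Points of [J] are fixed by
    idempotents [pi c] with [c] in [A'], so two of them stay distinct under some [g = pi c]. Along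
    [g * x] either most elements are Clifford, and [separation] applies, or the non-Clifford ones
    are finite in number, since no Clifford-singular set lies below [g]. *)
Lemma clifford_singular_step A : clifford_singular_set A ->
  (forall a, A a -> no_clifford_singular (pi a)) -> False.
Proof.
move=> Acs AncS; have [s [sA sR]] := clifford_antichain Acs.
have [_ nA AA] := Acs; pose A' := range s.
have A'A : A' `<=` A by move=> _ [n _ <-].
have A'R a b : A' a -> A' b -> pi a * pi b = pi b -> a = b.
  move=> [m _ <-] [n _ <-]; have [->//|/sR] := pselect (n = m).
  by rewrite (mulC (pi (s m))).
pose J : set X := [set z | exists a b, [/\ A' a, A' b &
  z = a * b \/ exists y, z = a * b * y]].
have Jideal x y : J x -> J (x * y).
  by move=> [a [b [Aa Ab [->|[z ->]]]]]; exists a, b; split=> //; right;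
    [exists y|exists (z * y); rewrite mulgA].
have mul_pi a b z : A' a -> A' b -> z = a * b \/ (exists y, z = a * b * y) ->
    pi a * z = z.
  move=> Aa Ab; suff E : pi a * (a * b) = a * b by case=> [->|[y ->]]; rewrite // mulgA E.
  have := AA _ _ (A'A _ Aa) (A'A _ Ab); rewrite /clf piM // => <-.
  by rewrite -(mulgA (pi a) (pi b)) mul_idem //; exact: pi_idem.
have Jpi z : J z -> exists2 a, A' a & pi a * z = z.
  by move=> [a [b [Aa Ab zE]]]; exists a => //; exact: mul_pi Ab zE.
have A'J c : A' c -> ~ J c.
  move=> Ac [a [b [Aa Ab cE]]]; have pc d y : A' d -> pi d * c = c -> d = c.
    by move=> Ad dc; apply: A'R => //; rewrite -{2}dc piM // pi_mul.
  have ac : a = c.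
    by apply: pc => //; exact: mul_pi Ab cE.
  have bc : b = c.
    by apply: pc => //; rewrite (mulC a) in cE; exact: mul_pi Aa cE.
  apply: (nA _ (A'A _ Ac)); rewrite ac bc in cE.
  exact: mul_pi cE.
have A'inf : infinite_set A'.
  apply: infinite_range => m n mn smn; apply: (sR m n).
    by move=> mn'; move: mn; rewrite mn' ltnn.
  by rewrite smn; exact: pi_pi.
have [u [uu uA' ufin]] := free_ultrafilter A'inf.
have uP : ProperFilter u by exact: ultra_proper.
pose F : set_system (option X) := [set Q | u [set x | Q (Some x)]].
have FU : UltraFilter F by exact: option_ultra.
have Fsq : fprod (rees_op J) F F = prin None.
  have opN a b : A' a -> A' b -> rees_op J (Some a) (Some b) = None.
    by move=> Aa Ab /=; rewrite asboolT //; exists a, b; split=> //; left.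
  apply/seteqP; split=> Q.
    move=> [P [R [uP' uR PRQ]]].
    have [a [Aa Pa]] := ultra_ex2 uu uA' uP'; have [b [Ab Rb]] := ultra_ex2 uu uA' uR.
    by rewrite /prin /= -(opN _ _ Aa Ab); exact: PRQ.
  move=> QN; pose B := [set a | exists2 x, A' x & a = Some x].
  have FB : F B.
    by change (u [set x | B (Some x)]); apply: filterS uA' => x Ax; exists x.
  by exists B, B; split=> // _ _ [x Ax ->] [y Ay ->]; rewrite opN.
have Fnp a : F <> prin a.
  move=> Fa; have : F [set a] by rewrite Fa.
  move=> Fs; have {Fs} : u [set x | Some x = a] := Fs.
  case: a {Fa} => [x|] Fx; last by have /filter_ex[] := Fx.
  by apply: (ufin [set x]); [exact: finite_set1|apply: filterS Fx => y [->]].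
have FG Q : F Q -> u [set x | Q (rees J x)].
  move=> FQ; have {FQ} : u [set x | Q (Some x)] := FQ.
  by apply: filterS2 uA' => x /A'J nJ /=; rewrite /rees asboolF.
have [p0 [p0sep p0esc]] := @ultra_probe _ _ (rees_opA mulC Jideal)
  (rees_opC J mulC) F FU (or_intror (ex_intro _ None Fsq)) Fnp X u (rees J) _
  (reesM mulC Jideal) FG.
apply: (@not_injectively_closed X u uP _ _ Xcl); last first.
  by move=> x; exists p0; exact: p0esc.
move=> a b ab; have [[Ja Jb]|nJ] := pselect (J a /\ J b); last first.
  by exists p0; apply: p0sep; exact: rees_inj.
have [c [Ac cab]] : exists c, A' c /\ pi c * a <> pi c * b.
  have [c Ac ca] := Jpi _ Ja; have [d Ad db] := Jpi _ Jb.
  have [cab|cab] := pselect (pi c * a = pi c * b); last by exists c.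
  exists d; split=> // dab; apply: ab.
  by rewrite -ca cab -db -dab (mulCA mulC) ca.
pose g := pi c; have gE : idempotents g by exact: pi_idem.
have gM x y : g * (x * y) = g * x * (g * y) by rewrite mulACA // gE.
have [ug|/(ultraN uu) ug] := pselect (u [set x | clf (g * x)]).
  have [S [op [f [opA fM fab [d ud]]]]] :=
    @separation X mulC per cf Hfin X u (fun x => g * x) _ _ uu ug cab.
  have [|q [qsep _]] := @discrete_probe X u uP S op opA (fun x => f (g * x)) d _ ud.
    by move=> x y; rewrite gM fM.
  by exists q; exact: qsep.
have [d ud] : ucst u (fun x => g * x).
  have Bfin : finite_set [set g * x | x in A' `&` [set x | ~ clf (g * x)]].
    apply: contrapT => Binf; apply: (AncS c (A'A _ Ac) _ _ (And3 Binf _ _)).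
    - by move=> _ [x _ <-]; exact: mul_idem.
    - by move=> _ [x [_ nx] <-].
    - move=> _ _ [x [Ax _] <-] [y [Ay _] <-]; rewrite -gM.
      by apply: clfM => //; [exact: clf_idem|apply: AA; exact: A'A].
  have [|d _ ud] := @ultra_finite X X u (fun x => g * x) _ uu Bfin; last by exists d.
  by apply: filterS2 uA' ug => x Ax nx; exists x.
have [q [qsep _]] := @discrete_probe X u uP X *%g (@mulgA X) (fun x => g * x) d gM ud.
by exists q; exact: qsep.
Qed.

(** Take [t] minimal such that a Clifford-singular set [B] lies in [t X]. If the inductive step
    fails at [b] in [B], then [pi b = t] by minimality, so [pi b * b = t * b = b] and [b] is
    Clifford. *)
Lemma closed_clifford_nonsingular : ~ Clifford_singular X.
Proof.
move=> [A [Ainf nA AA]].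
have Acs : clifford_singular_set A.
  split=> // [a /nA na ca|a b Aa Ab]; first by apply: na; exact/(Clifford_partE mulC per).
  apply/(Clifford_partE mulC per); apply: AA; exists a => //; exists b => //.
apply: (clifford_singular_step Acs) => a _.
apply: contrapT => na; pose D := [set e | idempotents e /\ ~ no_clifford_singular e].
have [||t [tE nt] tmin] := @idem_min X mulC cf D; first by move=> t [].
  by exists (pi a); split=> //; exact: pi_idem.
apply: nt => B Bt Bcs; apply: (clifford_singular_step Bcs) => b Bb.
apply: contrapT => nb; have [_ nB _] := Bcs; apply: (nB _ Bb).
have tb : pi b * t = pi b by rewrite -{2}(Bt _ Bb) piM // (pi_id per tE) mulC.
by rewrite /clf (tmin (pi b)) ?Bt //; split=> //; exact: pi_idem.
Qed.

End CliffordSingular.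

(** * Bounded exponent *)

Section IndexBounded.
Variable X : semigroupType.
Hypothesis mulC : forall x y : X, x * y = y * x.
Hypothesis per : periodic X.
Hypothesis cf : chain_finite X.
Hypothesis ncs : ~ Clifford_singular X.

Lemma finite_nonclifford (B : set X) : (forall x, B x -> ~ clf x) ->
  (forall x y, B x -> B y -> clf (x * y)) -> finite_set B.
Proof.
move=> nB BB; apply: contrapT => Binf; apply: ncs; exists B; split=> //.
  by move=> x Bx /(Clifford_partE mulC per); exact: nB.
by move=> _ [x Bx [y By <-]]; apply/(Clifford_partE mulC per); exact: BB.
Qed.

Lemma clf_mul_pw_le (s x : X) a b : (0 < a)%N -> (a <= b)%N ->
  clf (s * pw x a) -> clf (s * pw x b).
Proof.
move=> a0; rewrite leq_eqVlt => /orP[/eqP <- //|ab].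
rewrite -(subnKC ab) addSnnS pwD // /clf !piM // !pi_pwn // pi_pi // !mulgA.
by move=> ->.
Qed.

Lemma pw_loop (s x : X) a b t : (0 < a)%N -> (a < b)%N ->
  s * pw x a = s * pw x b -> s * pw x (a + t * (b - a)) = s * pw x a.
Proof.
move=> a0 ab sab; elim: t => [|t IHt]; first by rewrite addn0.
have b0 : (0 < b)%N by exact: ltn_trans ab.
rewrite mulSn addnA subnKC 1?ltnW //; have [->|t0] := posnP t.
  by rewrite addn0 -sab.
have d0 : (0 < t * (b - a))%N by rewrite muln_gt0 t0 subn_gt0.
by rewrite (pwD _ b0 d0) mulgA -sab -mulgA -(pwD _ a0 d0).
Qed.

Lemma pw_loop1 (x : X) a b t : (0 < a)%N -> (a < b)%N ->
  pw x a = pw x b -> pw x (a + t * (b - a)) = pw x a.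
Proof.
move=> a0 ab xab; elim: t => [|t IHt]; first by rewrite addn0.
rewrite mulSn addnA subnKC 1?ltnW //; have [->|t0] := posnP t.
  by rewrite addn0 -xab.
have d0 : (0 < t * (b - a))%N by rewrite muln_gt0 t0 subn_gt0.
have b0 : (0 < b)%N by exact: ltn_trans ab.
by rewrite (pwD _ b0 d0) -xab -(pwD _ a0 d0).
Qed.

Definition unbounded_index (D : set X) :=
  forall N, (0 < N)%N -> exists2 x, D x & ~ clf (pw x N).

Lemma unbounded_indexU (D1 D2 : set X) : unbounded_index (D1 `|` D2) ->
  unbounded_index D1 \/ unbounded_index D2.
Proof.
move=> U; apply: contrapT => /not_orP[/existsNP[M nM] /existsNP[N nN]].
have /not_implyP[M0 {}nM] := nM; have /not_implyP[N0 {}nN] := nN.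
have [|x Dx nx] := U (M + N)%N; first by rewrite addn_gt0 M0.
case: Dx => Dx; [apply: nM|apply: nN]; exists x => // cx; apply: nx.
  by apply: clf_pw_le cx => //; rewrite leq_addr.
by apply: clf_pw_le cx => //; rewrite leq_addl.
Qed.

Lemma unbounded_index_sequence D : unbounded_index D ->
  exists (x : nat -> X) (k m : nat -> nat), forall j, [/\ D (x j), (j < k j)%N,
    (k j + j < m j)%N, forall a, (0 < a < m j)%N -> ~ clf (pw (x j) a) &
    clf (pw (x j) (k j + k j))].
Proof.
move=> U.
have H j : exists xkm : X * (nat * nat), [/\ D xkm.1, (j < xkm.2.1)%N,
    (xkm.2.1 + j < xkm.2.2)%N, forall a, (0 < a < xkm.2.2)%N -> ~ clf (pw xkm.1 a) &
    clf (pw xkm.1 (xkm.2.1 + xkm.2.1))].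
  have [x Dx nx] := U (j + j + 2)%N (ltac:(by rewrite addn2)).
  have exn : exists n, (0 < n)%N && `[< clf (pw x n) >].
    by have [n n0 cn] := clf_pw_ex per x; exists n; rewrite n0; exact/asboolP.
  have [m /andP[m0 /asboolP cm] mmin] := ex_minnP exn.
  have mj : (j + j + 2 < m)%N.
    rewrite ltnNge; apply/negP => mj; apply: nx; exact: clf_pw_le cm.
  have mE := odd_double_half m; have ub : (odd m <= 1)%N by case: (odd m).
  (* [m] is the least exponent with a Clifford power and [k] is its half rounded up, so that
     [pw x k] is not Clifford while its square is. *)
  exists (x, (uphalf m, m)); split=> //=; rewrite ?uphalf_half; [lia|lia| |].
    move=> a /andP[a0 am] ca; have : (m <= a)%N.
      by apply: mmin; rewrite a0; exact/asboolP.
    by rewrite leqNgt am.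
  by apply: clf_pw_le cm => //; lia.
have /choice[f fP] := H.
by exists (fun j => (f j).1), (fun j => (f j).2.1), (fun j => (f j).2.2).
Qed.

(** Each [y j], about half way to the first Clifford power of [x j], is not Clifford but has a
    Clifford square. Along a subsequence all products of the [y j] are Clifford. Then so are all
    products of the many non-Clifford powers beyond [y j]; these are therefore finite in number,
    which forces a repetition among the powers of one [x j] before the first Clifford one. *)
Lemma index_absurd D : (forall x, D x -> exists2 N, (0 < N)%N &
  forall y, D y -> clf (pw (pi x * y) N)) -> ~ unbounded_index D.
Proof.
move=> DN /unbounded_index_sequence[x [k [m xkm]]].
have Dx j : D (x j) by have [] := xkm j.
have k0 j : (0 < k j)%N by have [_ jk _ _ _] := xkm j; exact: leq_ltn_trans jk.
pose y j := pw (x j) (k j).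
have [v [vu _ vfin]] := free_ultrafilter infinite_nat.
have tail c : v [set j | (c <= j)%N].
  apply: contrapT => /(ultraN vu) nm; apply: (vfin _ (finite_II c)).
  by apply: filterS nm => j /=; rewrite ltnNge => /negP.
have piE j : idempotents (pi (x j)) by exact: pi_idem.
have [l [lE vl lP]] := idem_lim mulC cf vu piE.
have piy j : pi (y j) = pi (x j) by exact: pi_pwn.
have yy i : clf (y i * y i) by rewrite -pwD //; have [] := xkm i.
(* Otherwise the non-Clifford elements [y i * pw (x j) a] with [a >= N] form a finite set, their
   products being Clifford. Each exponent [a] gives a constant value along [j], and two exponents
   share it. The resulting loop makes [y i * pi (x j)] non-Clifford as well, with a constant value
   [c] satisfying [c * l = c]. But [c * l = y i * l] is Clifford because [l] is below [pi (y i)]. *)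
have main i : l * pi (x i) = l -> v [set j | clf (y i * y j)].
  move=> li; apply: contrapT => /(ultraN vu) nv.
  have [N N0 cN] := DN _ (Dx i).
  pose B : set X := [set z | ~ clf z /\
    exists j a, (N <= a)%N /\ z = y i * pw (x j) a].
  have cNa j a : (N <= a)%N -> clf (pi (x i) * pw (x j) a).
    move=> Na; have := clf_pw_le mulC per N0 Na (cN _ (Dx j)).
    by rewrite pwM // pw_idem.
  have Bfin : finite_set B.
    apply: finite_nonclifford => [z []//|_ _ [_ [j [a [Na ->]]]] [_ [j' [b [Nb ->]]]]].
    have -> : y i * pw (x j) a * (y i * pw (x j') b) =
        (y i * y i) * ((pi (x i) * pw (x j) a) * (pi (x i) * pw (x j') b)).
      have E : pi (x i) * (y i * y i) = y i * y i.
        by have := yy i; rewrite /clf piM // piy pi_pi.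
      rewrite mulACA // (mulACA mulC (pi (x i))) pi_pi //.
      by rewrite [in RHS]mulgA (mulC (y i * y i) (pi (x i))) E.
    by apply: clfM => //; apply: clfM => //; exact: cNa.
  have small a : (N <= a)%N -> v [set j | ~ clf (y i * pw (x j) a)].
    move=> Na; apply: filterS2 nv (tail a) => j nj aj cj; apply: nj.
    have [_ jk _ _ _] := xkm j.
    apply: clf_mul_pw_le cj; first exact: leq_trans Na.
    by apply: leq_trans aj _; exact: ltnW.
  have /choice[d dP] : forall a, exists c, (N <= a)%N ->
      B c /\ v [set j | y i * pw (x j) a = c].
    move=> a; have [Na|_] := boolP (N <= a)%N; last by exists l.
    have [|c Bc vc] := @ultra_finite nat X v (fun j => y i * pw (x j) a) B vu Bfin.
      by apply: filterS (small a Na) => j nj; split=> //; exists j, a.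
    by exists c.
  have [a [b [Na ab dab]]] : exists a b, [/\ (N <= a)%N, (a < b)%N & d a = d b].
    apply: contrapT => nd.
    have /sub_infinite_set : range (fun n => d (N + n)%N) `<=` B.
      by move=> _ [n _ <-]; have [] := dP _ (leq_addr n N).
    move=> /(_ _) /(_ Bfin); apply; apply: infinite_range => p q pq dpq.
    apply: nd; exists (N + p)%N, (N + q)%N.
    by rewrite leq_addr ltn_add2l.
  have a0 : (0 < a)%N by exact: leq_trans Na.
  have Nb : (N <= b)%N by apply: leq_trans Na _; exact: ltnW.
  have vB : v [set j | B (y i * pi (x j))].
    have [_ va] := dP _ Na; have [_ vb] := dP _ Nb.
    apply: filterS3 (va) (vb) (small a Na) => j /= ja jb nj.
    have [c c0 cE] := pi_pw per (x j).
    have cE' : pw (x j) (c * N) = pi (x j).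
      by rewrite -pw_mul // cE pw_idem.
    have cN0 : (0 < c * N)%N by rewrite muln_gt0 c0.
    split; last first.
      by exists j, (c * N)%N; rewrite cE' leq_pmull.
    rewrite -cE' => cj; apply: nj.
    rewrite -(pw_loop (c * N) a0 ab); last by rewrite ja jb.
    apply: clf_mul_pw_le cj => //.
    apply: leq_trans (leq_addl a _); apply: leq_pmulr.
    by rewrite subn_gt0.
  have [c [nc _] vc] := @ultra_finite nat X v (fun j => y i * pi (x j)) B vu Bfin vB.
  have cl : c * l = c.
    apply: lP; apply: filterS vc => j /= <-.
    by rewrite -mulgA pi_pi.
  have [j [/= jc lj]] := ultra_ex2 vu vc vl.
  apply: nc; rewrite -cl -jc -mulgA (mulC _ l) lj mulC.
  by apply: clf_le => //; rewrite piy.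
have [||s [_ sR]] := @ultra_sequence nat v setT
    (fun i j => (i < j)%N /\ clf (y i * y j)) vu.
- exact: filterT.
- by apply: filterS vl => i /main vi; apply: filterS2 (tail i.+1) vi => j; split.
have sn n : (n <= s n)%N.
  elim: n => // n IHn; have [ss _] := sR n n.+1 (ltnSn n).
  exact: leq_ltn_trans ss.
(* The powers between [y (s n)] and the first Clifford power of [x (s n)]; there are more than [s n]
   of them, hence more than any fixed number for large [n]. *)
pose A : set X := [set z | exists n a,
  [/\ (k (s n) <= a)%N, (a < m (s n))%N & z = pw (x (s n)) a]].
have : infinite_set A.
  move=> Afin.
  have /choice[d dP] : forall r, exists c, A c /\
      v [set n | pw (x (s n)) (k (s n) + r) = c].
    move=> r.
    have [|c Ac vc] := @ultra_finite nat X v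
        (fun n => pw (x (s n)) (k (s n) + r)) A vu Afin; last by exists c.
    apply: filterS (tail r) => n rn; exists n, (k (s n) + r)%N; split=> //.
      exact: leq_addr.
    have [_ _ km _ _] := xkm (s n); apply: leq_ltn_trans km.
    by rewrite leq_add2l; exact: leq_trans (sn n).
  have /sub_infinite_set : range d `<=` A by move=> _ [r _ <-]; have [] := dP r.
  move=> /(_ _) /(_ Afin); apply; apply: infinite_range => p q pq dpq.
  have [_ vp] := dP p; have [_ vq] := dP q.
  have [n [/= np nq qn]] := ultra_ex3 vu vp vq (tail q).
  have [_ _ km nclf _] := xkm (s n).
  set z := x (s n) in np nq nclf; set K := k (s n) in np nq km.
  have K0 : (0 < K)%N by exact: k0.
  have Kq : (K + q < m (s n))%N.
    by apply: leq_ltn_trans km; rewrite leq_add2l; exact: leq_trans (sn n).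
  apply: (nclf (K + q)%N); first by rewrite addn_gt0 K0.
  have zE : pw z (K + p) = pw z (K + q) by rewrite np nq dpq.
  have [M M0 cM] := clf_pw_ex per z.
  rewrite -zE -(@pw_loop1 z (K + p) (K + q) M) ?addn_gt0 ?K0 ?ltn_add2l //.
  rewrite subnDl; apply: clf_pw_le cM => //.
  apply: leq_trans (leq_addl _ _); apply: leq_pmulr.
  by rewrite subn_gt0.
apply; apply: finite_nonclifford.
  move=> _ [n [a [ka am ->]]]; have [_ _ _ + _] := xkm (s n); apply.
  by rewrite am andbT; exact: leq_trans ka.
have cross n n' a b : clf (y (s n) * y (s n')) -> (k (s n) <= a)%N ->
    (k (s n') <= b)%N -> clf (pw (x (s n)) a * pw (x (s n')) b).
  move=> cyy ka kb; apply: (clf_mul_pw_le (k0 _) kb); rewrite mulC.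
  by apply: (clf_mul_pw_le (k0 _) ka); rewrite mulC.
move=> _ _ [n [a [ka am ->]]] [n' [b [kb bm ->]]].
have [nn|nn|nn] := ltngtP n n'.
- by apply: cross => //; have [] := sR _ _ nn.
- by rewrite mulC; apply: cross => //; have [] := sR _ _ nn.
- by apply: cross => //; rewrite nn.
Qed.

(** At a minimal idempotent [t] with unbounded index below it, split according to [pi x]. Where
    [pi x = t], the products [pi x * y] are already Clifford; where [pi x] is strictly below [t],
    minimality bounds the index of the [pi x * y]. Both pieces contradict [index_absurd]. *)
Lemma index_bounded : exists2 N, (0 < N)%N & forall x : X, clf (pw x N).
Proof.
pose D e : set X := [set x | pi x * e = pi x].
have step D' : (forall x, D' x -> ~ unbounded_index (D (pi x))) ->
    ~ unbounded_index D'.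
  move=> nD; apply: index_absurd => x /nD/existsNP[N /not_implyP[N0 nN]].
  exists N => // y D'y; apply: contrapT => nc; apply: nN; exists (pi x * y) => //.
  by rewrite /D /= piM // pi_mul // (mulC _ (pi x)) mulgA pi_pi.
have bD e : idempotents e -> ~ unbounded_index (D e).
  move=> eE Ue.
  have [||t [tE Ut] tmin] := @idem_min X mulC cf
      [set t | idempotents t /\ unbounded_index (D t)].
  - by move=> t [].
  - by exists e.
  have : unbounded_index ([set x | pi x = t] `|` [set x | D t x /\ pi x <> t]).
    move=> N N0; have [x Dx nx] := Ut _ N0; exists x => //.
    by have [xt|xt] := pselect (pi x = t); [left|right].
  move=> /unbounded_indexU[|]; first apply: index_absurd.
    move=> x xt; exists 1%N => // z zt.
    by change (clf (pi x * z)); rewrite xt -zt; exact: clf_pi_mul.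
  apply: step => x [Dx xt] Ux; apply: xt; apply: tmin => //.
  by split=> //; exact: pi_idem.
have : ~ unbounded_index setT by apply: step => x _; exact/bD/pi_idem.
move=> /existsNP[N /not_implyP[N0 nN]]; exists N => // x.
by apply: contrapT => nx; apply: nN; exists x.
Qed.

End IndexBounded.

(** * A topology for elements of large order *)

Section OrderTopology.
Variable X : semigroupType.
Variables (e z : nat -> X) (u : set_system nat).
Hypothesis mulC : forall x y : X, x * y = y * x.
Hypothesis uu : UltraFilter u.
Hypothesis utail : forall m, u [set i | (m <= i)%N].
Hypothesis eE : forall i, idempotents (e i).
Hypothesis ez : forall i, e i * z i = z i.
Hypothesis ze : forall i k, (0 < k <= 2 ^ i)%N -> pw (z i) k <> e i.
Hypothesis zz : forall i k, (1 < k <= 2 ^ i)%N -> pw (z i) k <> z i.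

Let B := nat -> option X.
Implicit Types (a b c : B) (i j k m n : nat).

Definition oop (p q : option X) : option X :=
  if p is Some x then if q is Some y then Some (x * y) else None else None.

Lemma oopA : associative oop.
Proof. by move=> [x|] [y|] [t|] //=; rewrite mulgA. Qed.

Lemma oopC : commutative oop.
Proof. by move=> [x|] [y|] //=; rewrite mulC. Qed.

Lemma oop0 p : oop p None = None. Proof. by case: p. Qed.

Lemma oop_unit i : oop (Some (e i)) (Some (e i)) = Some (e i).
Proof. by rewrite /= eE. Qed.

Definition bmul b c : B := fun i => oop (b i) (c i).
Definition bzero : B := fun=> None.

Definition eventually_unit b := exists m, forall i, (m <= i)%N ->
  b i = None \/ b i = Some (e i).

(** Zero, or a power of [z i] whose exponent is at least [r] and at most [2 ^ (i - m)]. The bound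
    keeps these powers in the range of [ze] and [zz], and increasing [m] leaves room for
    products. *)
Definition small r m i : set (option X) := [set p | p = None \/
  exists k, [/\ (r <= k)%N, (k * 2 ^ m <= 2 ^ i)%N & p = Some (pw (z i) k)]].

Lemma small_le r s m n i : (s <= r)%N -> (m <= n)%N ->
  small r n i `<=` small s m i.
Proof.
move=> sr mn p [->|[k [rk ki ->]]]; first by left.
right; exists k; split=> //; first exact: leq_trans rk.
by apply: leq_trans ki; rewrite leq_mul2l leq_exp2l // mn orbT.
Qed.

Lemma small_lt r m i k : (0 < r)%N -> (r <= k)%N -> (k * 2 ^ m <= 2 ^ i)%N ->
  (r <= k <= 2 ^ i)%N.
Proof. by move=> r0 -> /=; apply: leq_trans; rewrite leq_pmulr // expn_gt0. Qed.

Lemma small_z m i : (m <= i)%N -> small 1 m i (Some (z i)).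
Proof. by move=> mi; right; exists 1%N; split=> //; rewrite mul1n leq_exp2l. Qed.

Lemma small_nz m i : ~ small 2 m i (Some (z i)).
Proof.
move=> [//|[k [k2 ki [zE]]]]; apply: (zz (i := i) (k := k)) => //.
exact: small_lt ki.
Qed.

Lemma small_ne m i : ~ small 1 m i (Some (e i)).
Proof.
move=> [//|[k [k1 ki [eE']]]]; apply: (ze (i := i) (k := k)) => //.
exact: small_lt ki.
Qed.

Lemma small_unit m i p q : small 2 m i p -> q = None \/ q = Some (e i) ->
  small 2 m i (oop p q).
Proof.
move=> sp [->|->]; first by rewrite oop0; left.
case: sp => [->|[k [k2 ki ->]]]; first by left.
right; exists k; split=> //=; congr Some; rewrite mulC.
case: k {ki} k2 => // k _; elim: k => [|k IHk]; first exact: ez.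
by rewrite pwSS mulgA ez.
Qed.

Lemma smallM m i p q : small 1 m.+1 i p -> small 1 m.+1 i q ->
  small 2 m i (oop p q).
Proof.
move=> [->|[k [k1 ki ->]]]; first by left.
move=> [->|[l [l1 li ->]]]; first by left.
right; exists (k + l)%N; rewrite /= pwD //; split=> //; first by lia.
by move: ki li; rewrite expnS mulnDl; lia.
Qed.

(** Only zero coordinates from [m] on may move, to exponents at least 2. Exponent 1 is excluded
    because sequences with a single entry [z i] converge to [None]; exponent 2 has to be allowed
    because [None] squared is [bzero], and [z i * z i] occurs near it. *)
Definition bnbhs m b : set B := [set b' | forall i,
  ((i < m)%N \/ b i <> None -> b' i = b i) /\
  ((m <= i)%N -> b i = None -> small 2 m i (b' i))].

Definition unbhs (P : set nat) m : set B := [set b |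
  (forall j, (j < m)%N -> b j = None) /\
  exists i, [/\ P i, (m <= i)%N, b i = Some (z i) &
    forall j, (m <= j)%N -> j <> i -> small 2 m j (b j)]].

Definition ounit b := u [set i | b i = Some (e i)].

(** The product of [b] and [None]. When [b] is eventually zero or the unit, the ultrafilter decides
    which of the two prevails. *)
Definition uact b : option B := if `[< ounit b >] then None else Some bzero.

(* The point [None] is the limit along [u] of the sequences which are zero except
   for [z i] at the place [i], where the zero of [option X] is also [None]. *)
Definition uop (s t : option B) : option B := match s, t with
  | Some b, Some c => Some (bmul b c)
  | Some b, None => uact b
  | None, Some c => uact c
  | None, None => Some bzero
  end.
Arguments uop : simpl nomatch.

Definition udom : set (option B) := [set s |
  if s is Some b then eventually_unit b else True].

Definition unb (s : option B) : set_system (option B) := if s is Some b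
  then [set V | exists m, forall b', bnbhs m b b' -> V (Some b')]
  else [set V | exists P m, [/\ u P, V None & forall b, unbhs P m b -> V (Some b)]].

Lemma bmul0 b : bmul b bzero = bzero.
Proof. by apply/funext => i; exact: oop0. Qed.

Lemma bmulC b c : bmul b c = bmul c b.
Proof. by apply/funext => i; exact: oopC. Qed.

Lemma ounit0 : ~ ounit bzero.
Proof. by move=> u0; have /filter_ex[] := u0. Qed.

Lemma eventually_unitM b c : eventually_unit b -> eventually_unit c ->
  eventually_unit (bmul b c).
Proof.
move=> [m bm] [n cn]; exists (maxn m n) => i; rewrite geq_max => /andP[mi ni].
rewrite /bmul; have [->|->] := bm i mi; first by left.
by have [->|->] := cn i ni; [left|right; exact: oop_unit].
Qed.

Lemma ounitM b c : eventually_unit b -> eventually_unit c ->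
  ounit (bmul b c) <-> ounit b /\ ounit c.
Proof.
move=> [m bm] [n cn]; split=> [ubc|[ub uc]]; last first.
  by apply: filterS2 ub uc => i /= bi ci; rewrite /bmul bi ci oop_unit.
split; apply: filterS3 (ubc) (utail m) (utail n) => i bci mi ni;
  move: bci; rewrite /= /bmul; have [->//|->] := bm i mi;
  by have [->//|->] := cn i ni.
Qed.

Lemma ounit_uact b c : eventually_unit b -> eventually_unit c ->
  uop (uact b) (Some c) = uact (bmul b c).
Proof.
move=> gb gc; have bcE := ounitM gb gc; rewrite /uact.
have [ub|nub] := asboolP (ounit b); last first.
  rewrite asboolF; last by move=> ubc; case: (bcE.1 ubc).
  by rewrite /= bmulC bmul0.
rewrite /= /uact; have [uc|nuc] := asboolP (ounit c).
  by rewrite asboolT //; exact: (bcE.2 (conj ub uc)).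
by rewrite asboolF // => ubc; case: (bcE.1 ubc).
Qed.

Lemma uopC s t : uop s t = uop t s.
Proof. by case: s t => [b|] [c|] //=; rewrite bmulC. Qed.

Lemma uact_None b : uop (uact b) None = Some bzero.
Proof.
rewrite /uact; case: asboolP => //= _.
by rewrite /uact asboolF //; exact: ounit0.
Qed.

Lemma uopA s t r : udom s -> udom t -> udom r ->
  uop s (uop t r) = uop (uop s t) r.
Proof.
case: s t r => [b|] [c|] [d|] //= gb gc gd.
- by congr Some; apply/funext => i; exact: oopA.
- by rewrite uopC ounit_uact // bmulC.
- by rewrite ounit_uact // uopC ounit_uact // bmulC.
- by rewrite uact_None bmul0.
- by rewrite ounit_uact.
- by rewrite uopC uact_None bmulC bmul0.
Qed.

Lemma unb_filter s : Filter (unb s).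
Proof.
case: s => [b|] /=; split.
- by exists 0%N.
- move=> V W [m mV] [n nW]; exists (maxn m n) => b' bb'; split.
    apply: mV => i; have [H1 H2] := bb' i; split=> [im|mi bi].
      by apply: H1; case: im; [left; rewrite leq_max a|right].
    have [ni|ni] := leqP (maxn m n) i;
      first by apply: small_le (H2 ni bi) => //; exact: leq_maxl.
    by left; rewrite H1 //; left.
  apply: nW => i; have [H1 H2] := bb' i; split=> [im|mi bi].
    by apply: H1; case: im; [left; rewrite leq_max a orbT|right].
  have [ni|ni] := leqP (maxn m n) i;
    first by apply: small_le (H2 ni bi) => //; exact: leq_maxr.
  by left; rewrite H1 //; left.
- by move=> V W VW [m mV]; exists m => b' /mV/VW.
- by exists setT, 0%N; split=> //; exact: filterT.
- move=> V W [P [m [uP VN mV]]] [Q [n [uQ WN nW]]].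
  have mono p b : (p <= maxn m n)%N -> unbhs (P `&` Q) (maxn m n) b ->
      exists i, [/\ (P `&` Q) i, (p <= i)%N, b i = Some (z i) &
        forall j, (p <= j)%N -> j <> i -> small 2 p j (b j)].
    move=> pmn [b0 [i [PQi mni bi bj]]]; exists i; split=> //.
      exact: leq_trans mni.
    move=> j pj ji; have [mj|jm] := leqP (maxn m n) j.
      exact: small_le (bj _ mj ji).
    by rewrite b0 //; left.
  exists (P `&` Q), (maxn m n); split=> //; first exact: filterI.
  move=> b ub; split.
    have [i [[Pi _] mi bi bj]] := mono m b (leq_maxl _ _) ub.
    apply: mV; split; last by exists i.
    by move=> j jm; apply: ub.1; rewrite leq_max jm.
  have [i [[_ Qi] ni bi bj]] := mono n b (leq_maxr _ _) ub.
  apply: nW; split; last by exists i.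
  by move=> j jn; apply: ub.1; rewrite leq_max jn orbT.
- by move=> V W VW [P [m [uP VN mV]]]; exists P, m; split=> [||b /mV/VW] //; exact: VW.
Qed.

Lemma bnbhs_self m b : bnbhs m b b.
Proof. by move=> i; split=> // _ ->; left. Qed.

Lemma unb_self s V : unb s V -> V s.
Proof.
by case: s => [b [m]|[P [m []]]] //; apply; exact: bnbhs_self.
Qed.

Let uclop (A : set (option B)) := forall s, udom s ->
  (A s -> unb s A) /\ (~ A s -> unb s (~` A)).

Lemma bnbhs_open m b c : bnbhs m b c -> bnbhs m c `<=` bnbhs m b.
Proof.
move=> bc d cd i; have [H1 H2] := bc i; have [K1 K2] := cd i; split=> [im|mi bi].
  rewrite -H1 //; apply: K1; case: im => [->|bi]; first by left.
  by right; rewrite H1 //; right.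
have [ci|ci] := pselect (c i = None); first exact: K2.
by rewrite K1; [exact: H2|right].
Qed.

Lemma bnbhs_coord m b c i : bnbhs m b c -> (i < m)%N -> c i = b i.
Proof. by move=> bc im; have [H _] := bc i; apply: H; left. Qed.

Lemma bnbhs_clop m b : eventually_unit b ->
  uclop [set s | if s is Some b' then bnbhs m b b' else False].
Proof.
move=> [q bq] [c|] /= Ds; split=> //.
- by move=> bc; exists m => d; exact: bnbhs_open.
- move=> nbc; have [i ni] : exists i,
      ~ (((i < m)%N \/ b i <> None -> c i = b i) /\
         ((m <= i)%N -> b i = None -> small 2 m i (c i))).
    by apply: contrapT => ni; apply: nbc => i; apply: contrapT => nn; apply: ni; exists i.
  exists i.+1 => d cd bd; apply: ni.
  by rewrite -(bnbhs_coord cd (ltnSn i)); exact: bd.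
- move=> _; exists setT, (maxn m q); split=> //; first exact: filterT.
  move=> d [d0 [i [_ mqi di _]]] bd; have [H1 H2] := bd i.
  move: mqi; rewrite geq_max => /andP[mi qi].
  have [bi|bi] := bq i qi.
    by apply: (@small_nz m i); rewrite -di; exact: H2.
  have [ez'] : Some (z i) = Some (e i) by rewrite -di H1 ?bi //; right.
  by apply: (ze (i := i) (k := 1)); rewrite ?expn_gt0.
Qed.

Lemma unbhs_clop P m : u P ->
  uclop [set s | if s is Some b then unbhs P m b else True].
Proof.
move=> uP [c|] /= Ds; split=> //; last first.
  by move=> _; exists P, m.
- move=> nWc.
  have [[j [jm cj]]|c0] := pselect (exists j, (j < m)%N /\ c j <> None).
    exists j.+1 => d cd [d0 _]; apply: cj.
    by rewrite -(bnbhs_coord cd (ltnSn j)) d0.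
  have {}c0 j : (j < m)%N -> c j = None.
    by move=> jm; apply: contrapT => cj; apply: c0; exists j.
  (* Either some coordinate, or two coordinates, exclude [c] for good, or all
     coordinates are small and [bnbhs m c] contains no [Some (z i)]. *)
  have [[j [mj nj ncj]]|cz] := pselect (exists j, [/\ (m <= j)%N,
      ~ small 2 m j (c j) & ~ (P j /\ c j = Some (z j))]).
    exists j.+1 => d cd [_ [i [Pi mi di dj]]].
    have [ji|ji] := pselect (j = i).
      by apply: ncj; rewrite ji -(bnbhs_coord cd) ?ji.
    by apply: nj; rewrite -(bnbhs_coord cd (ltnSn j)); exact: dj.
  have {}cz j : (m <= j)%N -> small 2 m j (c j) \/ P j /\ c j = Some (z j).
    move=> mj; apply: contrapT => /not_orP[nj ncj]; apply: cz.
    by exists j.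
  have [[j [mj Pj cj]]|nz] := pselect (exists j, [/\ (m <= j)%N, P j & c j = Some (z j)]).
    have [[k [mk ck kj]]|nk] := pselect (exists k, [/\ (m <= k)%N,
        c k = Some (z k) & k <> j]).
      exists (maxn j k).+1 => d cd [_ [i [Pi mi di dj]]].
      have dj' : d j = Some (z j).
        by rewrite -cj; apply: bnbhs_coord cd _; rewrite ltnS leq_maxl.
      have dk : d k = Some (z k).
        by rewrite -ck; apply: bnbhs_coord cd _; rewrite ltnS leq_maxr.
      have [ji|ji] := pselect (j = i).
        by apply: (@small_nz m k); rewrite -dk; apply: dj => //; rewrite -ji.
      by apply: (@small_nz m j); rewrite -dj'; exact: dj.
    case: nWc; split=> //; exists j; split=> // k mk kj.
    have [//|[_ ck]] := cz k mk; by case: nk; exists k.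
  exists m => d cd [_ [i [Pi mi di dj]]]; have [H1 H2] := cd i.
  have [si|[_ ci]] := cz i mi; last by apply: nz; exists i.
  apply: (@small_nz m i); rewrite -di.
  have [ci|ci] := pselect (c i = None); first exact: H2.
  by rewrite H1 //; right.
- move=> [c0 [i [Pi mi ci cj]]]; exists i.+1 => d cd; split.
    by move=> j jm; rewrite (bnbhs_coord cd) ?c0 //; apply: leq_trans jm _; exact: leqW.
  exists i; split=> //; first by rewrite (bnbhs_coord cd).
  move=> j mj ji; have [H1 H2] := cd j.
  have [cj0|cj0] := pselect (c j = None); last by rewrite H1; [exact: cj|right].
  have [ij|ij] := ltnP i j; last by rewrite H1 ?cj0; left.
  by apply: small_le (H2 ij cj0) => //; exact: leqW.
Qed.

Lemma unb_base s V : udom s -> unb s V ->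
  exists A, [/\ uclop A, A s & forall t, udom t -> A t -> V t].
Proof.
case: s => [b gb [m mV]|_ [P [m [uP VN mV]]]].
  exists [set s | if s is Some b' then bnbhs m b b' else False]; split.
  - exact: bnbhs_clop.
  - exact: bnbhs_self.
  - by case=> // c _; exact: mV.
exists [set s | if s is Some b then unbhs P m b else True]; split=> //.
- exact: unbhs_clop.
- by case=> // c _; exact: mV.
Qed.

Lemma unb_sep s t : udom s -> udom t -> s <> t -> exists V, unb s V /\ ~ V t.
Proof.
case: s t => [b|] [c|] //= gb gc st.
- have [i bci] : exists i, b i <> c i.
    apply: contrapT => n; apply: st; congr Some; apply/funext => i.
    by apply: contrapT => bci; apply: n; exists i.
  exists [set s | if s is Some d then d i = b i else False]; split.
    by exists i.+1 => d /bnbhs_coord; exact.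
  by move=> /= cb; exact: bci.
- by exists [set s | if s is Some d then True else False]; split=> //; exists 0%N.
- have [m cm] := gc.
  exists [set s | if s is Some d then unbhs setT m d else True]; split.
    by exists setT, m; split=> //; exact: filterT.
  move=> /= [_ [i [_ mi ci _]]]; have := cm i mi; rewrite ci => -[//|[zei]].
  by apply: (ze (i := i) (k := 1)); rewrite ?expn_gt0.
Qed.

(** Beyond [n] the entries of [b] and [c] are zero or units. Where both vanish, small exponents add
    up within the bound of [m]; where one is a unit, it fixes the small entry of the other. *)
Lemma bnbhsM m b c : eventually_unit b -> eventually_unit c -> exists n,
  forall b' c', bnbhs n b b' -> bnbhs n c c' -> bnbhs m (bmul b c) (bmul b' c').
Proof.
move=> [p bp] [q cq]; pose n := maxn m.+1 (maxn p q).
have [mn pn qn] : [/\ (m < n)%N, (p <= n)%N & (q <= n)%N].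
  by rewrite /n; split; lia.
exists n => b' c' bb cc i; have [B1 B2] := bb i; have [C1 C2] := cc i.
have [ni|ni] := ltnP i n.
  have E : bmul b' c' i = bmul b c i by rewrite /bmul B1 ?C1 //; left.
  by split=> // _ bci; rewrite E bci; left.
have pi_ := bp i (leq_trans pn ni); have qi := cq i (leq_trans qn ni).
have sle r x : small r n i x -> small r m i x.
  by apply: small_le => //; exact: ltnW.
split=> [[im|bci]|mi bci].
- by move: ni; rewrite leqNgt (ltn_trans im).
- have [bi ci] : b i <> None /\ c i <> None.
    by split=> E; apply: bci; rewrite /bmul E // oop0.
  by rewrite /bmul B1 ?C1 //; right.
- rewrite /bmul; have [bi|bi] := pselect (b i = None).
    have [ci|ci] := pselect (c i = None).
      have s1 x : small 2 n i x -> small 1 m.+1 i x by exact: small_le.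
      by apply: smallM; apply: s1; [exact: B2|exact: C2].
    rewrite C1; last by right.
    by apply: small_unit => //; apply: sle; exact: B2.
  rewrite B1; last by right.
  have ci : c i = None.
    by move: bci; rewrite /bmul; case: (b i) bi => // x _; case: (c i).
  by rewrite oopC; apply: small_unit => //; apply: sle; exact: C2.
Qed.

Lemma unbhs_small P m b : unbhs P m b ->
  (forall j, (j < m)%N -> b j = None) /\ forall j, (m <= j)%N -> small 1 m j (b j).
Proof.
move=> [b0 [i [Pi mi bi bj]]]; split=> // j mj.
have [->|ji] := pselect (j = i); first by rewrite bi; exact: small_z.
exact: small_le (bj _ mj ji).
Qed.

Lemma unbhs_nounit P m b : unbhs P m b -> ~ ounit b.
Proof.
move=> /unbhs_small[b0 bj] ub; have [j [/= bje mj]] := ultra_ex2 uu ub (utail m).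
by apply: (@small_ne m j); rewrite -bje; exact: bj.
Qed.

(** If [b] is a unit at most places, the distinguished entry [z i] is restricted to these places,
    where it survives. Otherwise it is restricted to places where [b] vanishes; there a factor near
    [b] is small, and the product has exponent at least 2. *)
Lemma unb_op_None b V : eventually_unit b -> unb (uact b) V ->
  exists A D, [/\ unb None A, unb (Some b) D &
    forall s t, udom s -> udom t -> A s -> D t -> V (uop s t)].
Proof.
move=> [q bq]; rewrite /uact; have [ub|nub] := asboolP (ounit b).
  move=> [P [m [uP VN mV]]]; pose n := maxn m.+1 q.
  have [mn qn] : (m < n)%N /\ (q <= n)%N by rewrite /n; split; lia.
  pose Q := P `&` [set i | b i = Some (e i)].
  exists [set s | if s is Some c then unbhs Q n c else True].
  exists [set s | if s is Some c then bnbhs n b c else False].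
  split; [|by exists n|].
    by exists Q, n; split=> //; exact: filterI.
  move=> [w|] [c|] //= _ _; last first.
    move=> _ bc; rewrite /uact asboolT //; apply: filterS ub => i /= bi.
    by have [H _] := bc i; rewrite H bi //; right.
  move=> [w0 [i [[Pi bi] ni wi wj]]] bc.
  apply: mV; split=> [j jm|].
    by rewrite /bmul w0 //; exact: ltn_trans mn.
  exists i; split=> //; first exact: ltnW (leq_trans mn ni).
    have [H _] := bc i; rewrite /bmul wi H; last by right; rewrite bi.
    by rewrite bi /= mulC ez.
  move=> j mj ji; rewrite /bmul; have [nj|jn] := leqP n j; last first.
    by rewrite w0 //; left.
  have [H1 H2] := bc j; have sw := wj j nj ji.
  have [bj|bj] := bq j (leq_trans qn nj); last first.
    rewrite H1; last by right; rewrite bj.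
    by apply: small_unit; [exact: small_le (ltnW mn) _ sw|right].
  by apply: smallM; [exact: small_le mn _ sw|exact: small_le mn _ (H2 nj bj)].
move=> [m mV]; pose n := maxn m.+1 q.
have [mn qn] : (m < n)%N /\ (q <= n)%N by rewrite /n; split; lia.
pose Q := [set i | b i = None].
have uQ : u Q.
  have := ultraN uu nub; apply: filterS2 (utail q) => i qi nbi.
  by have [|bi] := bq i qi.
exists [set s | if s is Some c then unbhs Q n c else True].
exists [set s | if s is Some c then bnbhs n b c else False].
split; [by exists Q, n|by exists n|].
move=> [w|] [c|] //= _ _; last first.
  move=> _ bc; rewrite /uact asboolF; first exact/mV/bnbhs_self.
  move=> uc; have [i [ci bi ni]] := ultra_ex3 uu uc uQ (utail n).
  have [_ H] := bc i; apply: (@small_ne n i); rewrite -ci.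
  exact: small_le (leqnn n) _ (H ni bi).
move=> uw bc; have [w0 wj] := unbhs_small uw.
apply: mV => j; rewrite /bmul; have [nj|jn] := leqP n j; last first.
  by rewrite w0 //; split=> // *; left.
split=> [[jm|//]|mj _]; first by move: nj; rewrite leqNgt (ltn_trans jm mn).
have [H1 H2] := bc j; have [bj|bj] := bq j (leq_trans qn nj).
  by apply: smallM; [exact: small_le mn _ (wj j nj)|exact: small_le mn _ (H2 nj bj)].
rewrite H1; last by right; rewrite bj.
move: uw => [_ [i [/= bi ni _ wj']]]; apply: small_unit; last by right.
apply: small_le (ltnW mn) _ (wj' j nj _) => // ji.
by move: bj; rewrite ji bi.
Qed.

Lemma unb_op s t V : udom s -> udom t -> unb (uop s t) V ->
  exists A D, [/\ unb s A, unb t D & forall s' t', udom s' -> udom t' ->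
    A s' -> D t' -> V (uop s' t')].
Proof.
case: s t => [b|] [c|].
- move=> gb gc [m mV]; have [n mn] := bnbhsM m gb gc.
  exists [set s | if s is Some d then bnbhs n b d else False].
  exists [set s | if s is Some d then bnbhs n c d else False].
  by split; [exists n|exists n|case=> [b'|] [c'|] // _ _ bb cc; apply/mV/mn].
- move=> gb _ /(unb_op_None gb)[A [D [uA uD AD]]].
  exists D, A; split=> // s t Ds Dt sD tA.
  by rewrite uopC; exact: AD.
- by move=> _ gc /(unb_op_None gc).
move=> _ _ [m mV]; pose A := [set s | if s is Some c then unbhs setT m.+1 c else True].
have uA : unb None A by exists setT, m.+1; split=> //; exact: filterT.
exists A, A; split=> // -[b|] [c|] _ _ /=; last first.
- by move=> _ _; exact/mV/bnbhs_self.
- by move=> _ /unbhs_nounit uc; rewrite /uact asboolF //; exact/mV/bnbhs_self.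
- by move=> /unbhs_nounit ub _; rewrite /uact asboolF //; exact/mV/bnbhs_self.
move=> /unbhs_small[b0 bj] /unbhs_small[c0 cj]; apply: mV => j.
have [mj|jm] := leqP m.+1 j; last first.
  by rewrite /bmul b0 //; split=> // *; left.
split=> [[jm|//]|_ _]; first by move: mj; rewrite leqNgt ltnS (ltnW jm).
by apply: smallM; [exact: bj|exact: cj].
Qed.

Definition order_tzs : tzs.
Proof.
refine (@Tzs (option B) udom uop unb _ _ _ _ unb_base unb_sep unb_op).
- have gu : eventually_unit bzero by exists 0%N => *; left.
  move=> [b|] [c|] //= => [gb gc|gb _|_ gc]; first exact: eventually_unitM.
    by rewrite /uact; case: asboolP.
  by rewrite /uact; case: asboolP.
- exact: uopA.
- by move=> s _; exact: unb_filter.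
- by move=> s V _; exact: unb_self.
Defined.

End OrderTopology.

(** * Bounded orders of Clifford elements *)

Section ExponentBounded.
Variable X : semigroupType.
Hypothesis mulC : forall x y : X, x * y = y * x.
Hypothesis Xcl : injectively_closed TzS X.

Let per := closed_periodic mulC Xcl.
Let cf := closed_chain_finite mulC Xcl.
Let Hfin := closed_Hc_finite mulC Xcl.

Lemma idem_pw_dvd (x : X) m n : (m %| n)%N -> (0 < m)%N -> (0 < n)%N ->
  idempotents (pw x m) -> pw x n = pw x m.
Proof.
move=> /dvdnP[q ->] m0; rewrite muln_gt0 => /andP[q0 _] xm.
by rewrite mulnC -pw_mul // pw_idem.
Qed.

(* If [k <= 2 ^ n], then [n! k] divides [(n! 2 ^ n)!]; hence the order of [x ^ n!]
   exceeds [2 ^ n]. *)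
Definition large_order n (x : X) := clf x /\ ~ idempotents (pw x (n`! * 2 ^ n)`!).

Lemma large_order_le m n x : (m <= n)%N -> large_order n x -> large_order m x.
Proof.
move=> mn [cx nx]; split=> // ix; apply: nx.
rewrite (idem_pw_dvd _ _ _ ix) ?fact_gt0 //; apply: fact_dvd.
apply: leq_mul; last by rewrite leq_exp2l.
by apply: dvdn_leq; [exact: fact_gt0|exact: fact_dvd].
Qed.

Lemma large_order_pi n x k : large_order n x -> (0 < k <= 2 ^ n)%N ->
  pw (pw x n`!) k <> pi x.
Proof.
move=> [cx nx] /andP[k0 kn] E; apply: nx.
have nk0 : (0 < n`! * k)%N by rewrite muln_gt0 fact_gt0.
rewrite pw_mul ?fact_gt0 // in E.
have ix : idempotents (pw x (n`! * k)) by rewrite E; exact: pi_idem.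
rewrite (idem_pw_dvd _ nk0 _ ix) ?fact_gt0 //.
by rewrite dvdn_fact // nk0 leq_mul2l kn orbT.
Qed.

Lemma large_order_id n x k : large_order n x -> (1 < k <= 2 ^ n)%N ->
  pw (pw x n`!) k <> pw x n`!.
Proof.
case: k => [|[|k]] // xl /andP[_ kn] E.
have [cx _] := xl; have cz := clf_pw mulC per cx n`!.
have [y [cy yz zy]] := clf_inv mulC per cz.
apply: (large_order_pi (k := k.+1) xl); first exact: ltnW kn.
have /(congr1 (fun t => t * y)) := E.
rewrite pwSS (mulAC mulC) zy pi_pwn // => <-; rewrite -(pi_pwn mulC per x n`!).
by rewrite -[LHS](clf_pw mulC per cz) pi_pwn.
Qed.

(** If the idempotents were constant on a large set, an exponent [M] of their finite group would
    divide [(i! 2 ^ i)!] for large [i]. So an antichain can be extracted; thinning preserves the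
    orders because the indices only increase. *)
Lemma large_order_antichain : (forall n, exists x, large_order n x) ->
  exists x : nat -> X, (forall n, large_order n (x n)) /\
    forall i j, i <> j -> pi (x i) * pi (x j) <> pi (x i).
Proof.
move=> /choice[a aP].
have [u [uu _ ufin]] := free_ultrafilter infinite_nat.
have utail m : u [set i | (m <= i)%N].
  have := ultraN uu (ufin _ (finite_II m)); apply: filterS => i /=.
  by move/negP; rewrite -leqNgt.
have ncst : ~ ucst u (fun i => pi (a i)).
  move=> [c uc]; have [M M0 cM] := finite_exponent per (Hfin c).
  have [i [/= ic Mi]] := ultra_ex2 uu uc (utail M).
  have [ca na] := aP i; apply: na; have ia := cM _ (conj ca ic).
  rewrite (idem_pw_dvd _ M0 _ ia) ?fact_gt0 // dvdn_fact // M0 /=.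
  rewrite (leq_trans Mi) // (leq_trans (ltnW (ltn_expl i (ltnSn 1)))) //.
  by rewrite leq_pmull ?fact_gt0.
have inc := antichain_ultra mulC cf uu (fun i => pi_idem per (a i)) ncst.
have [|s [_ sR]] := @ultra_sequence _ u setT (fun i j => (i < j)%N /\
    (pi (a i) * pi (a j) <> pi (a i) /\ pi (a i) * pi (a j) <> pi (a j)))
    uu filterT.
  by apply: filterS inc => i ui; exact: filterI (utail i.+1) ui.
have sge n : (n <= s n)%N.
  by elim: n => // n IHn; apply: leq_ltn_trans IHn _; have [] := sR n n.+1 (ltnSn n).
exists (a \o s); split=> [n|i j ij] /=; first exact: large_order_le (sge n) (aP _).
have [{}ij|ji|//] := ltngtP i j; first by have [_ []] := sR _ _ ij.
by rewrite mulC; have [_ []] := sR _ _ ji.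
Qed.

Section OrderProbe.
Variable x : nat -> X.
Hypothesis xl : forall n, large_order n (x n).
Hypothesis xinc : forall i j, i <> j -> pi (x i) * pi (x j) <> pi (x i).
Variable u : set_system nat.
Hypothesis uu : UltraFilter u.
Hypothesis utail : forall m, u [set i | (m <= i)%N].

Let e i := pi (x i).
Let z i := pw (x i) i`!.
Let F : set_system X := x @ u.

Let eE i : idempotents (e i). Proof. exact: pi_idem. Qed.

Let ez i : e i * z i = z i.
Proof.
have [cx _] := xl i; rewrite -[RHS](clf_pw mulC per cx).
by rewrite pi_pwn.
Qed.

(** The exponent [i!] makes [pw y i!] equal to [pi y] for large [i], so each value is eventually
    zero or the unit [e i], as [udom] requires. *)
Definition order_char (y : X) : option (nat -> option X) :=
  Some (fun i => if `[< e i * pi y = e i >] then Some (pw (e i * y) i`!) else None).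

(** By incomparability the image of [x n] vanishes at every place except [n], where its entry is
    [z n]; such sequences converge to [None], which is the image of no element. *)
Lemma order_probe : exists p : probe F, forall y, pf p y <> plim p.
Proof.
pose T := order_tzs mulC uu utail eE ez (fun i k => large_order_pi (xl i))
  (fun i k => large_order_id (xl i)).
have fdom y : @dom T (order_char y).
  have [M M0 My] := pi_pw per y; exists M => i Mi.
  case: asboolP => ey; [right|by left].
  have yi : pw y i`! = pi y.
    by rewrite (idem_pw_dvd _ M0) ?fact_gt0 ?dvdn_fact ?M0 // My; exact: pi_idem.
  by rewrite pwM // pw_idem // yi ey.
have fM y t : order_char (y * t) = @op T (order_char y) (order_char t).
  congr Some; apply/funext => i; rewrite /bmul piM // mulgA.
  have [ey|ney] := asboolP (e i * pi y = e i); last first.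
    rewrite asboolF // => eyt; apply: ney.
    by rewrite -[in LHS]eyt (mulAC mulC) -(mulgA (e i)) pi_pi.
  rewrite ey; case: asboolP => //= _; congr Some.
  rewrite -pwM //; congr (pw _ _); rewrite (mulACA mulC).
  by rewrite (eE i).
have cvg (V : set T) : @nb T None V -> F [set y | V (order_char y)].
  move=> [P [m [uP _ mV]]]; change (u [set n | V (order_char (x n))]).
  apply: filterS2 uP (utail m) => n Pn mn.
  apply: mV; have other j : j <> n -> (if `[< e j * pi (x n) = e j >] then
      Some (pw (e j * x n) j`!) else None) = None.
    by move=> jn; rewrite asboolF //; exact: xinc.
  split=> [j jm|]; first by apply: other => jn; move: jm; rewrite jn ltnNge mn.
  exists n; split=> // [|j mj jn]; last by left; exact: other.
  rewrite asboolT; last exact: pi_pi.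
  by congr (Some (pw _ _)); have [] := xl n.
by exists (@Probe X F T order_char None fdom I fM cvg).
Qed.

Lemma large_order_absurd : False.
Proof.
have uP : ProperFilter u by exact: ultra_proper.
have FF : ProperFilter F by exact: fmap_proper_filter.
apply: (@not_injectively_closed X F FF _ _ Xcl) => [s t st|y]; last first.
  by have [p pE] := order_probe; exists p.
have ucx : u [set i | clf (x i)] by apply: filterS filterT => i _; have [] := xl i.
have [S [op [f [opA fM fst [c uc]]]]] := separation mulC per cf Hfin uu ucx st.
by have [p [psep _]] := discrete_probe FF opA fM uc; exists p; exact: psep.
Qed.

End OrderProbe.

Lemma closed_exponent : exists2 N, (0 < N)%N &
  forall x : X, clf x -> idempotents (pw x N).
Proof.
apply: contrapT => nN; have [|x [xl xinc]] := large_order_antichain.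
  move=> n; apply: contrapT => nx; apply: nN; exists (n`! * 2 ^ n)`! => [|x cx].
    exact: fact_gt0.
  by apply: contrapT => ix; apply: nx; exists x.
have [u [uu _ ufin]] := free_ultrafilter infinite_nat.
apply: (large_order_absurd xl xinc uu) => m.
have := ultraN uu (ufin _ (finite_II m)); apply: filterS => i /=.
by move/negP; rewrite -leqNgt.
Qed.

End ExponentBounded.

Theorem theorem1p9 (C : topologicalSemigroupType -> Prop)
    (TzS_sub_C : forall Y : topologicalSemigroupType, TzS Y -> C Y)
    (C_sub_T2S : forall Y : topologicalSemigroupType, C Y -> T2S Y)
    (X : semigroupType) (X_comm : forall x y : X, commute x y) :
  injectively_closed C X <->
  [/\ bounded_semigroup X, chain_finite X, group_finite X,
      ~ singular X & ~ Clifford_singular X].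
Proof.
have mulC (x y : X) : x * y = y * x by exact: X_comm.
split=> [XclC|[bd cf gf ns ncs]]; last first.
  move=> Y h CY; apply: (injectively_closed_T2S mulC) => //.
  exact: C_sub_T2S.
have Xcl : injectively_closed TzS X by move=> Y h /TzS_sub_C; exact: XclC.
have per := closed_periodic mulC Xcl; have cf := closed_chain_finite mulC Xcl.
have ncs := closed_clifford_nonsingular mulC Xcl.
split=> //.
- have [N N0 XN] := index_bounded mulC per cf ncs.
  have [n n0 Xn] := closed_exponent mulC Xcl.
  exists (N * n)%N => [|x]; first by rewrite muln_gt0 N0.
  by have := Xn _ (XN x); rewrite pw_mul.
- exact/(group_finiteP mulC per)/(closed_Hc_finite mulC Xcl).
- exact: closed_nonsingular mulC Xcl.
Qed.
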